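(* PGO promise-inference with the set consisting of the free terminal, fanout gates (with any number of outputs), the crossover, the OR gate, and the AND gate is coNP-hard.
   Context: A gadget consists of a finite set of ports, equipped with a cyclic order, and a constraint, which is a set of subsets of the ports. A network of gadgets from a set $S$ is a finite undirected multigraph in which each vertex is labeled with a gadget from $S$; if the label has $k$ ports, the vertex has degree $k$ and its edge incidences are in bijection with the ports of the label. A planar network is a network with a planar embedding such that the cyclic order of edges around each vertex matches the cyclic order of the ports of its label. An assignment orients every edge; a vertex is satisfied if the set of its ports whose edges point into the vertex belongs to its constraint; an assignment is satisfying if every vertex is satisfied. PGO promise-inference with $S$: the input is a planar network $N$ of gadgets from $S$ together with, for each vertex $v$, a semilocal constraint, which is a subset of the constraint of $v$'s gadget. An edge is locally forced if the semilocal constraint of one of its endpoints forces its orientation (the corresponding port lies in every element, or in no element, of that semilocal constraint), and locally free otherwise. It is promised that (i) in every satisfying assignment, for every vertex the set of edges pointing into it belongs to its semilocal constraint; and (ii) either (a) there is a locally free edge to which every satisfying assignment assigns the same orientation, or (b) for every vertex $v$ and every set $L$ in the semilocal constraint of $v$, some satisfying assignment makes exactly the edges of $L$ point into $v$. The question is whether (a) holds. Gadgets: free terminal: one port $a$, constraint $\{\emptyset,\{a\}\}$. $k$-way fanout gate: ports $a,c_1,\dots,c_k$, constraint $\{\{a\},\{c_1,\dots,c_k\}\}$. Crossover: ports $a_1,b_1,a_2,b_2$ in this cyclic order, constraint $\{\{a_1,b_1\},\{a_2,b_1\},\{a_1,b_2\},\{a_2,b_2\}\}$. OR gate: ports $a,b,c$,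 constraint $\{\{c\},\{a\},\{b\},\{a,b\}\}$. AND gate: ports $a,b,c$, constraint $\{\{c\},\{a,c\},\{b,c\},\{a,b\}\}$. *)

(* Defs.v *)
From mathcomp Require Import all_boot.
Set Implicit Arguments.
Unset Strict Implicit.
Unset Printing Implicit Defensive.

(* Tape alphabet: None = blank, Some (inl b) = bit b,                 *)
(* Some (inr g) = auxiliary symbol g from an arbitrary finite set.    *)

Record TM := MkTM {
  tm_state : finType;
  tm_aux : finType;
  tm_start : tm_state;
  tm_halt : pred tm_state;
  (* transition: new state, written symbol, move (true = right) *)
  tm_delta : tm_state -> option (bool + tm_aux) ->
             tm_state * option (bool + tm_aux) * bool
}.

Definition tsym (M : TM) := option (bool + tm_aux M).

(* configuration: state, left part (nearest cell first), head cell, right part *)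
Definition config (M : TM) := (tm_state M * seq (tsym M) * tsym M * seq (tsym M))%type.

Definition tm_init (M : TM) (x : seq bool) : config M :=
  let t := [seq Some (inl b) : tsym M | b <- x] in
  (@tm_start M, [::], head None t, behead t).

Definition tm_step (M : TM) (c : config M) : config M :=
  let: (q, l, h, r) := c in
  if @tm_halt M q then c else
  let: (q', w, dir) := @tm_delta M q h in
  if dir then (q', w :: l, head None r, behead r)
  else (q', behead l, head None l, w :: r).

Fixpoint read_bits (A : Type) (s : seq (option (bool + A))) : seq bool :=
  match s with
  | Some (inl b) :: s' => b :: read_bits s'
  | _ => [::]
  end.

Definition tm_output (M : TM) (c : config M) : seq bool :=
  let: (_, _, h, r) := c in read_bits (h :: r).

Definition tm_runs (M : TM) (x : seq bool) (t : nat) (y : seq bool) : Prop :=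
  let c := iter t (@tm_step M) (tm_init M x) in
  let: (q, _, _, _) := c in @tm_halt M q /\ tm_output c = y.

Definition poly_time_computable (f : seq bool -> seq bool) : Prop :=
  exists (M : TM) (c k : nat), forall x : seq bool,
    exists t, t <= c * (size x) ^ k + c /\ tm_runs M x t (f x).

Definition language := seq bool -> Prop.

(* self-delimiting pairing of strings *)
Definition pair_str (x w : seq bool) : seq bool :=
  flatten [seq [:: b; b] | b <- x] ++ [:: true; false] ++ w.

Definition in_NP (L : language) : Prop :=
  exists (V : seq bool -> seq bool) (c k : nat),
    poly_time_computable V /\
    forall x, L x <-> exists w : seq bool,
      size w <= c * (size x) ^ k + c /\ V (pair_str x w) = [:: true].

Definition in_coNP (L : language) : Prop := in_NP (fun x => ~ L x).

Definition coNP_hard_promise (YES NO : language) : Prop :=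
  forall L : language, in_coNP L ->
    exists f, poly_time_computable f /\
      forall x, (L x -> YES (f x)) /\ (~ L x -> NO (f x)).

(* 3. Gadgets.  Port subsets are bit vectors indexed by the ports in   *)
(* their listed (cyclic) order.                                         *)

Inductive gadget :=
| FreeTerminal            (* ports a *)
| Fanout of nat           (* Fanout k : ports a, c_1, ..., c_k *)
| Crossover               (* ports a1, b1, a2, b2 *)
| OrGate                  (* ports a, b, c *)
| AndGate.                (* ports a, b, c *)

Definition gdeg (g : gadget) : nat :=
  match g with
  | FreeTerminal => 1
  | Fanout k => k.+1
  | Crossover => 4
  | OrGate => 3
  | AndGate => 3
  end.

Definition gconstraint (g : gadget) : seq (seq bool) :=
  match g with
  | FreeTerminal => [:: [:: false]; [:: true]]
  | Fanout k => [:: true :: nseq k false; false :: nseq k true]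
  | Crossover => [:: [:: true; true; false; false];
                     [:: false; true; true; false];
                     [:: true; false; false; true];
                     [:: false; false; true; true]]
  | OrGate => [:: [:: false; false; true];
                  [:: true; false; false];
                  [:: false; true; false];
                  [:: true; true; false]]
  | AndGate => [:: [:: false; false; true];
                   [:: true; false; true];
                   [:: false; true; true];
                   [:: true; true; false]]
  end.

(* 4. Instances: a network as a rotation system plus semilocal          *)
(* constraints.  Vertices are 0..nV-1, vertex v has label lab`_v; its   *)
(* ports are the darts offs v + i (i < deg v); [mate] pairs darts into  *)
(* edges; semi`_v is the semilocal constraint of v.                     *)

Record instance := Inst {
  inst_lab : seq gadget;
  inst_mate : seq nat;
  inst_semi : seq (seq (seq bool))
}.

Section InstanceDefs.
Variable I : instance.

Definition nV := size (inst_lab I).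
Definition lab (v : nat) : gadget := nth FreeTerminal (inst_lab I) v.
Definition vdeg (v : nat) : nat := gdeg (lab v).
Definition offs (v : nat) : nat := sumn [seq gdeg g | g <- take v (inst_lab I)].
Definition nD : nat := sumn [seq gdeg g | g <- inst_lab I].
Definition dart (v i : nat) : nat := offs v + i.
Definition owner (d : nat) : nat := \sum_(v < nV) (offs v.+1 <= d).
Definition port (d : nat) : nat := d - offs (owner d).
Definition mt (d : nat) : nat := nth 0 (inst_mate I) d.
Definition semi (v : nat) : seq (seq bool) := nth [::] (inst_semi I) v.

Definition rot (d : nat) : nat :=
  dart (owner d) ((port d).+1 %% vdeg (owner d)).
(* face permutation of the rotation system *)
Definition facep (d : nat) : nat := rot (mt d).

Definition nFaces : nat :=
  \sum_(d < nD) [forall j : 'I_nD, d <= iter j facep d].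

Definition vadj : rel 'I_nV :=
  fun u v => [exists d : 'I_nD, (owner d == u) && (owner (mt d) == v)].

Definition nComponents : nat :=
  \sum_(v < nV) [forall u : 'I_nV, connect vadj v u ==> (v <= u)].

(* genus-0 rotation system: V - E + F = 2 * (#components), with E = nD/2 *)
Definition planar_embedding : Prop :=
  2 * nV + 2 * nFaces = nD + 4 * nComponents.

Definition valid_instance : Prop :=
  [/\ size (inst_mate I) = nD /\ size (inst_semi I) = nV,
      (forall v, v < nV -> forall k, lab v = Fanout k -> 0 < k),
      (forall d, d < nD -> [/\ mt d < nD, mt d != d & mt (mt d) = d]),
      (forall v, v < nV -> {subset semi v <= gconstraint (lab v)}) &
      planar_embedding].

(* an assignment: a d = true iff the edge of dart d points into owner d *)
Definition assignment := nat -> bool.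

Definition in_set (a : assignment) (v : nat) : seq bool :=
  mkseq (fun i => a (dart v i)) (vdeg v).

Definition satisfying (a : assignment) : Prop :=
  (forall d, d < nD -> a (mt d) = ~~ a d) /\
  (forall v, v < nV -> in_set a v \in gconstraint (lab v)).

Definition forced (v i : nat) : bool :=
  all (fun L => nth false L i) (semi v) || all (fun L => ~~ nth false L i) (semi v).

Definition locally_free (d : nat) : bool :=
  ~~ forced (owner d) (port d) && ~~ forced (owner (mt d)) (port (mt d)).

Definition promise_i : Prop :=
  forall a, satisfying a -> forall v, v < nV -> in_set a v \in semi v.

Definition cond_a : Prop :=
  exists d, [/\ d < nD, locally_free d &
    forall a1 a2, satisfying a1 -> satisfying a2 -> a1 d = a2 d].

Definition cond_b : Prop :=
  forall v, v < nV -> forall L, L \in semi v ->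
    exists a, satisfying a /\ in_set a v = L.

End InstanceDefs.

(* 5. Binary encoding of instances (injective prefix code).            *)

Definition enc_nat (n : nat) : seq bool := rcons (nseq n true) false.
Definition enc_list (T : Type) (e : T -> seq bool) (s : seq T) : seq bool :=
  enc_nat (size s) ++ flatten (map e s).
Definition enc_bool (b : bool) : seq bool := [:: b].
Definition gadget_code (g : gadget) : nat :=
  match g with
  | FreeTerminal => 0 | Crossover => 1 | OrGate => 2 | AndGate => 3
  | Fanout k => k + 4
  end.
Definition enc_instance (I : instance) : seq bool :=
  enc_list (fun g => enc_nat (gadget_code g)) (inst_lab I) ++
  enc_list enc_nat (inst_mate I) ++
  enc_list (enc_list (enc_list enc_bool)) (inst_semi I).

Definition PGO_YES : language := fun x =>
  exists I, [/\ x = enc_instance I, valid_instance I, promise_i I & cond_a I].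

Definition PGO_NO : language := fun x =>
  exists I, [/\ x = enc_instance I, valid_instance I, promise_i I,
                cond_b I & ~ cond_a I].

(* Main.v *)
(* The complement of a coNP language has a polynomial-time verifier, and a clause set says that some
   witness makes it accept. The clauses are drawn as a crossbar: variables are vertical wires, clauses
   are rows, and a chain of AND gates collects the rows. Every place where a column meets a row has its
   own free terminal, so every local configuration off the chain can be realized whether or not the
   formula is satisfiable, and all semilocal constraints are the full gadget constraints. The chain
   starts with the negation of an extra variable z that satisfies all rows. Hence the last edge of the
   chain is constantly false if the formula is unsatisfiable, and otherwise all configurations of all
   vertices occur.

   Planarity follows from Euler's inequality, so that it suffices to name enough faces. The reduction is
   a nest of loops over bounded counters that prints bits; such programs run on a Turing machine that
   keeps each counter as a mark on its own tape track. *)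

From HB Require Import structures.
Require Import Defs.
From mathcomp Require Import all_boot all_fingroup zify.
Set Implicit Arguments.
Unset Strict Implicit.
Unset Printing Implicit Defensive.

(** * Counter machines and their simulation by Turing machines *)

(** The obstacle is condition (b): the wires of an ordinary circuit are correlated, so many local
    configurations of its gates never occur. The free terminals remove the correlation without
    making the reduction unsound. All terminals true let a row compute its clause; terminals equal
    to the initial value of a row keep it constant, whatever the columns carry. A terminal enters
    only through an AND with a tapped column, or through an OR whose result is ANDed with the row,
    so it cannot make a row true when [z] and its clause are false. Only the chain therefore feels
    satisfiability: its gates need a true prefix, which is a solution, and a false prefix, which [z]
    or false terminals supply.

    The wiring depends on the numbers of rows and columns alone and the formula only selects labels,
    so one face count covers all instances and mates are printed by arithmetic.

    Time bounds are kept as powers of n + 2 through all layers, because these absorb constants and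
    are stable under products and substitution. *)

Definition upd (A : Type) (f : nat -> A) (r : nat) (v : A) : nat -> A :=
  fun s => if s == r then v else f s.

Inductive test :=
| TNe of nat & nat
| TBit of nat
| TIn of nat.

Inductive instr :=
| IZero of nat
| IInc of nat
| IOut of bool
| IJump of test & nat.

Definition cstate := (nat * (nat -> nat) * seq bool)%type.

Definition teval (x : seq bool) (f : nat -> nat) (t : test) : bool :=
  match t with
  | TNe r s => f r != f s
  | TBit r => nth false x (f r)
  | TIn r => f r < size x
  end.

Definition cstep (x : seq bool) (code : seq instr) (c : cstate) : cstate :=
  let: (pc, f, o) := c in
  match onth code pc with
  | Some (IZero r) => (pc.+1, upd f r 0, o)
  | Some (IInc r) => (pc.+1, upd f r (f r).+1, o)
  | Some (IOut b) => (pc.+1, f, rcons o b)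
  | Some (IJump t l) => (if teval x f t then pc.+1 else l, f, o)
  | None => c
  end.

Section TapeView.
Variable M : TM.

(* The machine [M] is in state [q], its head at cell [P] of the tape [tau]; cells left of 0 are blank. *)
Definition at_pos (q : tm_state M) (P : nat) (tau : nat -> tsym M) (c : config M) :=
  exists l h r, [/\ c = (q, l, h, r),
    forall k, nth None l k = if k < P then tau (P - k.+1) else None &
    forall k, nth None (h :: r) k = tau (P + k)].

Lemma at_pos_ext q P tau tau' c :
  tau =1 tau' -> at_pos q P tau c -> at_pos q P tau' c.
Proof.
move=> E [l [h [r [-> Hl Hr]]]]; exists l, h, r; split=> // k.
  by rewrite Hl; case: ifP; rewrite ?E.
by rewrite Hr E.
Qed.

Lemma nth_headbehead (A : Type) (x0 : A) s k :
  nth x0 (head x0 s :: behead s) k = nth x0 s k.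
Proof. by case: s => //=; case: k => //= k; rewrite nth_nil. Qed.

Lemma step_right q P tau c q' w :
  at_pos q P tau c -> ~~ @tm_halt M q -> @tm_delta M q (tau P) = (q', w, true) ->
  at_pos q' P.+1 (upd tau P w) (tm_step c).
Proof.
move=> [l [h [r [-> Hl Hr]]]] /negbTE Hq D /=; rewrite Hq.
have := D; have -> : tau P = h by have := Hr 0; rewrite addn0.
move=> ->; exists (w :: l), (head None r), (behead r); split=> // k.
  case: k => [|k] /=; first by rewrite subn1 /= /upd eqxx.
  by rewrite Hl ltnS subSS /upd; case: ifP => // kP; case: eqP => //; lia.
rewrite nth_headbehead; have := Hr k.+1 => /= ->.
by rewrite /upd; case: eqP; [lia | rewrite addSnnS].
Qed.

Lemma step_left q P tau c q' w :
  at_pos q P.+1 tau c -> ~~ @tm_halt M q -> @tm_delta M q (tau P.+1) = (q', w, false) ->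
  at_pos q' P (upd tau P.+1 w) (tm_step c).
Proof.
move=> [l [h [r [-> Hl Hr]]]] /negbTE Hq D /=; rewrite Hq.
have := D; have -> : tau P.+1 = h by have := Hr 0; rewrite addn0.
move=> ->; exists (behead l), (head None l), (w :: r); split=> // k.
  rewrite nth_behead Hl ltnS; case: ifP => // kP.
  by rewrite /upd; case: eqP; [lia | rewrite subSS].
case: k => [|k] /=.
  rewrite -nth0 Hl /= /upd; case: eqP; first lia.
  by rewrite subn1 addn0.
rewrite /upd; case: k => [|k] /=; first by rewrite addn1 eqxx.
case: eqP; first lia.
by have := Hr k.+1 => /= -> _; congr tau; lia.
Qed.

End TapeView.

Lemma isSome_onth (T : Type) (s : seq T) i : isSome (onth s i) = (i < size s).
Proof. by elim: s i => [|a s IH] [|i] //=; rewrite IH. Qed.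

Section Simulation.
Variable code : seq instr.

(** Only an upper bound on the registers and jump targets is needed, so sums replace maxima here and
    in [maxreg] and [maxpc]. *)
Definition treg (t : test) : nat :=
  match t with TNe r s => r + s | TBit r => r | TIn r => r end.
Definition ireg (i : instr) : nat :=
  match i with IZero r => r | IInc r => r | IOut _ => 0 | IJump t _ => treg t end.
Definition itgt (i : instr) : nat := if i is IJump _ l then l else 0.

Definition maxreg := sumn (map ireg code).
Definition maxpc := size code + sumn (map itgt code).

(* One track for the input, one mark track per register (the register's value is the position of its
   mark), and one track for the output. *)
Definition cell := (option bool * {ffun 'I_maxreg.+1 -> bool} * option bool)%type.
(** Triples of booleans are a finite type for free. An instruction sweeps right in [pSearch] to the
    cell it concerns and returns in [pBack]. A moved mark is written in [pPut]: on the next cell for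
    [IInc], and after a return in [pBackPut] on the first data cell for [IZero]. *)
Definition phase := (bool * bool * bool)%type.
Definition sst := ('I_maxpc.+1 * phase)%type.
Definition sym := option (bool + cell).

Definition pSearch : phase := (false, false, false).
Definition pPut : phase := (false, false, true).
Definition pBack : phase := (false, true, false).
Definition pBackPut : phase := (false, true, true).
Definition pBackHalt : phase := (true, false, false).
Definition pHalt : phase := (true, false, true).
Definition pInit : phase := (true, true, false).

Definition decode (s : sym) : cell :=
  match s with
  | None => (None, [ffun=> false], None)
  | Some (inl b) => (Some b, [ffun=> false], None)
  | Some (inr c) => c
  end.

Definition mark (c : cell) (r : nat) : bool := c.1.2 (inord r).
Definition setmark (c : cell) (r : nat) (v : bool) : cell :=
  (c.1.1, [ffun s => if s == inord r then v else c.1.2 s], c.2).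

Definition tregs (t : test) : seq nat :=
  match t with TNe r s => [:: r; s] | TBit r => [:: r] | TIn r => [:: r] end.

Definition tdecide (t : test) (c : cell) : bool :=
  match t with
  | TNe r s => ~~ (mark c r && mark c s)
  | TBit r => c.1.1 == Some true
  | TIn r => c.1.1 != None
  end.

Definition mkst (pc : nat) (ph : phase) : sst := (inord pc, ph).

(** Once the program has ended, the sweep replaces each cell by the bare bit of its output track and
    writes a blank behind the last one, the format that [tm_output] reads. *)
Definition search_delta (pc : nat) (c : cell) : sst * sym * bool :=
  let go := (mkst pc pSearch, Some (inr c) : sym, true) in
  match onth code pc with
  | Some (IZero r) =>
      if mark c r then (mkst pc pBackPut, Some (inr (setmark c r false)) : sym, false) else go
  | Some (IInc r) =>
      if mark c r then (mkst pc pPut, Some (inr (setmark c r false)) : sym, true) else go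
  | Some (IOut b) =>
      if c.2 is None then (mkst pc.+1 pBack, Some (inr (c.1, Some b)) : sym, false) else go
  | Some (IJump t l) =>
      if has (mark c) (tregs t) then
        (mkst (if tdecide t c then pc.+1 else l) pBack, Some (inr c) : sym, false)
      else go
  | None =>
      if c.2 is Some b then (mkst pc pSearch, Some (inl b) : sym, true)
      else (mkst pc pBackHalt, None : sym, false)
  end.

Definition put_delta (pc : nat) (c : cell) : sst * sym * bool :=
  let r := oapp ireg 0 (onth code pc) in
  (mkst pc.+1 pBack, Some (inr (setmark c r true)) : sym, false).

Definition back_delta (pc : nat) (ph ph' : phase) (s : sym) : sst * sym * bool :=
  if s is None then (mkst pc ph', None : sym, true) else (mkst pc ph, s, false).

Definition sim_delta (q : sst) (s : sym) : sst * sym * bool :=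
  let pc := val q.1 in
  match q.2 with
  | (false, false, false) => search_delta pc (decode s)
  | (false, false, true) => put_delta pc (decode s)
  | (false, true, false) => back_delta pc pBack pSearch s
  | (false, true, true) => back_delta pc pBackPut pPut s
  | (true, false, false) => back_delta pc pBackHalt pHalt s
  | (true, true, false) =>
      (mkst pc pBack, Some (inr ((decode s).1.1, [ffun=> true], None)) : sym, false)
  | _ => (q, s, true)
  end.

Definition simTM : TM :=
  @MkTM sst cell (mkst 0 pInit) (fun q => q.2 == pHalt) sim_delta.

Definition cell_of (x : seq bool) (f : nat -> nat) (o : seq bool) (p : nat) : cell :=
  (onth x p, [ffun r : 'I_maxreg.+1 => f r == p], onth o p).

(* The data start at cell 1; cell 0 stays blank and tells a head moving left where to turn back. *)
Definition simulates (x : seq bool) (c : cstate) (tc : config simTM) : Prop :=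
  let: (pc, f, o) := c in
  [/\ pc <= maxpc & exists tau : nat -> sym, 
    [/\ @at_pos simTM (mkst pc pSearch) 1 tau tc, tau 0 = None &
        forall p, decode (tau p.+1) = cell_of x f o p]].

(** Visited cells are rewritten as non-blank symbols even if they hold nothing; otherwise the way
    back would mistake them for the blank cell 0. *)
Lemma sweep (q : sst) (tau : nat -> sym) (tc : config simTM) k :
  q.2 != pHalt ->
  @at_pos simTM q 1 tau tc ->
  (forall p, p < k -> sim_delta q (tau p.+1) = (q, Some (inr (decode (tau p.+1))), true)) ->
  exists tau', [/\ @at_pos simTM q k.+1 tau' (iter k (@tm_step _) tc),
    forall p, decode (tau' p) = decode (tau p), tau' 0 = tau 0,
    forall p, k < p -> tau' p = tau p &
    forall p, 0 < p <= k -> tau' p <> None].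
Proof.
move=> Hq Hat; elim: k => [|k IH] H.
  by exists tau; split=> // p; case: p.
have [p Hp|tau' [Ha Hd H0 Hgt Hn]] := IH; first by apply: H; lia.
exists (upd tau' k.+1 (Some (inr (decode (tau k.+1))))); split.
- by apply: (@step_right simTM) Ha _ _; rewrite //= Hgt // H.
- by move=> p; rewrite /upd; case: eqP => [->|].
- by rewrite /upd.
- by move=> p Hp; rewrite /upd; case: eqP => [E|_]; [lia | apply: Hgt; lia].
- by move=> p Hp; rewrite /upd; case: eqP => // E; apply: Hn; lia.
Qed.

Lemma go_back pc (ph ph' : phase) (tau : nat -> sym) (tc : config simTM) P :
  pc <= maxpc -> (ph, ph') \in [:: (pBack, pSearch); (pBackPut, pPut); (pBackHalt, pHalt)] ->
  @at_pos simTM (mkst pc ph) P tau tc -> tau 0 = None ->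
  (forall p, 0 < p <= P -> tau p <> None) ->
  @at_pos simTM (mkst pc ph') 1 tau (iter P.+1 (@tm_step _) tc).
Proof.
move=> Hpc Hph Hat H0 Hn.
have D s : sim_delta (mkst pc ph) s = back_delta pc ph ph' s.
  move: Hph; rewrite /sim_delta !inE !xpair_eqE /= inordK //.
  by case/or3P => /andP [/eqP -> /eqP ->].
have Hh : (mkst pc ph).2 != pHalt.
  by move: Hph; rewrite !inE !xpair_eqE /=; case/or3P => /andP [/eqP -> _].
elim: P tc Hat Hn => [|P IH] tc Hat Hn.
  have := @step_right simTM _ _ _ _ (mkst pc ph') None Hat Hh.
  rewrite /= D H0 => /(_ erefl) /=; apply: at_pos_ext => p.
  by rewrite /upd; case: eqP => [->|].
rewrite iterSr; apply: IH => [|p Hp]; last by apply: Hn; lia.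
have HP : tau P.+1 <> None by apply: Hn; lia.
have := @step_left simTM _ _ _ _ (mkst pc ph) (tau P.+1) Hat Hh.
rewrite /= D /back_delta; case E : (tau P.+1) HP => [s|] // _ /(_ erefl).
by apply: at_pos_ext => p; rewrite /upd; case: eqP => [->|].
Qed.

Lemma onth_sumn (T : Type) (h : T -> nat) (s : seq T) i a :
  onth s i = Some a -> h a <= sumn (map h s).
Proof.
elim: s i => [|b s IH] [|i] //=; first by case=> ->; rewrite leq_addr.
by move=> /IH H; lia.
Qed.

Lemma mark_cell x f o p r : r <= maxreg -> mark (cell_of x f o p) r = (f r == p).
Proof. by move=> H; rewrite /mark /= ffunE inordK. Qed.

Lemma setmark_cell x f o p q r : r <= maxreg ->
  setmark (cell_of x f o p) r (p == q) = cell_of x (upd f r q) o p.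
Proof.
move=> H; rewrite /setmark /cell_of /=; congr (_, _, _).
apply/ffunP => s; rewrite !ffunE /upd.
have -> : (s == inord r) = (nat_of_ord s == r).
  by rewrite -val_eqE /= inordK.
by case: eqP => // _; rewrite eq_sym.
Qed.

Lemma simulates_back x pc f o P (tau : nat -> sym) (tc : config simTM) :
  pc <= maxpc ->
  @at_pos simTM (mkst pc pBack) P tau tc -> tau 0 = None ->
  (forall p, 0 < p <= P -> tau p <> None) ->
  (forall p, decode (tau p.+1) = cell_of x f o p) ->
  simulates x (pc, f, o) (iter P.+1 (@tm_step _) tc).
Proof.
move=> Hpc Hat H0 Hn Hd; split=> //; exists tau; split=> //.
by apply: go_back Hat H0 Hn => //; rewrite !inE eqxx.
Qed.

Lemma simulates_found x pc pc' f o f' o' (c' : cell) P (tau : nat -> sym) (tc : config simTM) :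
  pc <= maxpc -> pc' <= maxpc ->
  @at_pos simTM (mkst pc pSearch) P.+1 tau tc -> tau 0 = None ->
  (forall p, 0 < p <= P -> tau p <> None) ->
  (forall p, decode (tau p.+1) = cell_of x f o p) ->
  search_delta pc (cell_of x f o P) = (mkst pc' pBack, Some (inr c'), false) ->
  c' = cell_of x f' o' P ->
  (forall p, p <> P -> cell_of x f o p = cell_of x f' o' p) ->
  simulates x (pc', f', o') (iter P.+2 (@tm_step _) tc).
Proof.
move=> Hpc Hpc' Hat H0 Hn Hd Hs Hc' Ho; rewrite iterSr.
have D : sim_delta (mkst pc pSearch) (tau P.+1) = (mkst pc' pBack, Some (inr c'), false).
  by rewrite /sim_delta /= inordK // Hd.
have {Hat} := @step_left simTM _ _ _ _ _ _ Hat isT D => Hat.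
apply: (simulates_back Hpc' Hat).
- by rewrite /upd.
- by move=> p Hp; rewrite /upd; case: eqP => // _; apply: Hn.
- move=> p; rewrite /upd eqSS; case: eqP => [->|Hp]; first exact: Hc'.
  by rewrite Hd Ho.
Qed.

Lemma simulates_put x pc f f' o r P (tau : nat -> sym) (tc : config simTM) :
  pc < maxpc -> r <= maxreg -> oapp ireg 0 (onth code pc) = r ->
  @at_pos simTM (mkst pc pPut) P.+1 tau tc -> tau 0 = None ->
  (forall p, 0 < p <= P -> tau p <> None) ->
  (forall p, decode (tau p.+1) = setmark (cell_of x f o p) r false) ->
  (forall p, cell_of x f' o p = cell_of x (upd f r P) o p) ->
  simulates x (pc.+1, f', o) (iter P.+2 (@tm_step _) tc).
Proof.
move=> Hpc Hr Hi Hat H0 Hn Hd Hf; rewrite iterSr.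
have D : sim_delta (mkst pc pPut) (tau P.+1) =
   (mkst pc.+1 pBack, Some (inr (setmark (decode (tau P.+1)) r true)), false).
  by rewrite /sim_delta /= /put_delta inordK ?Hi //; apply: ltnW.
have {Hat} := @step_left simTM _ _ _ _ _ _ Hat isT D => Hat.
apply: (simulates_back Hpc Hat).
- by rewrite /upd.
- by move=> p Hp; rewrite /upd; case: eqP => // _; apply: Hn.
- have E p : setmark (setmark (cell_of x f o p) r false) r (p == P) =
             setmark (cell_of x f o p) r (p == P).
    by rewrite /setmark /=; congr (_, _, _); apply/ffunP => s; rewrite !ffunE; case: eqP.
  move=> p; rewrite /upd eqSS Hf -setmark_cell // -E -Hd.
  case: eqP => [->|] //=; rewrite Hd /setmark /= => _.
  by congr (_, _, _); apply/ffunP => s; rewrite !ffunE; case: eqP.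
Qed.

Lemma search_go x pc f o (tau : nat -> sym) (tc : config simTM) P :
  pc <= maxpc ->
  @at_pos simTM (mkst pc pSearch) 1 tau tc -> tau 0 = None ->
  (forall p, decode (tau p.+1) = cell_of x f o p) ->
  (forall p, p < P -> search_delta pc (cell_of x f o p) =
     (mkst pc pSearch, Some (inr (cell_of x f o p)), true)) ->
  exists tau', [/\ @at_pos simTM (mkst pc pSearch) P.+1 tau' (iter P (@tm_step _) tc),
    tau' 0 = None, forall p, 0 < p <= P -> tau' p <> None &
    forall p, decode (tau' p.+1) = cell_of x f o p].
Proof.
move=> Hpc Hat H0 Hd Hgo.
have [//|p Hp|tau' [Ha Hd' H0' _ Hn]] := @sweep _ tau tc P _ Hat.
  by rewrite /sim_delta /= inordK // Hd Hgo.
exists tau'; split=> //; first by rewrite H0'.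
by move=> p; rewrite Hd' Hd.
Qed.

(** All marks and the end of the output lie within distance [E], and an instruction is one sweep
    there and back. *)
Lemma sim_step x c (tc : config simTM) E :
  simulates x c tc -> c.1.1 < size code ->
  (forall r, r <= maxreg -> c.1.2 r <= E) -> size c.2 <= E ->
  exists2 k, k <= 2 * E + 5 & simulates x (cstep x code c) (iter k (@tm_step _) tc).
Proof.
case: c => [[pc f] o] [Hpc [tau [Hat H0 Hd]]] /= Hsz HE Ho.
have Hpc' : pc < maxpc by rewrite /maxpc; lia.
case Ei : (onth code pc) => [i|]; last first.
  by move: Hsz; rewrite -isSome_onth Ei.
have Hireg := onth_sumn ireg Ei; rewrite -/maxreg in Hireg.
have Htgt : itgt i <= maxpc by have := onth_sumn itgt Ei; rewrite /maxpc; lia.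
case: i Ei Hireg Htgt => [r|r|b|t l] Ei /= Hr Htgt.
- have [p Hp|tau' [Ha H0' Hn Hd']] := @search_go x pc f o tau tc (f r) Hpc Hat H0 Hd.
    by rewrite /search_delta Ei mark_cell //; case: eqP => //; lia.
  have D : sim_delta (mkst pc pSearch) (tau' (f r).+1) =
     (mkst pc pBackPut, Some (inr (setmark (decode (tau' (f r).+1)) r false)), false).
    by rewrite /sim_delta /= inordK // Hd' /search_delta Ei mark_cell // eqxx.
  have Hb := @step_left simTM _ _ _ _ _ _ Ha isT D.
  exists (2 + ((f r).+1 + (1 + f r))); first by have := HE _ Hr; lia.
  have {}Hb := @go_back _ pBackPut pPut _ _ _ Hpc isT Hb.
  rewrite !iterD; apply: (@simulates_put x pc f _ o r 0 _ _ Hpc' Hr _ (Hb _ _)) => //.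
  + by rewrite Ei.
  + by move=> p Hp; rewrite /upd; case: eqP => // _; apply: Hn.
  + by move=> p Hp; lia.
  + move=> p; rewrite /upd eqSS; case: eqP => [->|Hp] /=; first by rewrite Hd'.
    rewrite Hd' /setmark; congr (_, _, _); apply/ffunP => s; rewrite !ffunE.
    by case: (s =P inord r) => [->|] //; rewrite inordK //; apply/eqP => E1; case: Hp.
- have [p Hp|tau' [Ha H0' Hn Hd']] := @search_go x pc f o tau tc (f r) Hpc Hat H0 Hd.
    by rewrite /search_delta Ei mark_cell //; case: eqP => //; lia.
  have D : sim_delta (mkst pc pSearch) (tau' (f r).+1) =
     (mkst pc pPut, Some (inr (setmark (decode (tau' (f r).+1)) r false)), true).
    by rewrite /sim_delta /= inordK // Hd' /search_delta Ei mark_cell // eqxx.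
  have Hb := @step_right simTM _ _ _ _ _ _ Ha isT D.
  exists ((f r).+3 + (1 + f r)); first by have := HE _ Hr; lia.
  rewrite !iterD; apply: (@simulates_put x pc f _ o r (f r).+1 _ _ Hpc' Hr _ Hb) => //.
  + by rewrite Ei.
  + by move=> p Hp; rewrite /upd; case: eqP => // E1; apply: Hn; lia.
  + move=> p; rewrite /upd eqSS; case: eqP => [->|Hp] /=; first by rewrite Hd'.
    rewrite Hd' /setmark; congr (_, _, _); apply/ffunP => s; rewrite !ffunE.
    by case: (s =P inord r) => [->|] //; rewrite inordK //; apply/eqP => E1; case: Hp.
- have [p Hp|tau' [Ha H0' Hn Hd']] := @search_go x pc f o tau tc (size o) Hpc Hat H0 Hd.
    rewrite /search_delta Ei /=; case Eo : (onth o p) => //.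
    by move: Hp; rewrite -isSome_onth Eo.
  have Eo q : onth (rcons o b) q = if q == size o then Some b else onth o q.
    by elim: (o) q => [|a s IH] [|q] //=; case: q.
  have Eo0 : onth o (size o) = None by elim: (o).
  exists ((size o).+2 + size o); first lia.
  rewrite iterD; apply: (@simulates_found x pc pc.+1 f o _ _ _ (size o) _ _ Hpc Hpc' Ha H0' Hn Hd').
  + by rewrite /search_delta Ei /= Eo0.
  + by rewrite /cell_of /= Eo eqxx.
  + by move=> p /eqP/negbTE Hp; rewrite /cell_of Eo Hp.
- have HP : exists2 P, P <= E & (forall p, p < P -> ~~ has (mark (cell_of x f o p)) (tregs t)) /\
     has (mark (cell_of x f o P)) (tregs t) /\ tdecide t (cell_of x f o P) = teval x f t.
    have Hbit p : (onth x p == Some true) = nth false x p.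
      by elim: (x) p => [|[] s IH] [|p] //=.
    have Hin p : (onth x p != None) = (p < size x).
      by elim: (x) p => [|[] s IH] [|p] //=.
    case: t Ei Hr => [r s|r|r] Ei /= Hr.
    (* The sweep stops at the first mark of either register; the values are equal exactly if both
       marks are in that cell. *)
    + exists (minn (f r) (f s)); first by have := HE r; lia.
      rewrite !orbF !mark_cell; try lia; split; first by move=> p Hp; rewrite !mark_cell; lia.
      by split; lia.
    + exists (f r); first exact: HE.
      by rewrite mark_cell // eqxx; split=> // p Hp; rewrite mark_cell //; lia.
    + exists (f r); first exact: HE.
      by rewrite mark_cell // eqxx; split=> // p Hp; rewrite mark_cell //; lia.
  case: HP => P HPE [Hlt [Hhas Hdec]].
  have [p Hp|tau' [Ha H0' Hn Hd']] := @search_go x pc f o tau tc P Hpc Hat H0 Hd.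
    by rewrite /search_delta Ei (negbTE (Hlt _ Hp)).
  exists (P.+2 + P); first lia.
  rewrite iterD; apply: (@simulates_found x pc _ f o _ _ _ P _ _ Hpc _ Ha H0' Hn Hd') => //.
  + by case: ifP.
  + by rewrite /search_delta Ei Hhas Hdec Hd.
Qed.
Lemma sim_halt x pc f o (tc : config simTM) :
  simulates x (pc, f, o) tc -> size code <= pc ->
  let c := iter (size o).*2.+2 (@tm_step _) tc in
  let: (q, _, _, _) := c in @tm_halt simTM q /\ tm_output c = o.
Proof.
case=> Hpc [tau [Hat H0 Hd]] Hsz.
have Ei : onth code pc = None by case: onth (isSome_onth code pc) => //=; lia.
have [tau' [Ha Hs Hl H0' Hn]] : exists tau' : nat -> sym, 
   [/\ @at_pos simTM (mkst pc pSearch) (size o).+1 tau' (iter (size o) (@tm_step _) tc),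
    forall p, size o <= p -> tau' p.+1 = tau p.+1,
    forall p, p < size o -> tau' p.+1 = Some (inl (nth false o p)),
    tau' 0 = None & forall p, 0 < p <= size o -> tau' p <> None].
  have: size o <= size o by [].
  elim: {1 3 4 5 6 7}(size o) => [|k IH] Hk.
    by exists tau; split=> // p; lia.
  have [|tau' [Ha Hs Hl H0' Hn]] := IH; first lia.
  have D : sim_delta (mkst pc pSearch) (tau' k.+1) =
     (mkst pc pSearch, Some (inl (nth false o k)), true).
    rewrite /sim_delta /= inordK // Hs // Hd /search_delta Ei /=.
    case Eo : (onth o k) (isSome_onth o k) => [b|] /=; last by rewrite Hk.
    by move=> _; elim: (o) (k) Eo => [|a s IHs] [|j] //= => [[->]|/IHs].
  exists (upd tau' k.+1 (Some (inl (nth false o k)))); split.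
  - exact: (@step_right simTM _ _ _ _ _ _ Ha isT D).
  - by move=> p Hp; rewrite /upd; case: eqP => [|_]; [lia | apply: Hs; lia].
  - move=> p Hp; rewrite /upd; case: eqP => [[->] //|E1]; apply: Hl; lia.
  - by rewrite /upd.
  - by move=> p Hp; rewrite /upd; case: eqP => // E1; apply: Hn; lia.
have D : sim_delta (mkst pc pSearch) (tau' (size o).+1) = (mkst pc pBackHalt, None, false).
  rewrite /sim_delta /= inordK // Hs // Hd /search_delta Ei /=.
  by case: onth (isSome_onth o (size o)) => //=; rewrite ltnn.
have Hb := @step_left simTM _ _ _ _ _ _ Ha isT D.
have {}Hb := @go_back _ pBackHalt pHalt _ _ _ Hpc isT Hb.
have -> : (size o).*2.+2 = (size o).+1 + (1 + size o) by lia.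
move=> c; rewrite {}/c.
rewrite !iterD [iter 1 _ _]/=; have [||l [h [r [-> _ Hr]]]] := Hb.
- by rewrite /upd.
- by move=> p Hp; rewrite /upd; case: eqP => [|_]; [lia | apply: Hn].
split=> //=; rewrite -/(read_bits (h :: r)).
have : forall k, k <= size o -> nth None (h :: r) k =
         if k < size o then Some (inl (nth false o k)) else None.
  move=> k Hk; rewrite Hr add1n /upd eqSS; case: (ltngtP k (size o)) Hk => // Hk _.
  by rewrite Hl.
elim: (o) (h :: r) => [|b s IH] [|a t] H //=.
- by have /= -> := H 0 isT.
- by have := H 0 isT.
- by have /= -> := H 0 isT; rewrite IH // => k Hk; apply: (H k.+1).
Qed.

(** The first input symbol counts as cell 1. One step puts the marks of all registers there, which
    means value 0, and moves to the blank cell 0; the second step turns around. *)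
Lemma sim_init x :
  simulates x (0, fun=> 0, [::]) (iter 2 (@tm_step _) (tm_init simTM x)).
Proof.
pose xs : seq sym := [seq Some (inl b) | b <- x].
pose tau p : sym := if p is p'.+1 then nth None xs p' else None.
have Hat : @at_pos simTM (mkst 0 pInit) 1 tau (tm_init simTM x).
  exists [::], (head None xs), (behead xs); split=> // k.
    by rewrite nth_nil; case: k.
  by rewrite nth_headbehead.
have D : sim_delta (mkst 0 pInit) (tau 1) =
   (mkst 0 pBack, Some (inr ((decode (tau 1)).1.1, [ffun=> true], None)), false).
  by rewrite /sim_delta /= inordK.
have Hd p : decode (tau p.+1) = (onth x p, [ffun=> false], None).
  by rewrite /tau /xs; elim: (x) p => [|b s IH] [|p] //=; rewrite ?nth_nil // IH.
have Hb := @step_left simTM _ _ _ _ _ _ Hat isT D.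
rewrite (iterSr 1); apply: (simulates_back (P := 0) _ Hb) => //.
  by move=> p; lia.
move=> p; rewrite /upd eqSS; case: eqP => [->|Hp] /=; rewrite ?Hd /=.
  by congr (_, _, _); apply/ffunP => s; rewrite !ffunE.
congr (_, _, _); first by apply/ffunP => s; rewrite !ffunE; case: p Hp.
by case: p Hp.
Qed.

(** Registers and output grow by at most one per instruction, so each of the first [k] instructions
    costs O(k) and the simulation is quadratic. *)
Lemma sim_run x k : 
  let c := iter k (cstep x code) (0, fun=> 0, [::]) in
  [/\ forall r, c.1.2 r <= k, size c.2 <= k &
  exists2 t, t <= 2 + k * (2 * k + 5) & simulates x c (iter t (@tm_step _) (tm_init simTM x))].
Proof.
elim: k => [|k IH] /=; first by split=> //; exists 2 => //; exact: sim_init.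
case: (iter k _ _) IH => [[pc f] o] [/= Hf Ho [t Ht Hsim]].
have [Hpc|Hpc] := ltnP pc (size code).
  have [t' Ht' Hsim'] := @sim_step x (pc, f, o) _ k Hsim Hpc (fun r _ => Hf r) Ho.
  split; last by exists (t' + t); rewrite ?iterD //; nia.
    move=> r; case Ei : onth => [[s|s|b|u l]|] //=; rewrite /upd; try exact: leqW.
      by case: eqP => // _; apply: leqW.
    by case: eqP => // _; rewrite ?ltnS //; apply: leqW.
  by case Ei : onth => [[s|s|b|u l]|] //=; rewrite ?size_rcons //; apply: leqW.
have -> : onth code pc = None by case: onth (isSome_onth code pc) => //=; lia.
split=> /=; [by move=> r; apply: leqW | exact: leqW |].
by exists t => //; nia.
Qed.

End Simulation.

(** For n > 0 one has n + 2 <= 3 * n; the additive constant covers n = 0. *)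
Lemma exp_le_poly (n K : nat) : (n + 2) ^ K <= 3 ^ K * n ^ K + 3 ^ K.
Proof.
case: n => [|n].
  by apply: leq_trans (leq_addl _ _); case: K => // K; rewrite leq_exp2r.
apply: leq_trans (leq_addr _ _); rewrite -expnMn.
by case: K => // K; rewrite leq_exp2r //; lia.
Qed.

Theorem counter_poly (code : seq instr) (F : seq bool -> seq bool) (K : nat) :
  (forall x, exists k pc f, [/\ k <= (size x + 2) ^ K, size code <= pc &
     iter k (cstep x code) (0, fun=> 0, [::]) = (pc, f, F x)]) ->
  poly_time_computable F.
Proof.
(* The exponent doubles because the simulation is quadratic; 20 generously bounds the coefficients
   of the simulation and of the final output pass. *)
move=> H; exists (simTM code), (20 * 3 ^ (2 * K)), (2 * K) => x.
have [k [pc [f [Hk Hpc Hrun]]]] := H x.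
have /= := sim_run code x k; rewrite Hrun => -[_ /= Ho [t Ht Hsim]].
exists ((size (F x)).*2.+2 + t); split; last first.
  by rewrite /tm_runs iterD; exact: (@sim_halt code x pc f (F x) _ Hsim Hpc).
have := exp_le_poly (size x) (2 * K); rewrite mulnC expnM.
set B := (size x + 2) ^ K in Hk *; have HB : 0 < B by rewrite expn_gt0; lia.
nia.
Qed.

(** * A language of bit generators *)

Inductive prog :=
| PSkip
| PZero of nat
| PInc of nat
| POut of bool
| PSeq of prog & prog
| PIf of test & prog & prog
| PWhile of test & prog.

Definition pstate := ((nat -> nat) * seq bool)%type.

(** The costs count instructions of the compiled code: a first branch of [PIf] and each round of
    [PWhile] pay for the test and for a closing [goto]. *)
Inductive exec (x : seq bool) : prog -> pstate -> nat -> pstate -> Prop :=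
| ex_skip s : exec x PSkip s 0 s
| ex_zero r f o : exec x (PZero r) (f, o) 1 (upd f r 0, o)
| ex_inc r f o : exec x (PInc r) (f, o) 1 (upd f r (f r).+1, o)
| ex_out b f o : exec x (POut b) (f, o) 1 (f, rcons o b)
| ex_seq p1 p2 s1 s2 s3 k1 k2 :
    exec x p1 s1 k1 s2 -> exec x p2 s2 k2 s3 -> exec x (PSeq p1 p2) s1 (k1 + k2) s3
| ex_if_true t p1 p2 s s' k :
    teval x s.1 t -> exec x p1 s k s' -> exec x (PIf t p1 p2) s (k + 2) s'
| ex_if_false t p1 p2 s s' k :
    ~~ teval x s.1 t -> exec x p2 s k s' -> exec x (PIf t p1 p2) s (k + 1) s'
| ex_while_false t p s : ~~ teval x s.1 t -> exec x (PWhile t p) s 1 s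
| ex_while_true t p s s' s'' k k' :
    teval x s.1 t -> exec x p s k s' -> exec x (PWhile t p) s' k' s'' ->
    exec x (PWhile t p) s (k + k' + 2) s''.

(** A jump is taken when its test fails, and a register never differs from itself. *)
Definition goto (l : nat) : instr := IJump (TNe 0 0) l.

Fixpoint comp (p : prog) (pc : nat) : seq instr :=
  match p with
  | PSkip => [::]
  | PZero r => [:: IZero r]
  | PInc r => [:: IInc r]
  | POut b => [:: IOut b]
  | PSeq p1 p2 => let c1 := comp p1 pc in c1 ++ comp p2 (pc + size c1)
  | PIf t p1 p2 =>
      let c1 := comp p1 pc.+1 in
      let m := (pc + size c1).+2 in
      let c2 := comp p2 m in
      IJump t m :: c1 ++ goto (m + size c2) :: c2
  | PWhile t p =>
      let c := comp p pc.+1 in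
      IJump t (pc + size c).+2 :: rcons c (goto pc)
  end.

Definition code_at (code : seq instr) (pc : nat) (c : seq instr) : Prop :=
  exists pre post, code = pre ++ c ++ post /\ size pre = pc.

Lemma code_at_cat code pc c1 c2 :
  code_at code pc (c1 ++ c2) -> code_at code pc c1 /\ code_at code (pc + size c1) c2.
Proof.
case=> pre [post [-> <-]]; split; first by exists pre, (c2 ++ post); rewrite !catA.
by exists (pre ++ c1), post; rewrite !catA size_cat.
Qed.

Lemma code_at_cons code pc i c :
  code_at code pc (i :: c) -> onth code pc = Some i /\ code_at code pc.+1 c.
Proof.
rewrite -cat1s => /code_at_cat [[pre [post [-> <-]]] H]; split; last by move: H; rewrite addn1.
by elim: pre {H} => //=.
Qed.

Lemma cstep_jump x code pc t l f o : onth code pc = Some (IJump t l) ->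
  cstep x code (pc, f, o) = (if teval x f t then pc.+1 else l, f, o).
Proof. by rewrite /cstep => ->. Qed.

Lemma iter1 (T : Type) (f : T -> T) c : iter 1 f c = f c.
Proof. by []. Qed.

Lemma comp_correct x p s k s' : exec x p s k s' ->
  forall code pc, code_at code pc (comp p pc) ->
  iter k (cstep x code) (pc, s.1, s.2) = (pc + size (comp p pc), s'.1, s'.2).
Proof.
elim=> {p s k s'}.
- by move=> s code pc _; rewrite addn0.
- by move=> r f o code pc /code_at_cons [/= -> _]; rewrite addn1.
- by move=> r f o code pc /code_at_cons [/= -> _]; rewrite addn1.
- by move=> r f o code pc /code_at_cons [/= -> _]; rewrite addn1.
- move=> p1 p2 s1 s2 s3 k1 k2 _ IH1 _ IH2 code pc /= /code_at_cat [H1 H2].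
  by rewrite addnC iterD IH1 // IH2 // size_cat addnA.
- move=> t p1 p2 s s' k Ht _ IH code pc /= /code_at_cons [H0 /code_at_cat [H1 /code_at_cons [H2 H3]]].
  have -> : k + 2 = 1 + (k + 1) by lia.
  rewrite !iterD !iter1 (cstep_jump _ _ _ H0) Ht IH // (cstep_jump _ _ _ H2) /= eqxx /=.
  by rewrite size_cat /=; congr (_, _, _); lia.
- move=> t p1 p2 s s' k Ht _ IH code pc /= /code_at_cons [H0 /code_at_cat [H1 /code_at_cons [H2 H3]]].
  rewrite addn1 iterSr /= H0 (negbTE Ht) IH //.
  by rewrite size_cat /=; congr (_, _, _); lia.
- move=> t p s Ht code pc /= /code_at_cons [H0 _].
  by rewrite H0 (negbTE Ht) size_rcons; congr (_, _, _); lia.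
- move=> t p s s' s'' k k' Ht _ IH1 _ IH2 code pc /= H.
  have [H0] := code_at_cons H; rewrite -{1}cats1 => /code_at_cat [H1 /code_at_cons [H2 _]].
  have -> : k + k' + 2 = k' + (1 + (k + 1)) by lia.
  by rewrite !iterD !iter1 (cstep_jump _ _ _ H0) Ht IH1 // (cstep_jump _ _ _ H2) /= eqxx IH2.
Qed.

Lemma upd_same (A : Type) (f : nat -> A) r v : upd f r v r = v.
Proof. by rewrite /upd eqxx. Qed.

Lemma upd_other (A : Type) (f : nat -> A) r v s : s <> r -> upd f r v s = f s.
Proof. by rewrite /upd => /eqP/negbTE ->. Qed.

Definition PFor (i b : nat) (p : prog) : prog :=
  PSeq (PZero i) (PWhile (TNe i b) (PSeq p (PInc i))).

(** A round costs the body, the increment and two jumps; clearing the counter and the last test add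
    2. The invariant refers to the state after the increment. *)
Lemma exec_for x i b p (Inv : nat -> pstate -> Prop) N C : i != b ->
  (forall j s, j < N -> Inv j s -> s.1 i = j -> s.1 b = N ->
     exists k s', [/\ k <= C, exec x p s k s', s'.1 i = j, s'.1 b = N &
       Inv j.+1 (upd s'.1 i j.+1, s'.2)]) ->
  forall s, s.1 b = N -> Inv 0 (upd s.1 i 0, s.2) ->
  exists k s', [/\ k <= N * (C + 3) + 2, exec x (PFor i b p) s k s', s'.1 b = N & Inv N s'].
Proof.
move=> Hib Hbody s Hb H0.
have : forall m j s, m + j = N -> Inv j s -> s.1 i = j -> s.1 b = N ->
  exists k s', [/\ k <= m * (C + 3) + 1,
    exec x (PWhile (TNe i b) (PSeq p (PInc i))) s k s', s'.1 b = N & Inv N s'].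
  elim=> [|m IH] j [f o] Hm HI /= Hi Hbj.
    exists 1, (f, o); split=> //; last by rewrite -Hm.
    by apply: ex_while_false; rewrite /= Hi Hbj -Hm eqxx.
  have [|k1 [[f1 o1] [Hk1 E1 /= Hi1 Hb1 HI1]]] := Hbody j (f, o) _ HI Hi Hbj; first lia.
  have [|||k2 [s2 [Hk2 E2 Hb2 HI2]]] := IH j.+1 (upd f1 i j.+1, o1) _ HI1.
  - lia.
  - by rewrite /= /upd eqxx.
  - by rewrite /= /upd eq_sym (negbTE Hib).
  exists (k1 + 1 + k2 + 2), s2; split=> //; first lia.
  apply: ex_while_true E2; first by rewrite /= Hi Hbj; lia.
  by apply: ex_seq E1 _; rewrite -Hi1; apply: ex_inc.
case: s Hb H0 => f o /= Hb H0 /(_ N 0 (upd f i 0, o)).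
case=> //; first by rewrite addn0.
- by rewrite /= /upd eqxx.
- by rewrite /= /upd eq_sym (negbTE Hib).
move=> k [s' [Hk E1 Hb1 HI]]; exists (1 + k), s'; split=> //; first lia.
by apply: ex_seq E1; apply: ex_zero.
Qed.

(** * Arithmetic expressions and bit generators with nested loops *)

Inductive expr :=
| EVar of nat
| ECst of nat
| EAdd of expr & expr
| EMul of expr & expr
| EPred of expr
| EEq of expr & expr
| ELt of expr & expr
| EInp of expr.

Fixpoint eval (x : seq bool) (env : nat -> nat) (e : expr) : nat :=
  match e with
  | EVar i => env i
  | ECst c => c
  | EAdd e1 e2 => eval x env e1 + eval x env e2
  | EMul e1 e2 => eval x env e1 * eval x env e2
  | EPred e => (eval x env e).-1
  | EEq e1 e2 => eval x env e1 == eval x env e2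
  | ELt e1 e2 => eval x env e1 < eval x env e2
  | EInp e => nth false x (eval x env e)
  end.

Inductive gen :=
| GNil
| GBit of bool
| GSeq of gen & gen
| GIf of expr & gen & gen
| GFor of expr & gen.

(* [d] is the binding depth: the enclosing loops are the variables below [d], and a [GFor] binds [d]. *)
Fixpoint geval (x : seq bool) (d : nat) (env : nat -> nat) (g : gen) : seq bool :=
  match g with
  | GNil => [::]
  | GBit b => [:: b]
  | GSeq g1 g2 => geval x d env g1 ++ geval x d env g2
  | GIf e g1 g2 => if eval x env e != 0 then geval x d env g1 else geval x d env g2
  | GFor e g => flatten [seq geval x d.+1 (upd env d i) g | i <- iota 0 (eval x env e)]
  end.

(* Variable [i] lives in register [2 * i]; register [2 * i + 1] holds the bound of its loop. *)
Definition PCopy (r s : nat) : prog := PSeq (PZero r) (PWhile (TNe r s) (PInc r)).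

(** The value goes to register [b] and all scratch registers lie above it, so the loop counters and
    bounds below survive. [EPred] keeps the last value of a counter that runs below the argument;
    [ELt] increments [b] when a counter running below the second value meets the first, which
    happens once or never. *)
Fixpoint cexp (d : nat) (e : expr) (b : nat) : prog :=
  match e with
  | EVar i => if i < d then PCopy b i.*2 else PZero b
  | ECst c => PSeq (PZero b) (iter c (PSeq (PInc b)) PSkip)
  | EAdd e1 e2 =>
      PSeq (cexp d e1 b) (PSeq (cexp d e2 b.+1) (PFor b.+2 b.+1 (PInc b)))
  | EMul e1 e2 =>
      PSeq (cexp d e1 b.+1) (PSeq (cexp d e2 b.+2)
        (PSeq (PZero b) (PFor b.+3 b.+1 (PFor b.+4 b.+2 (PInc b)))))
  | EPred e =>
      PSeq (cexp d e b.+1) (PSeq (PZero b) (PFor b.+2 b.+1 (PCopy b b.+2)))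
  | EEq e1 e2 =>
      PSeq (cexp d e1 b.+1) (PSeq (cexp d e2 b.+2)
        (PSeq (PZero b) (PIf (TNe b.+1 b.+2) PSkip (PInc b))))
  | ELt e1 e2 =>
      PSeq (cexp d e1 b.+1) (PSeq (cexp d e2 b.+2)
        (PSeq (PZero b) (PFor b.+3 b.+2 (PIf (TNe b.+3 b.+1) PSkip (PInc b)))))
  | EInp e =>
      PSeq (cexp d e b.+1) (PSeq (PZero b) (PIf (TBit b.+1) (PInc b) PSkip))
  end.

Fixpoint cgen (d : nat) (g : gen) : prog :=
  let b := d.*2 in
  match g with
  | GNil => PSkip
  | GBit c => POut c
  | GSeq g1 g2 => PSeq (cgen d g1) (cgen d g2)
  | GIf e g1 g2 =>
      PSeq (cexp d e b) (PSeq (PZero b.+1) (PIf (TNe b b.+1) (cgen d g1) (cgen d g2)))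
  | GFor e g => PSeq (cexp d e b.+1) (PFor b b.+1 (cgen d.+1 g))
  end.

(** A total-correctness Hoare triple with a time bound. *)
Definition runs (x : seq bool) (p : prog) (s : pstate) (C : nat) (P : pstate -> Prop) :=
  exists k s', [/\ k <= C, exec x p s k s' & P s'].

Lemma runs_seq x p1 p2 s C1 C2 C (P1 P2 : pstate -> Prop) :
  C1 + C2 <= C -> runs x p1 s C1 P1 -> (forall s', P1 s' -> runs x p2 s' C2 P2) ->
  runs x (PSeq p1 p2) s C P2.
Proof.
move=> HC [k1 [s1 [Hk1 E1 H1]]] /(_ _ H1) [k2 [s2 [Hk2 E2 H2]]].
by exists (k1 + k2), s2; split=> //; [lia | apply: ex_seq E1 E2].
Qed.

Lemma runs_zero x r f o (P : pstate -> Prop) : P (upd f r 0, o) -> runs x (PZero r) (f, o) 1 P.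
Proof. by move=> H; exists 1, (upd f r 0, o); split=> //; apply: ex_zero. Qed.

Lemma runs_inc x r f o (P : pstate -> Prop) :
  P (upd f r (f r).+1, o) -> runs x (PInc r) (f, o) 1 P.
Proof. by move=> H; eexists 1, _; split; [ | apply: ex_inc | ]. Qed.

Lemma runs_if x t p1 p2 s C (P : pstate -> Prop) :
  (teval x s.1 t -> runs x p1 s C P) -> (~~ teval x s.1 t -> runs x p2 s C P) ->
  runs x (PIf t p1 p2) s (C + 2) P.
Proof.
case E : (teval x s.1 t) => H1 H2.
  have [k [s' [Hk E1 HP]]] := H1 isT; exists (k + 2), s'; split=> //; first lia.
  exact: ex_if_true.
have [k [s' [Hk E1 HP]]] := H2 isT; exists (k + 1), s'; split=> //; first lia.
by apply: ex_if_false => //; rewrite E.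
Qed.

Lemma runs_skip x s (P : pstate -> Prop) C : P s -> runs x PSkip s C P.
Proof. by move=> H; exists 0, s; split=> //; apply: ex_skip. Qed.

Lemma runs_weaken x p s C C' (P P' : pstate -> Prop) :
  C <= C' -> (forall s', P s' -> P' s') -> runs x p s C P -> runs x p s C' P'.
Proof. by move=> HC H [k [s' [Hk E HP]]]; exists k, s'; split=> //; [lia | apply: H]. Qed.

Lemma runs_for x i b p (Inv : nat -> pstate -> Prop) N C C' s : i != b ->
  N * (C + 3) + 2 <= C' ->
  (forall j s, j < N -> Inv j s -> s.1 i = j -> s.1 b = N ->
     runs x p s C (fun s' => [/\ s'.1 i = j, s'.1 b = N & Inv j.+1 (upd s'.1 i j.+1, s'.2)])) ->
  s.1 b = N -> Inv 0 (upd s.1 i 0, s.2) ->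
  runs x (PFor i b p) s C' (fun s' => Inv N s' /\ s'.1 b = N).
Proof.
move=> Hib HC Hbody Hb H0.
have [j t Hj HI Hi Hbt|k [s' [Hk E Hb' HI]]] := @exec_for x i b p Inv N C Hib _ s Hb H0.
  by have [k [s' [Hk E [? ? ?]]]] := Hbody j t Hj HI Hi Hbt; exists k, s'.
by exists k, s'; split=> //; lia.
Qed.

(** The register function built by the loop agrees only pointwise with a single update, so the
    postcondition is required for every such function. *)
Lemma runs_copy x r s f o (P : pstate -> Prop) C : r != s -> 3 * f s + 2 <= C ->
  (forall f', f' =1 upd f r (f s) -> P (f', o)) -> runs x (PCopy r s) (f, o) C P.
Proof.
move=> Hrs HC HP; apply: (@runs_seq x _ _ _ 1 (3 * f s + 1) _ 
  (fun t => exists j, [/\ t.2 = o, t.1 =1 upd f r j & j <= f s])); first lia.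
  by apply: runs_zero; exists 0.
case=> g o' [j [/= -> Hg Hj]].
have: exists m, m + j = f s by exists (f s - j); lia.
case=> m Hm; have {HC} : 3 * m + 1 <= 3 * f s + 1 by lia.
have Hgs : g s = f s by rewrite Hg /upd eq_sym (negbTE Hrs).
have Hgr : g r = j by rewrite Hg /upd eqxx.
move: (3 * f s + 1) => C1.
elim: m j g Hg Hj Hm Hgs Hgr C1 => [|m IH] j g Hg Hj Hm Hgs Hgr C1 HC.
  exists 1, (g, o); split; first lia.
    by apply: ex_while_false; rewrite /= Hgs Hgr -Hm eqxx.
  by apply: HP => t; rewrite Hg -Hm.
have [||||||k [s' [Hk E Hs']]] := IH j.+1 (upd g r j.+1) _ _ _ _ _ (3 * m + 1).
- by move=> t; rewrite /upd Hg /upd; case: eqP.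
- lia.
- lia.
- by rewrite /upd eq_sym (negbTE Hrs).
- by rewrite /upd eqxx.
- by [].
exists (1 + k + 2), s'; split=> //; first lia.
apply: ex_while_true E; first by rewrite /= Hgs Hgr; lia.
by rewrite -Hgr; apply: ex_inc.
Qed.

(** As B + 2 >= 2, four further factors absorb the constant 16; this keeps every bound a pure
    power. *)
Lemma pow_bound B K1 K2 a :
  a <= 16 * (B + 2) ^ K1 * (B + 2) ^ K2 -> a <= (B + 2) ^ (K1 + K2 + 4).
Proof.
move=> H; apply: leq_trans H _; rewrite !expnD.
have : 2 ^ 4 <= (B + 2) ^ 4 by rewrite leq_exp2r //; lia.
by nia.
Qed.

Definition env_ok (d : nat) (env f : nat -> nat) (B : nat) : Prop :=
  [/\ forall i, i < d -> f i.*2 = env i, forall i, d <= i -> env i = 0 & forall i, env i <= B].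

Lemma env_ok_agree d env f f' B b : env_ok d env f B -> d.*2 <= b ->
  (forall r, r < b -> f' r = f r) -> env_ok d env f' B.
Proof. by case=> H1 H2 H3 Hb Hf; split=> // i Hi; rewrite Hf ?H1 //; lia. Qed.

(** The exponent is chosen before the input, the environment and the bound [B]; this uniformity is
    what polynomial time means here. *)
Lemma cexp_correct d e b : d.*2 <= b -> exists K, forall x env f o B, env_ok d env f B ->
  eval x env e <= (B + 2) ^ K /\
  runs x (cexp d e b) (f, o) ((B + 2) ^ K) (fun s =>
    [/\ s.2 = o, s.1 b = eval x env e & forall r, r < b -> s.1 r = f r]).
Proof.
have posp B K : 0 < (B + 2) ^ K by rewrite expn_gt0; lia.
elim: e b => [i|c|e1 IH1 e2 IH2|e1 IH1 e2 IH2|e1 IH1|e1 IH1 e2 IH2|e1 IH1 e2 IH2|e1 IH1] b Hb.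
- exists 3 => x env f o B [H1 H2 H3] /=.
  have HB : 3 * B + 2 <= (B + 2) ^ 3 by rewrite !expnS expn0; nia.
  split; first by have := H3 i; lia.
  case: ifP => Hi.
    apply: runs_copy; first by apply/eqP; lia.
      by rewrite H1 //; have := H3 i; lia.
    move=> f' Hf'; split=> //= [|r Hr]; rewrite Hf' /upd ?eqxx ?H1 //.
    by case: eqP => //; lia.
  apply: runs_weaken (runs_zero x (P := fun s => s = (upd f b 0, o)) erefl); first lia.
  move=> _ -> /=; rewrite /upd eqxx H2 //; last lia.
  by split=> // r Hr; case: eqP => //; lia.
- exists c.+1 => x env f o B _ /=.
  have Hc : c.+1 <= (B + 2) ^ c.+1 by apply: ltnW; apply: ltn_expl; lia.
  split; first lia.
  apply: (@runs_seq x _ _ _ 1 c _ (fun s => [/\ s.2 = o, s.1 b + c = c & forall r, r < b -> s.1 r = f r])).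
  + lia.
  + by apply: runs_zero; split; rewrite //= /upd ?eqxx // => r Hr; case: eqP => //; lia.
  + case=> g o' [/= -> Hg Hr].
    suff: forall m g, g b + m = c -> (forall r, r < b -> g r = f r) ->
      runs x (iter m (PSeq (PInc b)) PSkip) (g, o) m
        (fun s => [/\ s.2 = o, s.1 b = c & forall r, r < b -> s.1 r = f r]) by apply.
    elim=> [|m IH] g1 Hg1 Hr1; first by apply: runs_skip; split=> //=; lia.
    apply: (@runs_seq x _ _ _ 1 m _ (fun s => s = (upd g1 b (g1 b).+1, o))) => //.
      by apply: runs_inc.
    move=> _ ->; apply: IH; first by rewrite /upd eqxx; lia.
    by move=> r Hr2; rewrite /upd; case: eqP; [lia | rewrite Hr1].
- have [K1 H1] := IH1 b Hb; have [K2 H2] := IH2 b.+1 (leqW Hb).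
  exists (K1 + K2 + 4) => x env f o B He.
  have {H1} [v1 r1] := H1 x env f o B He.
  split=> /=.
    have [v2 _] := H2 x env f o B He; apply: pow_bound; have := posp B K1; have := posp B K2; nia.
  apply: (@runs_seq x _ _ _ ((B+2)^K1) (5 * (B+2)^K2 + 2) _ _ _ _ r1).
    by apply: pow_bound; have := posp B K1; have := posp B K2; nia.
  case=> g o' [/= -> Hg Hr].
  have [v2 r2] := H2 x env g o B (env_ok_agree He Hb Hr).
  apply: (@runs_seq x _ _ _ ((B+2)^K2) (4 * (B+2)^K2 + 2) _ _ _ _ r2); first lia.
  case=> g2 o2 [/= -> Hg2 Hr2].
  apply: runs_weaken (@runs_for x _ _ _ (fun j s => [/\ s.2 = o, s.1 b = eval x env e1 + j &
       forall r, r < b -> s.1 r = f r]) (eval x env e2) 1 _ (g2, o) _ (leqnn _) _ Hg2 _) => //.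
  + by nia.
  + by move=> s [].
  + by apply/eqP; lia.
  + move=> j [h oh] Hj [/= -> Hh Hrh] Hi Hbb; apply: runs_inc; split.
    * by rewrite /= /upd; case: eqP => //; lia.
    * by rewrite /= /upd; case: eqP => //; lia.
    * split=> //=; first by rewrite /upd eqxx; case: eqP; lia.
      by move=> r Hrr; rewrite /upd; do 2 (case: eqP; first lia); rewrite Hrh.
  + split=> //= [|r Hrr]; rewrite /upd; (case: eqP; first lia) => _.
      by rewrite Hr2 // addn0.
    by rewrite Hr2 ?Hr //; lia.
- have [K1 H1] := IH1 b.+1 (leqW Hb); have [K2 H2] := IH2 b.+2 (leqW (leqW Hb)).
  exists (K1 + K2 + 4) => x env f o B He.
  have {H1} [v1 r1] := H1 x env f o B He.
  have p1 := posp B K1; have p2 := posp B K2.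
  split=> /=.
    have [v2 _] := H2 x env f o B He; apply: pow_bound; nia.
  apply: (@runs_seq x _ _ _ ((B+2)^K1) (15 * (B+2)^K1 * (B+2)^K2 - (B+2)^K1) _ _ _ _ r1).
    by apply: pow_bound; nia.
  case=> g o' [/= -> Hg Hr].
  have [v2 r2] := H2 x env g o B (env_ok_agree He (leqW Hb) Hr).
  apply: (@runs_seq x _ _ _ ((B+2)^K2) ((B+2)^K1 * (4 * (B+2)^K2 + 5) + 3) _ _ _ _ r2); first nia.
  case=> g2 o2 [/= -> Hg2 Hr2].
  apply: (@runs_seq x _ _ _ 1 ((B+2)^K1 * (4 * (B+2)^K2 + 5) + 2) _ (fun s => s = (upd g2 b 0, o))).
  + by lia.
  + by apply: runs_zero.
  move=> _ ->.
  pose v := eval x env e2.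
  apply: runs_weaken (@runs_for x _ _ _ (fun j s => [/\ s.2 = o, s.1 b = j * v, s.1 b.+2 = v &
       forall r, r < b -> s.1 r = f r]) (eval x env e1) (4 * v + 2) _ _ _ (leqnn _) _ _ _) => //.
  + by rewrite -/v in v2; nia.
  + by move=> s [[]].
  + by apply/eqP; lia.
  + move=> j [h oh] Hj [/= -> Hh Hhv Hrh] Hi Hbb.
    apply: runs_weaken (@runs_for x _ _ _ (fun i s => [/\ s.2 = o, s.1 b = j * v + i,
       s.1 b.+1 = eval x env e1, s.1 b.+3 = j & forall r, r < b -> s.1 r = f r])
       v 1 _ _ _ (leqnn _) _ _ _) => //.
    * by nia.
    * case=> h2 o3 [[/= -> E1 E2 E3 Hr3] E4]; split=> //; split=> //=.
      - by rewrite /upd; case: eqP; nia.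
      - by rewrite /upd; case: eqP; lia.
      - by move=> r Hrr; rewrite /upd; case: eqP; [lia | rewrite Hr3].
    * by apply/eqP; lia.
    * move=> i [h2 o3] Hi2 [/= -> E1 E2 E3 Hr3] E4 E5; apply: runs_inc; split=> /=;
        last split=> //=.
      - by rewrite /upd; case: eqP; lia.
      - by rewrite /upd; case: eqP; lia.
      - by rewrite /upd eqxx; case: eqP; lia.
      - by rewrite /upd; do 2 (case: eqP; first lia).
      - by rewrite /upd; do 2 (case: eqP; first lia).
      - by move=> r Hrr; rewrite /upd; do 2 (case: eqP; first lia); rewrite Hr3.
    * split=> //=; try by (rewrite /upd; case: eqP; [lia | rewrite ?addn0]).
      by move=> r Hrr; rewrite /upd; case: eqP; [lia | rewrite Hrh].
  + by rewrite /= /upd; case: eqP; [lia | rewrite Hr2].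
  + split=> //=.
    * by rewrite /upd; case: eqP; [lia | rewrite eqxx].
    * by rewrite /upd; do 2 (case: eqP; first lia); rewrite Hg2.
    * by move=> r Hrr; rewrite /upd; do 2 (case: eqP; first lia); rewrite Hr2 ?Hr //; lia.
- have [K1 H1] := IH1 b.+1 (leqW Hb).
  exists (K1 + K1 + 4) => x env f o B He.
  have {H1} [v1 r1] := H1 x env f o B He.
  have p1 := posp B K1; set v := eval x env e1 in v1 *.
  split=> /=; first by apply: pow_bound; rewrite -/v; nia.
  apply: (@runs_seq x _ _ _ ((B+2)^K1) (15 * (B+2)^K1 * (B+2)^K1) _ _ _ _ r1).
    by apply: pow_bound; nia.
  case=> g o' [/= -> Hg Hr].
  apply: (@runs_seq x _ _ _ 1 (v * (3 * v + 5) + 2) _ (fun s => s = (upd g b 0, o))).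
  + by nia.
  + by apply: runs_zero.
  move=> _ ->.
  apply: runs_weaken (@runs_for x _ _ _ (fun j s => [/\ s.2 = o, s.1 b = j.-1 &
       forall r, r < b -> s.1 r = f r]) v (3 * v + 2) _ _ _ (leqnn _) _ _ _) => //.
  + by nia.
  + by move=> s [].
  + by apply/eqP; lia.
  + move=> j [h oh] Hj [/= -> Hh Hrh] Hi Hbb; apply: runs_copy.
    * by apply/eqP; lia.
    * by rewrite Hi; nia.
    * move=> f' Hf'; split=> /=; last split=> //=.
      - by rewrite Hf' /upd; case: eqP; lia.
      - by rewrite Hf' /upd; case: eqP; lia.
      - by rewrite /upd; case: eqP; [lia | rewrite Hf' /upd eqxx].
      - by move=> r Hrr; rewrite /upd Hf' /upd; do 2 (case: eqP; first lia); rewrite Hrh.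
  + by rewrite /= /upd; case: eqP; [lia | rewrite Hg].
  + split=> //=.
    * by rewrite /upd; case: eqP; [lia | rewrite eqxx].
    * by move=> r Hrr; rewrite /upd; do 2 (case: eqP; first lia); rewrite Hr //; lia.
- have [K1 H1] := IH1 b.+1 (leqW Hb); have [K2 H2] := IH2 b.+2 (leqW (leqW Hb)).
  exists (K1 + K2 + 4) => x env f o B He.
  have {H1} [v1 r1] := H1 x env f o B He.
  have p1 := posp B K1; have p2 := posp B K2.
  split=> /=; first by apply: pow_bound; nia.
  apply: (@runs_seq x _ _ _ ((B+2)^K1) ((B+2)^K2 + 4) _ _ _ _ r1).
    by apply: pow_bound; nia.
  case=> g o' [/= -> Hg Hr].
  have [v2 r2] := H2 x env g o B (env_ok_agree He (leqW Hb) Hr).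
  apply: (@runs_seq x _ _ _ ((B+2)^K2) 4 _ _ _ _ r2); first lia.
  case=> g2 o2 [/= -> Hg2 Hr2].
  apply: (@runs_seq x _ _ _ 1 3 _ (fun s => s = (upd g2 b 0, o))) => //.
    by apply: runs_zero.
  move=> _ ->; apply: (@runs_if _ _ _ _ _ 1) => /=.
    rewrite !upd_other; try lia.
    rewrite Hg2 Hr2 // Hg => /negbTE ->; apply: runs_skip; split=> //=.
      by rewrite /upd eqxx.
    by move=> r Hrr; rewrite upd_other; [rewrite Hr2 ?Hr //; lia | lia].
  rewrite !upd_other; try lia.
  rewrite Hg2 Hr2 // Hg negbK => ->; apply: runs_inc; split=> //=.
    by rewrite /upd !eqxx.
  by move=> r Hrr; do 2 (rewrite upd_other; last lia); rewrite Hr2 ?Hr //; lia.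
- have [K1 H1] := IH1 b.+1 (leqW Hb); have [K2 H2] := IH2 b.+2 (leqW (leqW Hb)).
  exists (K1 + K2 + 4) => x env f o B He.
  have {H1} [v1 r1] := H1 x env f o B He.
  have p1 := posp B K1; have p2 := posp B K2.
  split=> /=; first by apply: pow_bound; nia.
  apply: (@runs_seq x _ _ _ ((B+2)^K1) (7 * (B+2)^K2 + 3) _ _ _ _ r1).
    by apply: pow_bound; nia.
  case=> g o' [/= -> Hg Hr].
  have [v2 r2] := H2 x env g o B (env_ok_agree He (leqW Hb) Hr).
  apply: (@runs_seq x _ _ _ ((B+2)^K2) (6 * (B+2)^K2 + 3) _ _ _ _ r2); first lia.
  case=> g2 o2 [/= -> Hg2 Hr2].
  apply: (@runs_seq x _ _ _ 1 (6 * (B+2)^K2 + 2) _ (fun s => s = (upd g2 b 0, o))); first lia.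
    by apply: runs_zero.
  move=> _ ->.
  apply: runs_weaken (@runs_for x _ _ _ (fun j s => [/\ s.2 = o, s.1 b = (eval x env e1 < j),
       s.1 b.+1 = eval x env e1 & forall r, r < b -> s.1 r = f r]) (eval x env e2) 3 _ _ _ (leqnn _) _ _ _) => //.
  + by nia.
  + by move=> s [[]].
  + by apply/eqP; lia.
  + move=> j [h oh] Hj [/= -> Hh Hh1 Hrh] Hi Hbb; apply: (@runs_if _ _ _ _ _ 1) => /=;
      rewrite Hi Hh1.
    * move=> /eqP Hne; apply: runs_skip; split=> //; split=> //=.
      - by rewrite /upd; case: eqP; [lia | rewrite Hh; lia].
      - by rewrite /upd; case: eqP; [lia | rewrite Hh1].
      - by move=> r Hrr; rewrite /upd; case: eqP; [lia | rewrite Hrh].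
    * move=> /negPn /eqP Hje; apply: runs_inc; split=> /=; last split=> //=.
      - by rewrite /upd; case: eqP; lia.
      - by rewrite /upd; case: eqP; lia.
      - by rewrite /upd eqxx; case: eqP; [lia | rewrite Hh; lia].
      - by rewrite /upd; do 2 (case: eqP; first lia); rewrite Hh1.
      - by move=> r Hrr; rewrite /upd; do 2 (case: eqP; first lia); rewrite Hrh.
  + by rewrite /= /upd; case: eqP; [lia | rewrite Hg2].
  + split=> //=.
    * by rewrite /upd; case: eqP; [lia | rewrite eqxx].
    * by rewrite /upd; do 2 (case: eqP; first lia); rewrite Hr2.
    * by move=> r Hrr; rewrite /upd; do 2 (case: eqP; first lia); rewrite Hr2 ?Hr //; lia.
- have [K1 H1] := IH1 b.+1 (leqW Hb).
  exists (K1 + 0 + 4) => x env f o B He.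
  have {H1} [v1 r1] := H1 x env f o B He.
  have p1 := posp B K1.
  split=> /=; first by apply: pow_bound; rewrite expn0; case: nth => /=; lia.
  apply: (@runs_seq x _ _ _ ((B+2)^K1) 4 _ _ _ _ r1).
    by apply: pow_bound; rewrite expn0; lia.
  case=> g o' [/= -> Hg Hr].
  apply: (@runs_seq x _ _ _ 1 3 _ (fun s => s = (upd g b 0, o))) => //.
    by apply: runs_zero.
  move=> _ ->; apply: (@runs_if _ _ _ _ _ 1) => /=;
    (rewrite upd_other; last lia); rewrite Hg.
    move=> ->; apply: runs_inc; split=> //=; first by rewrite /upd !eqxx.
    by move=> r Hrr; do 2 (rewrite upd_other; last lia); rewrite Hr //; lia.
  move=> /negbTE ->; apply: runs_skip; split=> //=; first by rewrite /upd !eqxx.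
  by move=> r Hrr; rewrite /upd; case: eqP; [lia | rewrite Hr //; lia].
Qed.

Lemma flatten_iotaS (T : Type) (h : nat -> seq T) j :
  flatten [seq h i | i <- iota 0 j.+1] = flatten [seq h i | i <- iota 0 j] ++ h j.
Proof. by rewrite -addn1 iotaD map_cat flatten_cat /= cats0. Qed.

Lemma cgen_correct d g : exists K, forall x env f o B, env_ok d env f B ->
  runs x (cgen d g) (f, o) ((B + 2) ^ K) (fun s =>
    s.2 = o ++ geval x d env g /\ forall r, r < d.*2 -> s.1 r = f r).
Proof.
have posp B K : 0 < (B + 2) ^ K by rewrite expn_gt0; lia.
elim: g d => [|c|g1 IH1 g2 IH2|e g1 IH1 g2 IH2|e g IH] d.
- by exists 0 => x env f o B _; apply: runs_skip; rewrite cats0.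
- exists 0 => x env f o B _; exists 1, (f, rcons o c); split=> //; first exact: ex_out.
  by rewrite /= cats1.
- have [K1 H1] := IH1 d; have [K2 H2] := IH2 d.
  exists (K1 + K2 + 4) => x env f o B He /=.
  apply: (runs_seq _ (H1 x env f o B He)).
    by apply: (@pow_bound B K1 K2 ((B+2)^K1 + (B+2)^K2)); have := posp B K1; have := posp B K2; nia.
  case=> f1 o1 /= [-> Hf1].
  apply: runs_weaken (H2 x env f1 _ B (env_ok_agree He (leqnn _) Hf1)) => // s [-> Hs].
  by rewrite catA; split=> // r Hr; rewrite Hs ?Hf1.
- have [K0 H0] := cexp_correct e (leqnn d.*2); have [K1 H1] := IH1 d; have [K2 H2] := IH2 d.
  exists (K0 + (K1 + K2) + 4) => x env f o B He /=.
  have [v0 r0] := H0 x env f o B He.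
  have p0 := posp B K0; have p1 := posp B K1; have p2 := posp B K2.
  apply: (@runs_seq x _ _ _ ((B+2)^K0) (1 + ((B+2)^K1 + (B+2)^K2 + 2)) _ _ _ _ r0).
    apply: pow_bound; rewrite expnD.
    have : (B + 2) ^ K1 + (B + 2) ^ K2 <= (B + 2) ^ K1 * (B + 2) ^ K2 + 1 by nia.
    have : 0 < (B + 2) ^ K1 * (B + 2) ^ K2 by rewrite muln_gt0 p1 p2.
    by move: (_ ^ K1 * _) => Y; nia.
  case=> f1 o1 /= [-> Hv Hf1].
  apply: (@runs_seq x _ _ _ 1 _ _ (fun s => s = (upd f1 d.*2.+1 0, o)) _ (leqnn _)).
    by apply: runs_zero.
  move=> _ ->; have He1 : env_ok d env (upd f1 d.*2.+1 0) B.
    apply: (env_ok_agree He (leqnn _)) => r Hr.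
    by rewrite upd_other ?Hf1 //; lia.
  apply: runs_if => /=; (rewrite upd_other; last lia); rewrite Hv upd_same.
    move=> ->; apply: runs_weaken (H1 x env _ o B He1); first lia.
    move=> s [-> Hs]; split=> // r Hr; rewrite Hs // upd_other ?Hf1 //; lia.
  move=> /negbTE ->; apply: runs_weaken (H2 x env _ o B He1); first lia.
  move=> s [-> Hs]; split=> // r Hr; rewrite Hs // upd_other ?Hf1 //; lia.
- have [K0 H0] := cexp_correct e (leqnSn d.*2); have [K1 H1] := IH d.+1.
  exists (K0 + (K0 + 2) * K1 + 4) => x env f o B He /=.
  have [v0 r0] := H0 x env f o B He.
  set N := eval x env e in v0 *.
  set Y := (B + 2) ^ ((K0 + 2) * K1).
  have p0 := posp B K0; have p1 : 0 < Y by apply: posp.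
  apply: (@runs_seq x _ _ _ ((B+2)^K0) (N * (Y + 3) + 2) _ _ _ _ r0).
    by apply: pow_bound; rewrite -/Y; nia.
  case=> f1 o1 /= [-> Hv Hf1].
  apply: runs_weaken (@runs_for x _ _ _ (fun j s => s.2 = o ++ flatten [seq
     geval x d.+1 (upd env d i) g | i <- iota 0 j] /\ forall r, r < d.*2 -> s.1 r = f r)
     N Y _ _ _ (leqnn _) _ _ _) => //.
  + by move=> s [].
  + by apply/eqP; lia.
  (* The new counter can be as large as the value of [e], so the body runs under the larger bound
     [B']. Since B' + 2 <= (B + 2) ^ (K0 + 2), its exponent becomes (K0 + 2) * K1. *)
  + move=> j [h oh] Hj [/= -> Hh] Hi Hb; pose B' := (B + 2) ^ K0 + B.
    have He' : env_ok d.+1 (upd env d j) h B'.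
      case: He => E1 E2 E3; split=> [i Hid|i Hid|i].
      * rewrite /upd; case: eqP => [->|Hne]; first by rewrite Hi.
        by rewrite Hh ?E1 //; lia.
      * by rewrite upd_other ?E2 //; lia.
      * by rewrite /upd; case: eqP => _; [rewrite /B'; lia | have := E3 i; rewrite /B'; lia].
    apply: runs_weaken (H1 x _ h _ B' He').
      rewrite /Y expnM; case: (K1) => // K; rewrite leq_exp2r // /B' expnD expnS expn1; nia.
    case=> f2 o2 /= [-> Hf2]; rewrite Hf2 ?Hi ?doubleS //; split=> //.
      by rewrite Hf2 ?Hb ?doubleS.
    split=> [|r Hr]; last by rewrite upd_other ?Hf2 ?Hh //; lia.
    by rewrite -catA; congr (_ ++ _); apply: esym; apply: (flatten_iotaS (fun i => geval x d.+1 (upd env d i) g)).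
  + rewrite cats0; split=> // r Hr.
    by rewrite /= upd_other ?Hf1 //; lia.
Qed.

Definition env0 (n : nat) : nat -> nat := upd (fun=> 0) 0 n.

Lemma runs_size x : runs x (PWhile (TIn 0) (PInc 0)) (fun=> 0, [::]) (3 * size x + 1)
  (fun s => s.2 = [::] /\ s.1 0 = size x).
Proof.
suff: forall m f, f 0 + m = size x -> runs x (PWhile (TIn 0) (PInc 0)) (f, [::]) (3 * m + 1)
  (fun s => s.2 = [::] /\ s.1 0 = size x) by apply.
elim=> [|m IH] f Hf.
  exists 1, (f, [::]); split=> //; last by rewrite -Hf addn0.
  by apply: ex_while_false; rewrite /= -Hf addn0 ltnn.
have [|k [s [Hk E HP]]] := IH (upd f 0 (f 0).+1); first by rewrite upd_same addSnnS.
exists (1 + k + 2), s; split=> //; first lia.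
by apply: ex_while_true E; [rewrite /= -Hf; lia | apply: ex_inc].
Qed.

(** Every generator is polynomial because a loop bound is evaluated once, before the loop, and is
    polynomial in the counters in scope. The initial loop counts the input length into register 0,
    the home of variable 0. *)
Theorem gen_poly (g : gen) : poly_time_computable (fun x => geval x 1 (env0 (size x)) g).
Proof.
have [K HK] := cgen_correct 1 g.
pose p := PSeq (PWhile (TIn 0) (PInc 0)) (cgen 1 g).
apply: (@counter_poly (comp p 0) _ (K + 2 + 4)) => x.
have [k [s [Hk E Hs]]] : runs x p (fun=> 0, [::]) ((size x + 2) ^ (K + 2 + 4))
  (fun s => s.2 = geval x 1 (env0 (size x)) g).
  apply: (@runs_seq x _ _ _ _ ((size x + 2) ^ K) _ _ _ _ (runs_size x)).
    have : 0 < (size x + 2) ^ K by rewrite expn_gt0; lia.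
    by move=> H; apply: pow_bound; rewrite expnS expn1; nia.
  case=> f o /= [-> Hf]; apply: runs_weaken (HK x (env0 (size x)) f [::] (size x) _) => //.
    by move=> s [].
  split=> [[|i]|[|i]|[|i]] //= _.
exists k, (0 + size (comp p 0)), s.1; split=> //.
rewrite -Hs; apply: (comp_correct E).
by exists [::], [::]; rewrite cats0.
Qed.

(** * Euler's inequality for rotation systems *)

Section EulerInequality.
Variables (N : nat) (mate : 'I_N -> 'I_N) (s : {perm 'I_N}).
Hypothesis mateK : involutive mate.
Hypothesis mate_neq : forall d, mate d != d.

(** Only the edges whose smaller dart lies below [k] are present; the other darts are fixed points,
    that is, free ends. *)
Definition mate_upto (k : nat) (d : 'I_N) : 'I_N :=
  if (k <= d) && (k <= mate d) then d else mate d.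

Lemma mate_uptoK k : involutive (mate_upto k).
Proof.
move=> d; rewrite /mate_upto; case E : ((k <= d) && (k <= mate d)); first by rewrite E.
by rewrite mateK andbC E.
Qed.

Definition mate_perm k : {perm 'I_N} := perm (inv_inj (mate_uptoK k)).

Lemma mate_permE k d : mate_perm k d = mate_upto k d.
Proof. by rewrite permE. Qed.

(* Euler's inequality by joining the darts of one edge at a time: each edge changes the number of face
   cycles by one. [chi] labels the connected components so far; if the edge joins two of them, then it
   joins two face cycles, and the labels of the two components are identified. *)
Lemma euler_aux k : k <= N -> exists chi : 'I_N -> {set 'I_N},
  [/\ forall d, chi (s d) = chi d,
      forall d : 'I_N, d < k -> chi (mate d) = chi d &
      #|porbits (mate_perm k * s)%g| + #|porbits s|
        <= \sum_(d < N) ((d < mate d) && (d < k)) + 2 * #|chi @: setT|].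
Proof.
elim: k => [|k IH] Hk.
  (* Without edges, components, vertices and faces all coincide with the cycles of [s]. *)
  exists (porbit s); split=> // [d|].
    by apply/eqP; rewrite eq_porbit_mem; rewrite -{1}[s]expg1 mem_porbit.
  have -> : mate_perm 0 = 1%g.
    by apply/permP => d; rewrite permE perm1.
  rewrite mul1g /porbits; have -> : porbit s @: 'I_N = porbit s @: setT.
    by apply/setP => X; apply/imsetP/imsetP => -[d _ ->]; exists d; rewrite ?inE.
  by apply: leq_trans (leq_addl _ _); rewrite mul2n addnn.
have [chi [Hs Hm HF]] := IH (ltnW Hk).
pose d0 : 'I_N := Ordinal Hk.
have Hsum : \sum_(d < N) ((d < mate d) && (d < k.+1)) =
  \sum_(d < N) ((d < mate d) && (d < k)) + (d0 < mate d0).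
  rewrite (bigD1 d0) //= [X in _ = X + _](bigD1 d0) //= ltnn andbF ltnSn andbT add0n addnC.
  congr (_ + _); apply: eq_bigr => d /eqP Hd; congr (nat_of_bool (_ && _)).
  have : nat_of_ord d <> k by move=> E; apply: Hd; apply: val_inj.
  by rewrite /=; lia.
have Hd0 : nat_of_ord (mate d0) <> k.
  by move=> E; have := mate_neq d0; rewrite -val_eqE /= E eqxx.
have [Hlt|Hge] := ltnP d0 (mate d0); last first.
  (* The edge of [d0] was already added at its smaller dart. *)
  have E : mate_perm k.+1 = mate_perm k.
    apply/permP => d; rewrite !permE /mate_upto.
    suff -> : (k < d) && (k < mate d) = (k <= d) && (k <= mate d) by [].
    apply/idP/idP; first lia.
    move=> /andP [H1 H2].
    have H3 : nat_of_ord d <> k.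
      move=> E; have E' : d = d0 by apply: val_inj.
      by move: H2 Hge; rewrite E' /=; lia.
    have H4 : nat_of_ord (mate d) <> k.
      move=> E; have E' : mate d = d0 by apply: val_inj.
      by move: H1 Hge; rewrite -E' mateK /=; lia.
    by lia.
  exists chi; split=> //; last by rewrite Hsum E ltnNge Hge addn0.
  move=> d; rewrite ltnS leq_eqVlt => /orP [/eqP Hdk|]; last exact: Hm.
  have -> : d = d0 by apply: val_inj.
  by have := Hm (mate d0); rewrite mateK => -> //; move: Hge => /=; lia.
have E : mate_perm k.+1 = (tperm d0 (mate d0) * mate_perm k)%g.
  apply/permP => d; rewrite permM !mate_permE /mate_upto.
  have [->|Hd1] := eqVneq d d0.
    by rewrite tpermL mateK /= ltnn leqnn andbT; move: Hlt => /= /ltnW ->.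
  have [->|Hd2] := eqVneq d (mate d0).
    by rewrite tpermR mateK /= ltnn andbF leqnn; move: Hlt => /= /ltnW ->.
  rewrite tpermD 1?eq_sym //.
  suff -> : (k < d) && (k < mate d) = (k <= d) && (k <= mate d) by [].
  have H3 : nat_of_ord d <> k by move=> E; case/eqP: Hd1; apply: val_inj.
  have H4 : nat_of_ord (mate d) <> k.
    by move=> E; case/eqP: Hd2; rewrite -(mateK d); congr mate; apply: val_inj.
  by apply/idP/idP; lia.
have := porbits_mul_tperm (mate_perm k * s)%g d0 (mate d0).
rewrite /= mulgA -E [d0 == _]eq_sym (negbTE (mate_neq d0)) /= => HO.
have Hinv d : chi ((mate_perm k * s)%g d) = chi d.
  rewrite permM Hs permE /mate_upto; case: ifP => // /negbT.
  rewrite negb_and -!ltnNge => /orP [/Hm //|H].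
  by have := Hm (mate d) H; rewrite mateK.
have Horb x y : x \in porbit (mate_perm k * s)%g y -> chi x = chi y.
  case/porbitP => i ->; elim: i => [|i IHi]; first by rewrite expg0 perm1.
  by rewrite expgSr permM Hinv.
have [Ec|Nc] := eqVneq (chi d0) (chi (mate d0)).
  exists chi; split=> //; last first.
    have := leq_addr (d0 \notin porbit (mate_perm k * s) (mate d0)).*2
      #|porbits (mate_perm k.+1 * s)%g|.
    rewrite HO; move: HF; rewrite Hsum Hlt.
    move: #|porbits (mate_perm k.+1 * s)%g| #|porbits (mate_perm k * s)%g| #|porbits s|.
    by move: #|chi @: setT| => *; lia.
  move=> d; rewrite ltnS leq_eqVlt => /orP [/eqP Hdk|]; last exact: Hm.
  by have -> : d = d0 by apply: val_inj.
pose chi' d := if chi d == chi (mate d0) then chi d0 else chi d.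
exists chi'; split.
- by move=> d; rewrite /chi' Hs.
- move=> d; rewrite ltnS leq_eqVlt => /orP [/eqP Hdk|/Hm E1]; last by rewrite /chi' E1.
  have -> : d = d0 by apply: val_inj.
  by rewrite /chi' eqxx (negbTE Nc).
have HN : d0 \notin porbit (mate_perm k * s)%g (mate d0).
  by apply/negP => /Horb /eqP; rewrite (negbTE Nc).
have Hcard : #|chi @: setT| <= #|chi' @: setT|.+1.
  rewrite (cardsD1 (chi (mate d0)) (chi @: setT)) imset_f ?inE // ltnS.
  apply: subset_leq_card; apply/subsetP => X; rewrite !inE => /andP [HX /imsetP [d _ Ed]].
  apply/imsetP; exists d; rewrite ?inE // /chi' -Ed (negbTE HX) //.
rewrite HN /= in HO; move: HO HF Hcard; rewrite Hsum Hlt.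
move: #|porbits (mate_perm k.+1 * s)%g| #|porbits (mate_perm k * s)%g| #|porbits s|.
by move: #|chi @: setT| #|chi' @: setT| => *; lia.
Qed.

Lemma mate_pairs : (\sum_(d < N) (d < mate d)).*2 = N.
Proof.
have E : \sum_(d < N) (d < mate d) = \sum_(d < N) (mate d < d).
  by rewrite (reindex_inj (inv_inj mateK)) /=; apply: eq_bigr => d _; rewrite mateK.
rewrite -addnn {2}E -big_split /= -[RHS]card_ord -sum1_card; apply: eq_bigr => d _.
by have := mate_neq d; rewrite -val_eqE /=; case: ltngtP.
Qed.

(** This is F + V <= E + 2, doubled, with N = 2 * E. The hypothesis on [chi] expresses
    connectedness: an invariant labelling is constant. *)
Lemma euler_inequality (F : 'I_N -> 'I_N) (Finj : injective F) :
  (forall d, F d = s (mate d)) -> 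
  (forall chi : 'I_N -> {set 'I_N}, (forall d, chi (s d) = chi d) ->
     (forall d, chi (mate d) = chi d) -> forall d d', chi d = chi d') ->
  2 * #|porbits (perm Finj)| + 2 * #|porbits s| <= N + 4.
Proof.
move=> HF Hconn; have [chi [Hs Hm H]] := euler_aux (leqnn N).
have E : (mate_perm N * s)%g = perm Finj.
  apply/permP => d; rewrite permM !permE HF /mate_upto.
  by rewrite leqNgt ltn_ord.
have HC : #|chi @: setT| <= 1.
  have Hcc := Hconn chi Hs (fun d => Hm d (ltn_ord d)).
  apply: leq_trans (_ : #|codom chi| <= _).
    by apply: subset_leq_card; apply/subsetP => X /imsetP [d _ ->]; apply: codom_f.
  apply/card_le1P => X /codomP [d ->] Y; rewrite inE; apply/idP/eqP.
    by case/codomP => d' ->; apply: Hcc.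
  by move=> ->; apply: codom_f.
have Hsum : \sum_(d < N) ((d < mate d) && (d < N)) = \sum_(d < N) (d < mate d).
  by apply: eq_bigr => d _; rewrite ltn_ord andbT.
move: H HC mate_pairs; rewrite Hsum E; move: #|porbits (perm Finj)| #|porbits s|.
by move: #|chi @: setT| (\sum_(d < N) _) => *; lia.
Qed.

End EulerInequality.

(** * Components, faces and planarity of an instance *)

Section RotationSystem.
Variable I : instance.

Lemma offs_nV : offs I (nV I) = nD I.
Proof. by rewrite /offs /nV take_size. Qed.

Lemma offs_succ a : a < nV I -> offs I a.+1 = offs I a + vdeg I a.
Proof.
by move=> Ha; rewrite /offs (take_nth FreeTerminal Ha) map_rcons sumn_rcons.
Qed.

Lemma offs_leq a b : a <= b -> offs I a <= offs I b.
Proof.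
move=> Hab; rewrite /offs -(subnK Hab) addnC takeD map_cat sumn_cat.
exact: leq_addr.
Qed.

Lemma vdeg_gt0 a : 0 < vdeg I a.
Proof. by rewrite /vdeg; case: lab. Qed.

Lemma sum_ltn n a : a <= n -> \sum_(w < n) (w < a) = a.
Proof.
have -> : \sum_(w < n) (w < a) = minn n a; last by move/minn_idPr.
by elim: n => [|n IH]; rewrite ?big_ord0 ?min0n // big_ord_recr /= IH; lia.
Qed.

Lemma owner_dart a k : a < nV I -> k < vdeg I a -> owner I (dart I a k) = a.
Proof.
move=> Ha Hk; rewrite /owner /dart -[RHS](sum_ltn (ltnW Ha)).
apply: eq_bigr => w _; congr nat_of_bool.
have := offs_succ Ha; have [Hwa|Haw] := ltnP w a.
  by have := offs_leq Hwa; lia.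
by have := @offs_leq a.+1 w.+1; lia.
Qed.

Lemma port_dart a k : a < nV I -> k < vdeg I a -> port I (dart I a k) = k.
Proof. by move=> Ha Hk; rewrite /port owner_dart // /dart addKn. Qed.

Lemma dart_ltn a k : a < nV I -> k < vdeg I a -> dart I a k < nD I.
Proof.
move=> Ha Hk; rewrite /dart -offs_nV.
by have := offs_succ Ha; have := @offs_leq a.+1 (nV I) Ha; lia.
Qed.

Lemma dart_decomp d : d < nD I -> exists a k, [/\ a < nV I, k < vdeg I a & d = dart I a k].
Proof.
rewrite -offs_nV; have: nV I <= nV I by [].
elim: {1 3}(nV I) => [|a IH] Ha; first by rewrite /offs take0.
rewrite offs_succ // => Hd; have [Hlt|Hge] := ltnP d (offs I a).
  by apply: IH => //; apply: ltnW.
by exists a, (d - offs I a); rewrite /dart; split=> //; lia.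
Qed.

Lemma dart_inj a b k l : a < nV I -> b < nV I -> k < vdeg I a -> l < vdeg I b ->
  dart I a k = dart I b l -> a = b /\ k = l.
Proof.
move=> Ha Hb Hk Hl E; have Eab : a = b by rewrite -(owner_dart Ha Hk) E owner_dart.
by split=> //; rewrite -(port_dart Ha Hk) E port_dart.
Qed.

Lemma rot_dart a k : a < nV I -> k < vdeg I a ->
  Defs.rot I (dart I a k) = dart I a (k.+1 %% vdeg I a).
Proof. by move=> Ha Hk; rewrite /Defs.rot owner_dart // port_dart. Qed.

Lemma rot_ltn d : d < nD I -> Defs.rot I d < nD I.
Proof.
move=> /dart_decomp [a [k [Ha Hk ->]]]; rewrite rot_dart //; apply: dart_ltn => //.
by rewrite ltn_mod vdeg_gt0.
Qed.

Lemma owner_ltn d : d < nD I -> owner I d < nV I.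
Proof. by case/dart_decomp => a [k [Ha Hk ->]]; rewrite owner_dart. Qed.

Lemma rot_injective d d' : d < nD I -> d' < nD I -> Defs.rot I d = Defs.rot I d' -> d = d'.
Proof.
case/dart_decomp => a [k [Ha Hk ->]]; case/dart_decomp => b [l [Hb Hl ->]].
rewrite !rot_dart // => /dart_inj []; rewrite ?ltn_mod ?vdeg_gt0 // => Eab E.
move: Hl E; rewrite -Eab => Hl E; congr (dart I a _); move: E.
have : k.+1 = l.+1 %[mod vdeg I a] -> k = l.
  case: (ltngtP k.+1 (vdeg I a)) => H1; case: (ltngtP l.+1 (vdeg I a)) => H2; try lia.
  - by rewrite !modn_small // => -[].
  - by rewrite H2 modnn modn_small.
  - by rewrite H1 modnn modn_small.
by apply.
Qed.

Hypothesis mateP : forall d, d < nD I -> [/\ mt I d < nD I, mt I d != d & mt I (mt I d) = d].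
Hypothesis V_gt0 : 0 < nV I.
(** A certificate of connectedness: passing to smaller neighbours leads from every vertex to vertex
    0. *)
Hypothesis parent : forall a, 0 < a < nV I ->
  exists d, [/\ d < nD I, owner I d = a & owner I (mt I d) < a].

Lemma mt_ltn d : d < nD I -> mt I d < nD I.
Proof. by case/mateP. Qed.

Definition mate_ord (d : 'I_(nD I)) : 'I_(nD I) := Ordinal (mt_ltn (ltn_ord d)).
Definition rot_ord (d : 'I_(nD I)) : 'I_(nD I) := Ordinal (rot_ltn (ltn_ord d)).

Lemma rot_ord_inj : injective rot_ord.
Proof.
move=> d d' /(congr1 val) /= E; apply: val_inj.
exact: (rot_injective (ltn_ord d) (ltn_ord d') E).
Qed.

Lemma mate_ordK : involutive mate_ord.
Proof. by move=> d; apply: val_inj; case: (mateP (ltn_ord d)). Qed.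

Lemma mate_ord_neq d : mate_ord d != d.
Proof. by rewrite -val_eqE; case: (mateP (ltn_ord d)). Qed.

Definition face_ord d := rot_ord (mate_ord d).

Lemma face_ord_inj : injective face_ord.
Proof. exact: inj_comp rot_ord_inj (inv_inj mate_ordK). Qed.

Lemma components_one : nComponents I = 1.
Proof.
have Hc (v : 'I_(nV I)) : connect (@vadj I) v (Ordinal V_gt0).
  case: v => v Hv; elim/ltn_ind: v Hv => v IH Hv.
  have [E|Hpos] := posnP v.
    by have -> : Ordinal Hv = Ordinal V_gt0 by apply: val_inj.
  have [|d [Hd Ho Hlt]] := @parent v; first by rewrite Hpos.
  have Hw : owner I (mt I d) < nV I by apply: ltn_trans Hv.
  apply: connect_trans (connect1 _) (IH _ Hlt Hw).
  by apply/existsP; exists (Ordinal Hd); rewrite /= Ho !eqxx.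
rewrite /nComponents (bigD1 (Ordinal V_gt0)) //= big1 => [|v Hv].
  by rewrite addn0; case: forallP => // -[u]; apply/implyP.
case: forallP => // /(_ (Ordinal V_gt0)); rewrite Hc /= leqn0 => Hv0.
by rewrite -val_eqE /= Hv0 in Hv.
Qed.

Lemma invariant_constant (T : Type) (chi : 'I_(nD I) -> T) :
  (forall d, chi (rot_ord d) = chi d) -> (forall d, chi (mate_ord d) = chi d) ->
  forall d d', chi d = chi d'.
Proof.
move=> Hr Hm.
have Hrot a (Ha : a < nV I) k (Hk : k < vdeg I a) :
    chi (Ordinal (dart_ltn Ha Hk)) = chi (Ordinal (dart_ltn Ha (vdeg_gt0 a))).
  elim: k Hk => [|k IH] Hk; first by congr chi; apply: val_inj.
  rewrite -(IH (ltnW Hk)) -[RHS]Hr; congr chi; apply: val_inj => /=.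
  by rewrite rot_dart ?modn_small //; apply: ltnW.
have Hd (d : 'I_(nD I)) a (Ha : a < nV I) : owner I d = a ->
    chi d = chi (Ordinal (dart_ltn Ha (vdeg_gt0 a))).
  case: d => d Hd /=; have [b [k [Hb Hk E]]] := dart_decomp Hd.
  move: (Hd); rewrite E owner_dart // => Hd' Eab; subst b.
  by rewrite -(Hrot _ _ _ Hk); congr chi; apply: val_inj.
pose c := chi (Ordinal (dart_ltn V_gt0 (vdeg_gt0 0))).
suff H a (Ha : a < nV I) (d : 'I_(nD I)) : owner I d = a -> chi d = c.
  by move=> d d'; rewrite (H _ (owner_ltn (ltn_ord d))) // (H _ (owner_ltn (ltn_ord d'))).
elim/ltn_ind: a Ha d => a IH Ha d Ho.
have [E|Hpos] := posnP a.
  by subst a; rewrite (Hd d _ V_gt0).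
have [|e [He Hoe Hlt]] := @parent a; first by rewrite Hpos.
have Hw : owner I (mt I e) < nV I by apply: ltn_trans Ha.
rewrite (Hd d _ Ha Ho) -(Hd (Ordinal He) _ Ha Hoe) -Hm.
exact: (IH _ Hlt Hw (mate_ord (Ordinal He))).
Qed.

Lemma nV_leq_porbits : nV I <= #|porbits (perm rot_ord_inj)|.
Proof.
pose h (a : 'I_(nV I)) := porbit (perm rot_ord_inj) (Ordinal (dart_ltn (ltn_ord a) (vdeg_gt0 a))).
have hinj : injective h.
  move=> a b /eqP; rewrite eq_porbit_mem => /porbitP [i E]; apply: val_inj => /=.
  have Ho (d : 'I_(nD I)) : owner I ((perm rot_ord_inj ^+ i)%g d) = owner I d.
    elim: i {E} => [|i IH]; first by rewrite expg0 perm1.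
    rewrite expgSr permM permE /=; set e := (perm rot_ord_inj ^+ i)%g d in IH *; rewrite -IH.
    have [c [k [Hc Hk ->]]] := dart_decomp (ltn_ord e).
    by rewrite rot_dart // !owner_dart // ltn_mod vdeg_gt0.
  have := Ho (Ordinal (dart_ltn (ltn_ord b) (vdeg_gt0 b))).
  by rewrite -E /= !owner_dart ?vdeg_gt0.
rewrite -[X in X <= _]card_ord -(card_imset _ hinj); apply: subset_leq_card.
by apply/subsetP => X /imsetP [a _ ->]; apply: imset_f.
Qed.

Definition face_min (d : 'I_(nD I)) : bool := [forall j : 'I_(nD I), d <= iter j (facep I) d].

Lemma nFacesE : nFaces I = #|[set d | face_min d]|.
Proof.
rewrite /nFaces -sum1_card [RHS]big_mkcond /=; apply: eq_bigr => d _.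
by rewrite inE /face_min; case: ifP.
Qed.

Lemma iter_face (d : 'I_(nD I)) j : iter j (facep I) d = (perm face_ord_inj ^+ j)%g d.
Proof.
elim: j => [|j IH]; first by rewrite expg0 perm1.
by rewrite iterS IH expgSr permM permE.
Qed.

Lemma nFaces_leq : nFaces I <= #|porbits (perm face_ord_inj)|.
Proof.
rewrite nFacesE -(@card_in_imset _ _ (porbit (perm face_ord_inj))).
  by apply: subset_leq_card; apply/subsetP => X /imsetP [d _ ->]; apply: imset_f.
have Hle (d e : 'I_(nD I)) : face_min d -> e \in porbit (perm face_ord_inj) d -> d <= e.
  move=> /forallP Hd; rewrite porbit_traject => /trajectP [i Hi ->].
  have Hi' : i < nD I by apply: leq_trans Hi (leq_trans (max_card _) _); rewrite card_ord.
  by have := Hd (Ordinal Hi'); rewrite /= iter_face permX.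
move=> d e; rewrite !inE => Hd He /eqP; rewrite eq_porbit_mem => Hde.
apply: val_inj; apply/eqP; rewrite eqn_leq Hle //= 1?porbit_sym //.
by rewrite Hle // porbit_sym.
Qed.

Variables (L : finType) (phi : nat -> L).
Hypothesis phi_face : forall d, d < nD I -> phi (facep I d) = phi d.
Hypothesis phi_surj : forall l, exists2 d, d < nD I & phi d = l.

(** Labels are constant on faces, so the least dart with a given label is also the least dart of its
    face, the one that [nFaces] counts. *)
Lemma nFaces_geq : #|L| <= nFaces I.
Proof.
have surj l : exists d : 'I_(nD I), phi d == l.
  by have [d Hd <-] := phi_surj l; exists (Ordinal Hd).
pose rep l := [arg min_(d < xchoose (surj l) | phi d == l) (d : nat)].
have repP l : phi (rep l) = l /\ face_min (rep l).
  rewrite /rep; case: arg_minnP => [|d /eqP Hd Hmin]; first exact: xchooseP (surj l).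
  split=> //; apply/forallP => j; rewrite iter_face; apply: Hmin; apply/eqP.
  rewrite -[RHS]Hd; elim: (nat_of_ord j) => [|i IH]; first by rewrite expg0 perm1.
  by rewrite expgSr permM permE -IH; apply: phi_face.
rewrite nFacesE -(@card_imset _ _ rep); last first.
  by move=> l l' E; rewrite -(proj1 (repP l)) E (proj1 (repP l')).
by apply: subset_leq_card; apply/subsetP => d /imsetP [l _ ->]; rewrite inE (proj2 (repP l)).
Qed.

Lemma planar_from_faces : 2 * nV I + 2 * #|L| = nD I + 4 -> planar_embedding I.
Proof.
move=> Hcount; rewrite /planar_embedding components_one.
have : 2 * #|porbits (perm face_ord_inj)| + 2 * #|porbits (perm rot_ord_inj)| <= nD I + 4.
  apply: (euler_inequality mate_ordK mate_ord_neq) => [d|chi Hr Hm]; first by rewrite permE.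
  by apply: invariant_constant => // d; have := Hr d; rewrite permE.
have := nFaces_geq; have := nFaces_leq; have := nV_leq_porbits; lia.
Qed.

End RotationSystem.

(** * Networks over a type of vertices *)

Lemma gconstraint_size g L : L \in gconstraint g -> size L = gdeg g.
Proof.
by case: g => [|k||| ] /=; rewrite !inE; do ?[case/orP]; move/eqP => -> //=; rewrite size_nseq.
Qed.

(** With the full constraints as semilocal constraints, this makes every edge locally free. *)
Lemma gconstraint_unforced g k : k < gdeg g ->
  ~~ all (fun L => nth false L k) (gconstraint g) &&
  ~~ all (fun L => ~~ nth false L k) (gconstraint g).
Proof.
case: g => [|n||| ] /=; try by case: k => [|[|[|[|]]]].
by case: k => [|k] //= Hk; rewrite !nth_nseq -ltnS Hk.
Qed.

(** A locally free port takes both values in its semilocal constraint, and (b) realizes both. *)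
Lemma not_cond_a_of_cond_b (I : instance) : cond_b I -> ~ cond_a I.
Proof.
move=> Hb [d [Hd /andP [Hf _] H]].
have [a [k [Ha Hk E]]] := dart_decomp Hd.
move: Hf; rewrite E owner_dart // port_dart // /forced negb_or.
case/andP => /allPn [L1 HL1 N1] /allPn [L2 HL2 N2].
have [A1 [S1 E1]] := Hb a Ha L1 HL1; have [A2 [S2 E2]] := Hb a Ha L2 HL2.
have := H A1 A2 S1 S2; rewrite E => Eq.
have N L A : Defs.in_set I A a = L -> nth false L k = A (dart I a k).
  by move=> <-; rewrite nth_mkseq.
by move: N1 N2; rewrite (N _ _ E1) (N _ _ E2) Eq => /negbTE ->.
Qed.

Section Net.
Variables (vT : eqType) (v0 : vT) (vs : seq vT) (g : vT -> gadget).
Variable sm : vT * nat -> vT * nat.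

Definition net_darts : seq (vT * nat) := [seq (v, k) | v <- vs, k <- iota 0 (gdeg (g v))].

Definition net : instance :=
  Inst (map g vs) [seq index (sm d) net_darts | d <- net_darts] [seq gconstraint (g v) | v <- vs].

Notation I := net.
Notation ds := net_darts.
Notation d0 := (v0, 0).

Hypothesis ds_uniq : uniq ds.
Hypothesis sm_in : forall d, d \in ds -> sm d \in ds.
Hypothesis sm_neq : forall d, d \in ds -> sm d != d.
Hypothesis smK : forall d, d \in ds -> sm (sm d) = d.

Lemma net_nV : nV I = size vs. Proof. by rewrite /nV size_map. Qed.

Lemma net_lab a : a < size vs -> lab I a = g (nth v0 vs a).
Proof. by move=> Ha; rewrite /lab (nth_map v0). Qed.

Lemma net_semi a : a < size vs -> semi I a = gconstraint (g (nth v0 vs a)).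
Proof. by move=> Ha; rewrite /semi (nth_map v0). Qed.

Lemma net_vdeg a : a < size vs -> vdeg I a = gdeg (g (nth v0 vs a)).
Proof. by move=> Ha; rewrite /vdeg net_lab. Qed.

Lemma net_offs a : offs I a = size [seq (v, k) | v <- take a vs, k <- iota 0 (gdeg (g v))].
Proof.
rewrite /offs /= -map_take -map_comp size_allpairs_dep; congr sumn.
by apply: eq_map => v /=; rewrite size_iota.
Qed.

Lemma net_nD : nD I = size ds.
Proof. by rewrite -offs_nV net_offs net_nV take_size. Qed.

Lemma mem_net_darts v k : ((v, k) \in ds) = (v \in vs) && (k < gdeg (g v)).
Proof.
apply/allpairsPdep/andP => [[w [l [Hw Hl [-> ->]]]]|[Hv Hk]].
  by rewrite mem_iota in Hl.
by exists v, k; rewrite mem_iota.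
Qed.

Lemma nth_net_darts a k : a < size vs -> k < gdeg (g (nth v0 vs a)) ->
  nth d0 ds (dart I a k) = (nth v0 vs a, k).
Proof.
move=> Ha Hk; rewrite /dart net_offs /net_darts -{1}(cat_take_drop a vs) map_cat flatten_cat nth_cat.
rewrite ltnNge leq_addr /= addKn (drop_nth v0 Ha) /= nth_cat size_map size_iota Hk.
by rewrite (nth_map 0) ?size_iota // nth_iota.
Qed.

Lemma index_net_darts a k : a < size vs -> k < gdeg (g (nth v0 vs a)) ->
  index (nth v0 vs a, k) ds = dart I a k.
Proof.
move=> Ha Hk; rewrite -nth_net_darts // index_uniq // -net_nD.
by apply: dart_ltn; rewrite ?net_nV ?net_vdeg.
Qed.

Lemma net_mt d : d \in ds -> mt I (index d ds) = index (sm d) ds.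
Proof. by move=> Hd; rewrite /mt /= (nth_map d0) ?index_mem // nth_index. Qed.

Lemma net_mate d : d < nD I -> [/\ mt I d < nD I, mt I d != d & mt I (mt I d) = d].
Proof.
rewrite net_nD => Hd; have Hin := mem_nth d0 Hd.
have E : d = index (nth d0 ds d) ds by rewrite index_uniq.
rewrite E net_mt // index_mem net_mt ?sm_in // smK //; split=> //.
by apply: contra (sm_neq Hin) => /eqP /(congr1 (nth d0 ds)); rewrite !nth_index ?sm_in // => ->.
Qed.

Definition ssat (A : vT * nat -> bool) : Prop :=
  (forall d, d \in ds -> A (sm d) = ~~ A d) /\
  (forall v, v \in vs -> mkseq (fun k => A (v, k)) (gdeg (g v)) \in gconstraint (g v)).

Lemma net_in_set (A : vT * nat -> bool) a : a < size vs ->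
  Defs.in_set I (fun n => A (nth d0 ds n)) a = mkseq (fun k => A (nth v0 vs a, k)) (gdeg (g (nth v0 vs a))).
Proof.
move=> Ha; rewrite /Defs.in_set net_vdeg //; apply/eq_in_map => k; rewrite mem_iota => Hk.
by rewrite nth_net_darts.
Qed.

Lemma net_sat_of A : ssat A -> satisfying I (fun n => A (nth d0 ds n)).
Proof.
case=> H1 H2; split=> [d|a]; last first.
  by rewrite net_nV => Ha; rewrite net_in_set // net_lab // H2 // mem_nth.
rewrite net_nD => Hd; have Hin := mem_nth d0 Hd.
have E : d = index (nth d0 ds d) ds by rewrite index_uniq.
by rewrite {1}E net_mt // nth_index ?sm_in // H1.
Qed.

Lemma net_sat_to a : satisfying I a -> ssat (fun d => a (index d ds)).
Proof.
case=> H1 H2; split=> [d Hd|v Hv].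
  by rewrite -net_mt // H1 // net_nD index_mem.
have Hi : index v vs < size vs by rewrite index_mem.
have := H2 (index v vs); rewrite net_nV => /(_ Hi); rewrite net_lab // nth_index //.
suff -> : Defs.in_set I a (index v vs) = mkseq (fun k => a (index (v, k) ds)) (gdeg (g v)) by [].
rewrite /Defs.in_set net_vdeg // nth_index //; apply/eq_in_map => k; rewrite mem_iota => Hk.
by have := @index_net_darts (index v vs) k Hi; rewrite nth_index // => ->.
Qed.

Lemma net_promise : promise_i I.
Proof.
by move=> a [_ H] v Hv; have := H v Hv; rewrite net_nV in Hv; rewrite net_semi // net_lab.
Qed.

Lemma net_valid : planar_embedding I -> (forall v, v \in vs -> forall k, g v = Fanout k -> 0 < k) ->
  valid_instance I.
Proof.
move=> Hp Hf; split=> //.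
- by rewrite net_nD net_nV /= !size_map.
- move=> v; rewrite net_nV => Hv k; rewrite net_lab //; apply: Hf; exact: mem_nth.
- exact: net_mate.
- by move=> v; rewrite net_nV => Hv; rewrite net_semi // net_lab.
Qed.

Lemma net_cond_b :
  (forall v L, v \in vs -> L \in gconstraint (g v) ->
     exists A, ssat A /\ mkseq (fun k => A (v, k)) (gdeg (g v)) = L) ->
  cond_b I /\ ~ cond_a I.
Proof.
move=> H; have Hb : cond_b I.
  move=> a; rewrite net_nV => Ha L; rewrite net_semi // => HL.
  have [A [HA E]] := H _ L (mem_nth v0 Ha) HL.
  exists (fun n => A (nth d0 ds n)); split; first exact: net_sat_of.
  by rewrite net_in_set.
by split=> //; apply: not_cond_a_of_cond_b.
Qed.

Lemma net_forced d : d < nD I -> ~~ forced I (owner I d) (port I d).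
Proof.
case/dart_decomp => a [k []]; rewrite net_nV => Ha Hk ->.
rewrite owner_dart ?net_nV // port_dart ?net_nV // /forced negb_or net_semi //.
by apply: gconstraint_unforced; rewrite -net_vdeg.
Qed.

Lemma net_cond_a d b : d \in ds -> (forall A, ssat A -> A d = b) -> cond_a I.
Proof.
move=> Hd H; have Hi : index d ds < nD I by rewrite net_nD index_mem.
exists (index d ds); split=> //.
  by rewrite /locally_free !net_forced //; case: (net_mate Hi).
by move=> a1 a2 /net_sat_to /H -> /net_sat_to /H ->.
Qed.

Lemma net_planar (L : finType) (phi : vT * nat -> L) :
  0 < size vs ->
  (forall a, 0 < a < size vs ->
     exists2 k, k < gdeg (g (nth v0 vs a)) & index (sm (nth v0 vs a, k)).1 vs < a) ->
  (forall v k, (v, k) \in ds ->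
     phi ((sm (v, k)).1, (sm (v, k)).2.+1 %% gdeg (g (sm (v, k)).1)) = phi (v, k)) ->
  (forall l, exists2 d, d \in ds & phi d = l) ->
  2 * size vs + 2 * #|L| = size ds + 4 ->
  planar_embedding I.
Proof.
move=> Hpos Hpar Hphi Hsurj Hcount.
have Hidx w l : (w, l) \in ds -> [/\ index w vs < size vs, l < gdeg (g w),
    index (w, l) ds = dart I (index w vs) l & nth v0 vs (index w vs) = w].
  rewrite mem_net_darts => /andP [Hw Hl]; have Hi : index w vs < size vs by rewrite index_mem.
  by split=> //; rewrite ?nth_index // -index_net_darts // nth_index.
apply: (@planar_from_faces I net_mate _ _ L (fun n => phi (nth d0 ds n))).
- by rewrite net_nV.
- move=> a; rewrite net_nV => Ha; have [k Hk Hlt] := Hpar a Ha.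
  have Ha' : a < size vs by case/andP: Ha.
  exists (dart I a k); split; try by rewrite ?dart_ltn ?owner_dart ?net_nV ?net_vdeg.
  have Hin : (nth v0 vs a, k) \in ds by rewrite mem_net_darts mem_nth.
  rewrite -index_net_darts // net_mt //; case E : (sm _) => [w l] in Hlt *.
  have := sm_in Hin; rewrite E => /Hidx [Hi Hl -> Ew].
  by rewrite owner_dart ?net_nV ?net_vdeg ?Ew.
- move=> d; rewrite net_nD => Hd; have Hin := mem_nth d0 Hd.
  have E : d = index (nth d0 ds d) ds by rewrite index_uniq.
  rewrite /facep {1}E net_mt //; case Ev : (nth d0 ds d) Hin => [v k] Hin.
  have := Hphi _ _ Hin; have := sm_in Hin; case: (sm _) => [w l] /Hidx [Hi Hl -> Ew] <- /=.
  rewrite rot_dart ?net_nV ?net_vdeg ?Ew // nth_net_darts ?Ew // ltn_mod.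
  by apply: leq_trans Hl.
- move=> l; have [d Hd <-] := Hsurj l; exists (index d ds); first by rewrite net_nD index_mem.
  by rewrite nth_index.
- by rewrite net_nV net_nD.
Qed.

End Net.

(** * The crossbar and its planarity *)

(** A numbering that lists the sequence as [iota 0 N] gives distinctness and all indices at once. *)
Lemma index_numbering (T : eqType) (f : T -> nat) (s : seq T) N :
  map f s = iota 0 N -> uniq s /\ forall x, x \in s -> index x s = f x.
Proof.
move=> E; have Hu : uniq s by apply: (@map_uniq _ _ f); rewrite E iota_uniq.
split=> // x Hx; have Hi : index x s < size s by rewrite index_mem.
have := nth_map x 0 f Hi; rewrite nth_index // => <-.
rewrite E nth_iota //; by rewrite -(size_iota 0 N) -E size_map.
Qed.

Lemma flatten_iota_blocks c s m :
  flatten [seq iota (c + i * s) s | i <- iota 0 m] = iota c (m * s).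
Proof.
elim: m => [|m IH] //; rewrite (flatten_iotaS (fun i => iota (c + i * s) s)) IH.
by rewrite -iotaD mulSn addnC.
Qed.

Lemma flatten_flatten (T : Type) (sss : seq (seq (seq T))) :
  flatten (flatten sss) = flatten [seq flatten ss | ss <- sss].
Proof. by elim: sss => //= ss sss IH; rewrite flatten_cat IH. Qed.

(* Row [i] of the crossbar: [VL i] hands the value of the leftmost column to the row, block (i, j) lets
   column [j] cross the row ([VX]), copies the column ([VF]), combines the copy ([VG]) with a free
   terminal ([VT]) and feeds the result into the row ([VH]), and [VC i] adds the row to the rightmost
   column. [BZ], [BX j], [BC] end the columns at the bottom. *)
Inductive vtx :=
| VL of nat | VC of nat
| VX of nat & nat | VF of nat & nat | VG of nat & nat | VT of nat & nat | VH of nat & nat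
| BZ | BX of nat | BC.

Lemma vtx_eq_dec (a b : vtx) : decidable (a = b).
Proof. by rewrite /decidable; decide equality; apply: PeanoNat.Nat.eq_dec. Qed.

HB.instance Definition _ := hasDecEq.Build vtx (compareP vtx_eq_dec).

Section Crossbar.
Variables (h m : nat) (tap : nat -> nat -> bool).
Hypothesis m_gt0 : 0 < m.
Hypothesis h_gt0 : 0 < h.

Notation n := h.*2.

(* With row value [r], column value [x] and free value [v], a tapped column gives [r || (x && v)] and an
   untapped one [r && (x || v)]: the wiring is the same for every formula. *)
Definition vlabel (v : vtx) : gadget :=
  match v with
  | VL _ | VF _ _ => Fanout 2
  | VC _ => AndGate
  | VX _ _ => Crossover
  | VG i j => if tap i j then AndGate else OrGate
  | VH i j => if tap i j then OrGate else AndGate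
  | _ => FreeTerminal
  end.

Definition block (i j : nat) : seq vtx := [:: VX i j; VF i j; VG i j; VT i j; VH i j].
Definition row (i : nat) : seq vtx := VL i :: flatten [seq block i j | j <- iota 0 n] ++ [:: VC i].
Definition bottom : seq vtx := BZ :: [seq BX j | j <- iota 0 n] ++ [:: BC].
Definition cb_vertices : seq vtx := flatten [seq row i | i <- iota 0 m] ++ bottom.

Definition partner (j : nat) : nat := if odd j then j.-1 else j.+1.

(* Columns [2k] and [2k+1] are joined at the top, which makes them complementary; so are the leftmost
   and the rightmost column, which makes the conjunction of the rows start with the negation of the
   leftmost value. *)
Definition cb_mate (d : vtx * nat) : vtx * nat :=
  match d with
  | (VL i, 0) => if i is i'.+1 then (VL i', 2) else (VC 0, 1)
  | (VL i, 1) => (VX i 0, 3)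
  | (VL i, _) => if i.+1 < m then (VL i.+1, 0) else (BZ, 0)
  | (VC i, 0) => (VH i n.-1, 2)
  | (VC i, 1) => if i is i'.+1 then (VC i', 2) else (VL 0, 0)
  | (VC i, _) => if i.+1 < m then (VC i.+1, 1) else (BC, 0)
  | (VX i j, 0) => if i is i'.+1 then (VF i' j, 2) else (VX 0 (partner j), 0)
  | (VX i j, 1) => (VH i j, 1)
  | (VX i j, 2) => (VF i j, 0)
  | (VX i j, _) => if j is j'.+1 then (VH i j', 2) else (VL i, 1)
  | (VF i j, 0) => (VX i j, 2)
  | (VF i j, 1) => (VG i j, 1)
  | (VF i j, _) => if i.+1 < m then (VX i.+1 j, 0) else (BX j, 0)
  | (VG i j, 0) => (VT i j, 0)
  | (VG i j, 1) => (VF i j, 1)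
  | (VG i j, _) => (VH i j, 0)
  | (VT i j, _) => (VG i j, 0)
  | (VH i j, 0) => (VG i j, 2)
  | (VH i j, 1) => (VX i j, 1)
  | (VH i j, _) => if j.+1 < n then (VX i j.+1, 3) else (VC i, 0)
  | (BZ, _) => (VL m.-1, 2)
  | (BX j, _) => (VF m.-1 j, 2)
  | (BC, _) => (VC m.-1, 2)
  end.

Definition valid_vtx (v : vtx) : bool :=
  match v with
  | VL i | VC i => i < m
  | VX i j | VF i j | VG i j | VT i j | VH i j => (i < m) && (j < n)
  | BX j => j < n
  | _ => true
  end.

Definition vdegree (v : vtx) : nat :=
  match v with VX _ _ => 4 | VT _ _ | BZ | BX _ | BC => 1 | _ => 3 end.

Lemma gdeg_vlabel v : gdeg (vlabel v) = vdegree v.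
Proof. by case: v => //= i j; case: tap. Qed.

(** A block has 4 + 3 + 3 + 1 + 3 darts, and [VL] and [VC] add 3 each. The closed forms below let
    the generator compute dart positions arithmetically. *)
Definition row_darts := 14 * n + 6.
Definition dart_num (d : vtx * nat) : nat :=
  let: (v, k) := d in
  match v with
  | VL i => i * row_darts
  | VX i j => i * row_darts + 3 + j * 14
  | VF i j => i * row_darts + 3 + j * 14 + 4
  | VG i j => i * row_darts + 3 + j * 14 + 7
  | VT i j => i * row_darts + 3 + j * 14 + 10
  | VH i j => i * row_darts + 3 + j * 14 + 11
  | VC i => i * row_darts + 3 + n * 14
  | BZ => m * row_darts
  | BX j => m * row_darts + 1 + j
  | BC => m * row_darts + 1 + n
  end + k.

Definition row_vertices := 5 * n + 2.
Definition vtx_num (v : vtx) : nat :=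
  match v with
  | VL i => i * row_vertices
  | VX i j => i * row_vertices + 1 + j * 5
  | VF i j => i * row_vertices + 1 + j * 5 + 1
  | VG i j => i * row_vertices + 1 + j * 5 + 2
  | VT i j => i * row_vertices + 1 + j * 5 + 3
  | VH i j => i * row_vertices + 1 + j * 5 + 4
  | VC i => i * row_vertices + 1 + n * 5
  | BZ => m * row_vertices
  | BX j => m * row_vertices + 1 + j
  | BC => m * row_vertices + 1 + n
  end.

Notation vs := cb_vertices.
Notation ds := (net_darts vs vlabel).

Lemma map_vtx_num : map vtx_num vs = iota 0 (m * row_vertices + n + 2).
Proof.
have Hb i j : map vtx_num (block i j) = iota (i * row_vertices + 1 + j * 5) 5.
  by rewrite /=; do ! congr (_ :: _); lia.
have Hr i : map vtx_num (row i) = iota (0 + i * row_vertices) row_vertices.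
  rewrite /= map_cat map_flatten -map_comp (eq_map (Hb i)) flatten_iota_blocks.
  have -> : iota (0 + i * row_vertices) row_vertices =
     iota (i * row_vertices) (1 + (n * 5 + 1)) by congr iota; rewrite /row_vertices; lia.
  by rewrite iotaD [iota _ (n * 5 + 1)]iotaD.
rewrite map_cat map_flatten -map_comp (eq_map Hr) flatten_iota_blocks.
have HB : [seq vtx_num (BX j) | j <- iota 0 n] = iota (m * row_vertices + 1) n.
  by rewrite -[in RHS](addn0 (_ + 1)) iotaDl.
have -> : m * row_vertices + n + 2 = m * row_vertices + (1 + (n + 1)) by lia.
rewrite iotaD [iota (0 + _) (1 + _)]iotaD [iota _ (n + 1)]iotaD; congr (_ ++ _).
by rewrite /bottom -cat1s !map_cat -map_comp HB.
Qed.

Definition darts_of (v : vtx) := [seq (v, k) | k <- iota 0 (vdegree v)].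

Lemma cb_dartsE : ds = flatten [seq darts_of v | v <- vs].
Proof. by rewrite /net_darts; congr flatten; apply: eq_map => v; rewrite gdeg_vlabel. Qed.

Lemma map_dart_num : map dart_num ds = iota 0 (m * row_darts + n + 2).
Proof.
pose nd v := map dart_num (darts_of v).
have -> : map dart_num ds = flatten [seq nd v | v <- vs].
  by rewrite cb_dartsE map_flatten -map_comp.
have Hb i j : flatten [seq nd v | v <- block i j] = iota (i * row_darts + 3 + j * 14) 14.
  by rewrite /nd /=; do ! congr (_ :: _); lia.
have Hr i : flatten [seq nd v | v <- row i] = iota (0 + i * row_darts) row_darts.
  rewrite /= map_cat flatten_cat map_flatten -map_comp flatten_flatten -map_comp.
  rewrite (eq_map (Hb i)) flatten_iota_blocks.
  have -> : iota (0 + i * row_darts) row_darts =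
     iota (i * row_darts) (3 + (n * 14 + 3)) by congr iota; rewrite /row_darts; lia.
  rewrite iotaD [iota _ (n * 14 + 3)]iotaD.
  by rewrite /nd /= ?addn0 ?addn1 ?addn2; do ! congr (_ :: _); congr (_ ++ _); do ! congr (_ :: _); lia.
rewrite map_cat flatten_cat map_flatten -map_comp flatten_flatten -map_comp (eq_map Hr).
rewrite flatten_iota_blocks.
have HB : flatten [seq nd (BX j) | j <- iota 0 n] = iota (m * row_darts + 1) n.
  rewrite -[in RHS](addn0 (_ + 1)) iotaDl -[RHS]flatten_seq1 -map_comp.
  by congr flatten; apply: eq_map => j; rewrite /nd /=; congr (_ :: _); lia.
have -> : m * row_darts + n + 2 = m * row_darts + (1 + (n + 1)) by lia.
rewrite iotaD [iota (0 + _) (1 + _)]iotaD [iota _ (n + 1)]iotaD; congr (_ ++ _).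
rewrite /bottom -cat1s !map_cat !flatten_cat -map_comp HB.
by rewrite /nd /= !addn0.
Qed.

Lemma size_vertices : size vs = m * row_vertices + n + 2.
Proof. by rewrite -(size_map vtx_num) map_vtx_num size_iota. Qed.

Lemma size_darts : size ds = m * row_darts + n + 2.
Proof. by rewrite -(size_map dart_num) map_dart_num size_iota. Qed.

Lemma uniq_darts : uniq ds. Proof. by case: (index_numbering map_dart_num). Qed.

Lemma index_dart_num d : d \in ds -> index d ds = dart_num d.
Proof. by case: (index_numbering map_dart_num) => _; apply. Qed.

Lemma index_vtx_num v : v \in vs -> index v vs = vtx_num v.
Proof. by case: (index_numbering map_vtx_num) => _; apply. Qed.

Lemma mem_row i v : (v \in row i) = match v with
    | VL i' | VC i' => i' == i
    | VX i' j | VF i' j | VG i' j | VT i' j | VH i' j => (i' == i) && (j < n)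
    | _ => false end.
Proof.
rewrite /row inE mem_cat inE; apply/or3P/idP.
  case=> [/eqP -> //|/flatten_mapP [j]|/eqP -> //].
  rewrite mem_iota add0n => Hj; rewrite /block !inE.
  by do ! [case/orP]; move/eqP ->; rewrite eqxx.
have H i1 j1 : (i1 == i) && (j1 < n) -> v \in block i1 j1 ->
    v \in flatten [seq block i j | j <- iota 0 n].
  by case/andP => /eqP -> Hj Hv; apply/flatten_mapP; exists j1; rewrite ?mem_iota.
case: v H => //=; try by move=> i1 H /eqP ->; rewrite eqxx; constructor.
all: by move=> i1 j1 H Hj; apply: Or32; apply: (H _ _ Hj); rewrite /block !inE eqxx ?orbT.
Qed.

Lemma mem_vertices v : (v \in vs) = valid_vtx v.
Proof.
rewrite mem_cat !inE mem_cat !inE; apply/or4P/idP.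
  case=> [/flatten_mapP [i]|/eqP -> //|/mapP [j]|/eqP -> //]; last by rewrite mem_iota => Hj ->.
  rewrite mem_iota mem_row /= => Hi.
  by case: v => //= [i' /eqP ->|i' /eqP ->|i' j|i' j|i' j|i' j|i' j] // /andP [/eqP -> ->]; rewrite Hi.
have H i : i < m -> v \in row i -> v \in flatten [seq row i | i <- iota 0 m].
  by move=> Hi Hv; apply/flatten_mapP; exists i; rewrite ?mem_iota.
case: v H => /=.
1,2: by move=> i H Hi; apply: Or41; apply: (H _ Hi); rewrite mem_row eqxx.
1-5: by move=> i j H /andP [Hi Hj]; apply: Or41; apply: (H _ Hi); rewrite mem_row eqxx Hj.
- by move=> _ _; apply: Or42.
- by move=> j _ Hj; apply: Or43; apply/mapP; exists j; rewrite ?mem_iota.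
- by move=> _ _; apply: Or44.
Qed.

Lemma mem_darts v k : ((v, k) \in ds) = valid_vtx v && (k < vdegree v).
Proof. by rewrite mem_net_darts mem_vertices gdeg_vlabel. Qed.

Lemma partner_ltn j : j < n -> partner j < n.
Proof. by rewrite /partner; case: ifP => Hj; [lia | case: (ltngtP j.+1 n) => //; lia]. Qed.

Lemma partnerK j : partner (partner j) = j.
Proof. by rewrite /partner; do ? case: ifP; lia. Qed.

Lemma partner_neq j : partner j != j.
Proof. by rewrite /partner; do ? case: ifP; lia. Qed.

Lemma cb_mate_in d : d \in ds -> cb_mate d \in ds.
Proof.
have Hp := partner_ltn.
case: d => v k; rewrite mem_darts.
case: v => [i|i|i j|i j|i j|i j|i j||j|] /=; move: k => [|[|[|[|k]]]] //=;
  rewrite ?andbT ?andbF // => H; try (case: ifP => ?); rewrite ?mem_darts /=; try lia.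
- by case: i H => [|i] H; rewrite mem_darts /=; lia.
- by case: i H => [|i] H; rewrite mem_darts /=; lia.
- by case: i H => [|i] H; rewrite mem_darts /= ?Hp; lia.
- by case: j H => [|j] H; rewrite mem_darts /=; lia.
Qed.

Lemma cb_mate_neq d : d \in ds -> cb_mate d != d.
Proof.
case: d => v k; rewrite mem_darts.
case: v => [i|i|i j|i j|i j|i j|i j||j|] /=; move: k => [|[|[|[|k]]]] //=;
  rewrite ?andbT ?andbF // => H; try (case: ifP => ?); try by apply/eqP.
- by case: i H => [|i] H; apply/eqP.
- by case: i H => [|i] H; apply/eqP.
- by case: i H => [|i] H; apply/eqP => // -[E]; have := partner_neq j; rewrite E eqxx.
- by case: j H => [|j] H; apply/eqP.
Qed.

Lemma cb_mateK d : d \in ds -> cb_mate (cb_mate d) = d.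
Proof.
case: d => v k; rewrite mem_darts.
case: v => [i|i|i j|i j|i j|i j|i j||j|] /=; move: k => [|[|[|[|k]]]] //=;
  rewrite ?andbT ?andbF // => H.
- by case: i H => [|i] H /=; rewrite ?H.
- by case: ifP => //= Hi; congr (VL _, _); lia.
- by case: ifP => //=; lia.
- by case: i H => [|i] H /=; rewrite ?H.
- by case: ifP => //= Hi; congr (VC _, _); lia.
- by case: i H => [|i] H /=; [rewrite partnerK | case/andP: H => ->].
- by case: j H => [|j] //= /andP [_ ->].
- by case: ifP => //= Hi; congr (VF _ _, _); lia.
- by case: ifP => //= Hj; congr (VH _ _, _); lia.
- by rewrite prednK // ltnn.
- by rewrite prednK // ltnn.
- by rewrite prednK // ltnn.
Qed.

(** The port leading to a vertex that is earlier in the list, as the certificate of connectedness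
    requires. *)
Definition parent_port (v : vtx) : nat :=
  match v with VX _ _ => 3 | VG _ _ => 1 | VH _ _ => 1 | _ => 0 end.

Lemma cb_parent a : 0 < a < size vs ->
  exists2 k, k < gdeg (vlabel (nth BZ vs a)) & index (cb_mate (nth BZ vs a, k)).1 vs < a.
Proof.
case/andP => Ha Hlt; set v := nth BZ vs a; have Hv : v \in vs by apply: mem_nth.
have Ea : a = vtx_num v.
  by rewrite -(index_vtx_num Hv) index_uniq //; case: (index_numbering map_vtx_num).
exists (parent_port v); first by rewrite gdeg_vlabel; case: (v).
have Hd : (v, parent_port v) \in ds.
  by rewrite mem_darts -mem_vertices Hv; case: (v).
have := cb_mate_in Hd; case E : (cb_mate _) => [w l]; rewrite mem_darts => /andP [Hw _] /=.
rewrite index_vtx_num ?mem_vertices // Ea.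
move: Ha Hv E; rewrite Ea mem_vertices /row_vertices.
case: (v) => [i|i|i j|i j|i j|i j|i j||j|] /=; rewrite /row_vertices => Ha Hv.
- by case: i Ha Hv => [|i] Ha Hv [<- _] /=; rewrite /row_vertices ?mulSn; lia.
- by case=> <- _ /=; rewrite /row_vertices; lia.
- by case: j Ha Hv => [|j] Ha Hv [<- _] /=; rewrite /row_vertices; lia.
all: case=> <- _ /=; rewrite /row_vertices; try lia.
all: case: (m) m_gt0 => // m' _; rewrite mulSn /=; lia.
Qed.

(** The area just above row [i] and to the left of column [J]. Above row 0 the arc over columns 2k
    and 2k+1 cuts off a face of its own, and the rest under the arc joining the outermost columns is
    face 1. Below the last row the columns end freely, so everything there is the outer face 0. *)
Definition region (i J : nat) : nat :=
  if i == 0 then (if odd J then 2 + J./2 else 1)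
  else if i == m then 0 else 2 + h + m * n + i.-1 * n.+1 + J.

(** The face enclosed by [VX], [VF], [VG] and [VH] of one block. *)
Definition inner (i j : nat) : nat := 2 + h + i * n + j.

Definition cb_faces := 2 + h + m * n + m.-1 * n.+1.

(* The face to the left of a dart, when the gadgets are drawn clockwise. *)
Definition face_label (d : vtx * nat) : nat :=
  match d with
  | (VL i, 0) => 0
  | (VL i, 1) => region i 0
  | (VL i, _) => region i.+1 0
  | (VC i, 0) => region i.+1 n
  | (VC i, 1) => region i n
  | (VC i, _) => 0
  | (VX i j, 0) => region i j
  | (VX i j, 1) => region i j.+1
  | (VX i j, 2) => inner i j
  | (VX i j, _) => region i.+1 j
  | (VF i j, 0) => region i.+1 j
  | (VF i j, 1) => inner i j
  | (VF i j, _) => region i.+1 j.+1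
  | (VG i j, 0) => region i.+1 j.+1
  | (VG i j, 1) => region i.+1 j.+1
  | (VG i j, _) => inner i j
  | (VT i j, _) => region i.+1 j.+1
  | (VH i j, 0) => region i.+1 j.+1
  | (VH i j, 1) => inner i j
  | (VH i j, _) => region i j.+1
  | _ => 0
  end.

Lemma face_label_mate v k : (v, k) \in ds ->
  face_label ((cb_mate (v, k)).1, (cb_mate (v, k)).2.+1 %% gdeg (vlabel (cb_mate (v, k)).1)) =
  face_label (v, k).
Proof.
have region_m J : region m J = 0 by rewrite /region eqxx; case: eqP m_gt0 => // ->.
have region_last i J : i < m -> (i.+1 < m) = false -> region i.+1 J = 0.
  by move=> H1 H2; have -> : i.+1 = m by lia.
rewrite mem_darts gdeg_vlabel.
case: v => [i|i|i j|i j|i j|i j|i j||j|] /=; move: k => [|[|[|[|k]]]] //=; rewrite ?andbT ?andbF // => H.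
- by case: i H.
- by case: ifP => //= Hi; rewrite region_last.
- by rewrite prednK //; lia.
- by case: i H => [|i] H //=; rewrite /region /= odd_double.
- by case: ifP.
- case: i H => [|i] H //=; rewrite /partner /region /=.
  by case Hj : (odd j); case: j Hj H => [|j] //= Hj H; rewrite ?Hj ?negbK ?uphalf_half ?Hj //; lia.
- by case: j H => [|j] H.
- by case: ifP => //= Hi; rewrite region_last //; case/andP: H.
- by case: ifP => //= Hj; have -> : j.+1 = n by lia.
- by rewrite prednK // region_m.
- by rewrite prednK // region_m.
Qed.

Lemma face_label_surj l : l < cb_faces -> exists2 d, d \in ds & face_label d = l.
Proof.
move=> Hl; case: l Hl => [|[|l]] Hl.
- by exists (VL 0, 0) => //; rewrite mem_darts /= m_gt0.
- by exists (VL 0, 1) => //; rewrite mem_darts /= m_gt0.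
have [H1|H1] := ltnP l h.
  exists (VX 0 l.*2.+1, 0); first by rewrite mem_darts /= m_gt0; lia.
  by rewrite /= /region /= odd_double /= uphalf_double.
have [H2|H2] := ltnP (l - h) (m * n).
  exists (VX ((l - h) %/ n) ((l - h) %% n), 2).
    by rewrite mem_darts /= ltn_divLR ?ltn_mod ?double_gt0 // H2 h_gt0.
  by rewrite /= /inner; have := divn_eq (l - h) n; lia.
pose q := l - h - m * n.
have Hq : q < m.-1 * n.+1 by move: Hl; rewrite /q /cb_faces; lia.
have E := divn_eq q n.+1; have Hm : q %% n.+1 < n.+1 by rewrite ltn_mod.
have Hi : q %/ n.+1 < m.-1 by rewrite ltn_divLR.
have R J : region (q %/ n.+1).+1 J = 2 + h + m * n + (q %/ n.+1) * n.+1 + J.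
  by rewrite /region /=; case: eqP => //; lia.
case EJ : (q %% n.+1) => [|j] in E Hm.
  exists (VL (q %/ n.+1), 2); first by rewrite mem_darts /=; lia.
  by rewrite /= R /q in E *; lia.
exists (VF (q %/ n.+1) j, 2); first by rewrite mem_darts /=; lia.
by rewrite /= R /q in E *; lia.
Qed.

Lemma cb_planar : planar_embedding (net vs vlabel cb_mate).
Proof.
have HK : 0 < cb_faces by [].
(* Reduction modulo [cb_faces] puts the labels into a finite type without a bound on them having to
   be proved. *)
apply: (@net_planar _ BZ vs vlabel cb_mate uniq_darts cb_mate_in cb_mate_neq cb_mateK
  'I_cb_faces (fun d => Ordinal (ltn_pmod (face_label d) HK))).
- by rewrite size_vertices; lia.
- exact: cb_parent.
- by move=> v k Hd; apply: val_inj; apply: (congr1 (modn^~ cb_faces)); apply: face_label_mate.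
- move=> l; have [d Hd E] := face_label_surj (ltn_ord l); exists d => //.
  by apply: val_inj; rewrite /= E modn_small.
- rewrite card_ord size_vertices size_darts /cb_faces /row_vertices /row_darts.
  by case: (m) m_gt0 => // m' _ /=; rewrite !mulSn; nia.
Qed.

End Crossbar.

(** * Satisfying assignments of the crossbar *)

Section CrossbarSemantics.
Variables (h m : nat) (tap : nat -> nat -> bool).
Hypothesis m_gt0 : 0 < m.
Hypothesis h_gt0 : 0 < h.

Notation n := h.*2.
Notation vs := (cb_vertices h m).
Notation vl := (vlabel tap).
Notation mate := (cb_mate h m).
Notation ds := (net_darts vs vl).
Notation sat := (ssat vs vl mate).

Definition complementary (x : nat -> bool) : Prop := forall k, k < h -> x k.*2.+1 = ~~ x k.*2.

Definition cnf_sat : Prop := exists x, complementary x /\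
  forall i, i < m -> exists j, [/\ j < n, tap i j & x j].

Lemma complementary_partner x j : complementary x -> j < n -> x (partner j) = ~~ x j.
Proof.
move=> Hx Hj; have Hk : j./2 < h by lia.
have := odd_double_half j; rewrite /partner; case: (odd j) => /= E.
  by rewrite -E /= add1n /= Hx // negbK.
by rewrite -E add0n Hx.
Qed.

Section Valuation.
Variables (z : bool) (x : nat -> bool) (v : nat -> nat -> bool).

Fixpoint row_val (i j : nat) : bool :=
  if j is j'.+1 then
    if tap i j' then row_val i j' || (x j' && v i j') else row_val i j' && (x j' || v i j')
  else z.

Definition tap_val (i j : nat) : bool := if tap i j then x j && v i j else x j || v i j.

Fixpoint chain_val (i : nat) : bool :=
  if i is i'.+1 then chain_val i' && row_val i' n else ~~ z.

(* [true] means that the edge points into the vertex, so an output port carries the negated value. *)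
Definition valuation (d : vtx * nat) : bool :=
  match d with
  | (VL i, 0) => z
  | (VL i, _) => ~~ z
  | (VC i, 0) => row_val i n
  | (VC i, 1) => chain_val i
  | (VC i, _) => ~~ chain_val i.+1
  | (VX i j, 0) => x j
  | (VX i j, 1) => ~~ row_val i j
  | (VX i j, 2) => ~~ x j
  | (VX i j, _) => row_val i j
  | (VF i j, 0) => x j
  | (VF i j, _) => ~~ x j
  | (VG i j, 0) => v i j
  | (VG i j, 1) => x j
  | (VG i j, _) => ~~ tap_val i j
  | (VT i j, _) => ~~ v i j
  | (VH i j, 0) => tap_val i j
  | (VH i j, 1) => row_val i j
  | (VH i j, _) => ~~ row_val i j.+1
  | (BZ, _) => z
  | (BX j, _) => x j
  | (BC, _) => chain_val m
  end.

Lemma valuation_sat : complementary x -> sat valuation.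
Proof.
move=> Hx; split.
  case=> w k; rewrite mem_darts.
  case: w => [i|i|i j|i j|i j|i j|i j||j|] /=; move: k => [|[|[|[|k]]]] //=;
    rewrite ?andbT ?andbF // => H; rewrite ?negbK //.
  - by case: i H => [|i] H /=; rewrite ?negbK.
  - by case: ifP.
  - rewrite -[if tap i n.-1 then _ else _]/(row_val i n.-1.+1) prednK //; lia.
  - by case: i H => [|i] H /=; rewrite ?negbK.
  - by case: ifP => //= Hi; rewrite -[_ && _]/(chain_val i.+1) ?negbK //; congr chain_val; lia.
  - by case: i H => [|i] /andP [_ Hj] /=; rewrite ?complementary_partner.
  - by case: j H => [|j] H.
  - by case: ifP.
  - case: ifP => //= Hj; have -> : n = j.+1 by lia.
    by [].
  - by rewrite -[_ && _]/(chain_val m.-1.+1) prednK.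
move=> w _; rewrite gdeg_vlabel.
case: w => [i|i|i j|i j|i j|i j|i j||j|] /=; rewrite /mkseq /= ?/tap_val.
all: try by case: z.
all: try by case: (x j).
- by case: (row_val i n); case: (chain_val i).
- by case: (x j); case: (row_val i j).
- by case: (tap i j); case: (x j); case: (v i j).
- by case: (v i j).
- by case: (tap i j); case: (row_val i j); case: (x j); case: (v i j).
- by case: (chain_val m).
Qed.

(** The terminals override the columns: [true && (_ || true)] and [false || (_ && false)] keep the
    row value, and the two other cases likewise. *)
Lemma row_val_const i j b : z = b -> (forall j', j' < j -> v i j' = b) -> row_val i j = b.
Proof.
move=> Hz; elim: j => //= j IH Hv; rewrite IH => [|j' Hj']; last by apply: Hv; lia.
by rewrite Hv //; case: (b); case: (tap i j); rewrite ?andbF ?orbT.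
Qed.

(** With false terminals a row can only lose the value true, and a false untapped column makes it do
    so, even when [z] is true. *)
Lemma row_val_dead i j0 j : ~~ tap i j0 -> j0 < j -> ~~ x j0 ->
  (forall j', v i j' = false) -> row_val i j = false.
Proof.
move=> Ht Hj Hx Hv; elim: j Hj => //= j IH; rewrite ltnS leq_eqVlt => /orP [/eqP <-|/IH ->].
  by rewrite (negbTE Ht) Hv (negbTE Hx) andbF.
by rewrite Hv andbF; case: ifP.
Qed.

(** With true terminals an untapped column passes the row value on and a tapped one adds its
    literal. *)
Lemma row_val_clause i j : z = false -> (forall j', v i j' = true) ->
  row_val i j = has (fun j' => tap i j' && x j') (iota 0 j).
Proof.
move=> Hz Hv; elim: j => // j IH; rewrite -[in RHS]addn1 iotaD has_cat /= add0n orbF -IH Hv.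
by case: (tap i j); rewrite ?andbT ?orbF ?orbT ?andbT.
Qed.

Lemma chain_val_all i : z = false -> (forall i', i' < i -> row_val i' n = true) -> chain_val i.
Proof.
move=> Hz; elim: i => [|i IH] H /=; first by rewrite Hz.
by rewrite IH ?H // => i' Hi'; apply: H; lia.
Qed.

Lemma chain_val_z i : z -> chain_val i = false.
Proof. by move=> Hz; elim: i => /= [|i ->]; rewrite ?Hz. Qed.

End Valuation.

(** Columns of the parity of [j] get [b] and the others its negation: a complementary valuation with
    a prescribed value at column [j]. *)
Definition const_lits (j : nat) (b : bool) : nat -> bool := fun j' => b (+) (odd j != odd j').

Lemma const_lits_comp j b : complementary (const_lits j b).
Proof. by move=> k _; rewrite /const_lits /= odd_double; case: (odd j); case: b. Qed.

Lemma const_litsE j b : const_lits j b j = b.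
Proof. by rewrite /const_lits eqxx addbF. Qed.

(* The untapped column of row 0 is needed for the first chain gate: there the other input is [~~ z], and
   a row with [z = true] gets the value false only through an AND gate. *)
Lemma cb_cond_b (j0 : nat) : j0 < n -> ~~ tap 0 j0 -> cnf_sat ->
  cond_b (net vs vl mate) /\ ~ cond_a (net vs vl mate).
Proof.
move=> Hj0 Ht [xs [Hxs Hsat]].
apply: (@net_cond_b _ BZ vs vl mate (uniq_darts tap m_gt0 h_gt0) (@cb_mate_in h m tap m_gt0 h_gt0)) => w L.
rewrite mem_vertices => Hw HL.
have sat_row v i : i < m -> (forall j, v i j = true) -> row_val false xs v i n.
  move=> Hi Hv; rewrite row_val_clause //; apply/hasP.
  by have [j [Hj Hti Hx]] := Hsat i Hi; exists j; rewrite ?mem_iota ?Hti.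
suff: exists z x v, complementary x /\
   mkseq (fun k => valuation z x v (w, k)) (gdeg (vl w)) = L.
  by case=> z [x [v [Hx E]]]; exists (valuation z x v); split=> //; apply: valuation_sat.
have Es := gconstraint_size HL; move: Es HL; rewrite gdeg_vlabel.
case: w Hw => [i|i|i j|i j|i j|i j|i j||j|] /= Hw.
- case: L => [|a [|b [|c [|]]]] // _ HL.
  exists a, (const_lits 0 true), (fun _ _ => true); split; first exact: const_lits_comp.
  by move: HL; rewrite !inE; case: a; case: b; case: c.
- case: L => [|r [|t [|o [|]]]] // _ HL.
  have -> : o = ~~ (t && r) by move: HL; rewrite !inE; case: r; case: t; case: o.
  (* Satisfiability is used only here and at [BC]: a true chain value needs [z] false and all
     earlier rows true. For a false row behind a true chain, only the terminals of row [i] are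
     switched to false. *)
  clear HL; case: t; case: r.
  + exists false, xs, (fun _ _ => true); split=> //.
    rewrite /mkseq /= (sat_row (fun _ _ => true)) // (@chain_val_all false xs) // => i' Hi'.
    by apply: sat_row => //; lia.
  + exists false, xs, (fun i' _ => i' != i); split=> //.
    rewrite /mkseq /= (@row_val_const false xs _ i n false) //= ?eqxx //.
    rewrite (@chain_val_all false xs) // => i' Hi'.
    by apply: sat_row => [|j]; [lia | apply/eqP; lia].
  + exists true, xs, (fun _ _ => true); split=> //.
    by rewrite /mkseq /= (@row_val_const true xs _ i n true) // chain_val_z.
  + case: i Hw => [|i] Hw.
      exists true, (const_lits j0 false), (fun _ _ => false); split; first exact: const_lits_comp.
      by rewrite /mkseq /= (@row_val_dead _ _ _ 0 j0) // const_litsE.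
    exists false, xs, (fun _ _ => false); split=> //.
    by rewrite /mkseq /= (@row_val_const false xs _ i.+1 n false) // 
      (@row_val_const false xs _ i n false) // andbF.
- case: L => [|a [|b [|c [|d [|]]]]] // _ HL.
  exists d, (const_lits j a), (fun _ _ => d); split; first exact: const_lits_comp.
  rewrite /mkseq /= const_litsE (@row_val_const d _ _ i j d) //.
  by move: HL; rewrite !inE; case: a; case: b; case: c; case: d.
- case: L => [|a [|b [|c [|]]]] // _ HL.
  exists true, (const_lits j a), (fun _ _ => true); split; first exact: const_lits_comp.
  by rewrite /mkseq /= const_litsE; move: HL; rewrite !inE; case: a; case: b; case: c.
- case: L => [|a [|b [|c [|]]]] // _ HL.
  exists true, (const_lits j b), (fun _ _ => a); split; first exact: const_lits_comp.
  rewrite /mkseq /= /tap_val const_litsE; move: HL.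
  by case: (tap i j); rewrite !inE; case: a; case: b; case: c.
- case: L => [|a [|]] // _ HL.
  exists true, xs, (fun _ _ => ~~ a); split=> //.
  by rewrite /mkseq /= negbK.
- case: L => [|t [|r [|o [|]]]] // _ HL.
  (* The terminal value [tap i j] is neutral for the gate [VG i j], whose result becomes the column
     value [t]; the other terminals keep the row at [r]. *)
  exists r, (const_lits j t), (fun _ j' => if j' == j then tap i j else r).
  split; first exact: const_lits_comp.
  rewrite /mkseq /= /tap_val const_litsE eqxx (@row_val_const r _ _ i j r) //.
    by move: HL; case: (tap i j); rewrite !inE; case: t; case: r; case: o.
  by move=> j' Hj'; case: eqP => //; lia.
- case: L => [|a [|]] // _ HL.
  by exists a, xs, (fun _ _ => true).
- case: L => [|a [|]] // _ HL.
  exists true, (const_lits j a), (fun _ _ => true); split; first exact: const_lits_comp.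
  by rewrite /mkseq /= const_litsE.
- case: L => [|[] [|]] // _ HL.
    exists false, xs, (fun _ _ => true); split=> //.
    rewrite /mkseq /= (@chain_val_all false xs) // => i' Hi'.
    exact: sat_row.
  by exists true, xs, (fun _ _ => true); split=> //; rewrite /mkseq /= chain_val_z.
Qed.

(** A true end of the chain forces [z] false and all row ends true. Traced leftwards, a true row
    value comes from the preceding block or from a tapped true column; the left end carries [z], so
    some block must be of the second kind. *)
Lemma sat_final A : sat A -> A (BC, 0) -> cnf_sat.
Proof.
case=> He Hv HC.
have edge v k : valid_vtx h m v -> k < vdegree v -> A (mate (v, k)) = ~~ A (v, k).
  by move=> H1 H2; apply: He; rewrite mem_darts H1.
have con v : valid_vtx h m v -> mkseq (fun k => A (v, k)) (vdegree v) \in gconstraint (vl v).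
  by move=> H; rewrite -(gdeg_vlabel tap); apply: Hv; rewrite mem_vertices.
have conL i : i < m -> A (VL i, 1) = ~~ A (VL i, 0) /\ A (VL i, 2) = ~~ A (VL i, 0).
  move=> Hi; have := con (VL i) Hi; rewrite /mkseq /= !inE.
  by case: (A (VL i, 0)); case: (A (VL i, 1)); case: (A (VL i, 2)).
have conC i : i < m -> A (VC i, 2) = ~~ (A (VC i, 0) && A (VC i, 1)).
  move=> Hi; have := con (VC i) Hi; rewrite /mkseq /= !inE.
  by case: (A (VC i, 0)); case: (A (VC i, 1)); case: (A (VC i, 2)).
have conX i j : i < m -> j < n -> A (VX i j, 2) = ~~ A (VX i j, 0) /\ A (VX i j, 1) = ~~ A (VX i j, 3).
  move=> Hi Hj; have := con (VX i j); rewrite /= Hi Hj => /(_ isT); rewrite /mkseq /= !inE.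
  by case: (A (VX i j, 0)); case: (A (VX i j, 1)); case: (A (VX i j, 2)); case: (A (VX i j, 3)).
have conF i j : i < m -> j < n -> A (VF i j, 1) = ~~ A (VF i j, 0) /\ A (VF i j, 2) = ~~ A (VF i j, 0).
  move=> Hi Hj; have := con (VF i j); rewrite /= Hi Hj => /(_ isT); rewrite /mkseq /= !inE.
  by case: (A (VF i j, 0)); case: (A (VF i j, 1)); case: (A (VF i j, 2)).
have conG i j : i < m -> j < n -> tap i j -> ~~ A (VG i j, 2) -> A (VG i j, 1).
  move=> Hi Hj Ht; have := con (VG i j); rewrite /= Hi Hj Ht => /(_ isT); rewrite /mkseq /= !inE.
  by case: (A (VG i j, 0)); case: (A (VG i j, 1)); case: (A (VG i j, 2)).
have conH i j : i < m -> j < n -> ~~ A (VH i j, 2) -> A (VH i j, 1) || (tap i j && A (VH i j, 0)).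
  move=> Hi Hj; have := con (VH i j); rewrite /= Hi Hj => /(_ isT); rewrite /mkseq /=.
  by case: (tap i j); rewrite !inE; case: (A (VH i j, 0)); case: (A (VH i j, 1)); case: (A (VH i j, 2)).
pose x j := A (VX 0 j, 0).
have Hcol i j : i < m -> j < n -> A (VX i j, 0) = x j.
  elim: i => // i IH Hi Hj.
  have Hi' : i < m by apply: ltnW.
  have := edge (VF i j) 2; rewrite /= Hi' Hj Hi => /(_ isT isT) ->.
  case: (conF i j Hi' Hj) => _ ->; rewrite negbK.
  have := edge (VX i j) 2; rewrite /= Hi' Hj => /(_ isT isT) ->.
  by case: (conX i j Hi' Hj) => -> _; rewrite negbK IH.
have Hchain i : i <= m -> (if i < m then A (VC i, 1) else A (BC, 0)) ->
    A (VC 0, 1) /\ forall i', i' < i -> A (VC i', 0).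
  elim: i => [|i IH] Hi; first by rewrite m_gt0.
  have := edge (VC i) 2; rewrite /= Hi => /(_ isT isT) E H.
  have : A (VC i, 0) && A (VC i, 1).
    by rewrite -[_ && _]negbK -conC // -E; move: H; case: ifP.
  case/andP => H0 H1; have := IH (ltnW Hi); rewrite Hi => /(_ H1) [Hz Hr]; split=> // i'.
  by rewrite ltnS leq_eqVlt => /orP [/eqP ->|/Hr].
have := Hchain m (leqnn m); rewrite ltnn => /(_ HC) [Hz Hr].
(* The top arc between [VC 0] and [VL 0] turns the true start of the chain into a false leftmost
   column. *)
have HZ i : i < m -> A (VL i, 0) = false.
  elim: i => [|i IH] Hi.
    have := edge (VC 0) 1; rewrite /= m_gt0 => /(_ isT isT) ->.
    by rewrite Hz.
  have Hi' := ltnW Hi; have := edge (VL i) 2; rewrite /= Hi' Hi => /(_ isT isT) ->.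
  by case: (conL i Hi') => _ ->; rewrite negbK IH.
exists x; split.
  move=> k Hk; have := edge (VX 0 k.*2) 0; rewrite /= m_gt0 /partner odd_double /=.
  by apply=> //; lia.
move=> i Hi.
have Hstep j : j < n -> ~~ A (VH i j, 2) -> A (VX i j, 3) \/ tap i j /\ x j.
  move=> Hj /(conH i j Hi Hj)/orP [H1|/andP [Ht H0]].
    left; have := edge (VH i j) 1; rewrite /= Hi Hj => /(_ isT isT); rewrite H1.
    by case: (conX i j Hi Hj) => _ -> /negbFE.
  right; split=> //.
  have := edge (VH i j) 0; rewrite /= Hi Hj => /(_ isT isT); rewrite H0 => /negbT.
  move=> /(conG i j Hi Hj Ht) HG.
  have := edge (VG i j) 1; rewrite /= Hi Hj => /(_ isT isT); rewrite HG.
  case: (conF i j Hi Hj) => -> _ /negbFE HF.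
  have := edge (VX i j) 2; rewrite /= Hi Hj => /(_ isT isT); rewrite HF.
  by case: (conX i j Hi Hj) => -> _; rewrite negbK Hcol.
have Hrow j : j < n -> A (VX i j, 3) -> exists j', [/\ j' < n, tap i j' & x j'].
  elim: j => [|j IH] Hj H.
    have := edge (VL i) 1; rewrite /= Hi => /(_ isT isT); rewrite H.
    by case: (conL i Hi) => -> _; rewrite HZ.
  have Hj' := ltnW Hj.
  have := edge (VH i j) 2; rewrite /= Hi Hj' Hj H => /(_ isT isT) /esym /(Hstep j Hj') [|[Ht Hx]].
    exact: IH.
  by exists j.
have Hn : n.-1 < n by lia.
have := edge (VC i) 0; rewrite /= Hi (Hr i Hi) => /(_ isT isT) /negbT /(Hstep _ Hn) [|[Ht Hx]].
  exact: Hrow.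
by exists n.-1.
Qed.

Lemma cb_cond_a : ~ cnf_sat -> cond_a (net vs vl mate).
Proof.
move=> Hns.
apply: (net_cond_a BZ (uniq_darts tap m_gt0 h_gt0) (@cb_mate_in h m tap m_gt0 h_gt0)
  (@cb_mate_neq h m tap m_gt0 h_gt0) (@cb_mateK h m tap m_gt0 h_gt0) (d := (BC, 0)) (b := false)).
  by rewrite mem_darts.
by move=> A HA; apply/negP => /(sat_final HA).
Qed.

Lemma cb_valid : valid_instance (net vs vl mate).
Proof.
apply: (net_valid BZ (uniq_darts tap m_gt0 h_gt0) (@cb_mate_in h m tap m_gt0 h_gt0)
  (@cb_mate_neq h m tap m_gt0 h_gt0) (@cb_mateK h m tap m_gt0 h_gt0)).
  exact: cb_planar.
by move=> v _ k; case: v => [i|i|i j|i j|i j|i j|i j||j|] //=; try case: tap => //; case=> <-.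
Qed.

End CrossbarSemantics.

(** * Tableaux of a Turing machine as clause sets *)

Definition tv (x : seq bool) (env : nat -> nat) (e : expr) : bool := eval x env e != 0.
Definition ENot (e : expr) : expr := EEq e (ECst 0).
Definition ESucc (e : expr) : expr := EAdd e (ECst 1).
Fixpoint EPow (e : expr) (k : nat) : expr := if k is k'.+1 then EMul e (EPow e k') else ECst 1.
Definition EBool (b : bool) : expr := ECst b.

Lemma tv_and x env a b : tv x env (EMul a b) = tv x env a && tv x env b.
Proof. by rewrite /tv /= muln_eq0 negb_or. Qed.
Lemma tv_or x env a b : tv x env (EAdd a b) = tv x env a || tv x env b.
Proof. by rewrite /tv /= addn_eq0 negb_and. Qed.
Lemma tv_not x env a : tv x env (ENot a) = ~~ tv x env a.
Proof. by rewrite /tv /=; case: (eval x env a). Qed.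
Lemma tv_eq x env a b : tv x env (EEq a b) = (eval x env a == eval x env b).
Proof. by rewrite /tv /=; case: (_ == eval x env b). Qed.
Lemma tv_lt x env a b : tv x env (ELt a b) = (eval x env a < eval x env b).
Proof. by rewrite /tv /=; case: ltnP. Qed.
Lemma tv_inp x env a : tv x env (EInp a) = nth false x (eval x env a).
Proof. by rewrite /tv /=; case: nth. Qed.
Lemma tv_bool x env b : tv x env (EBool b) = b.
Proof. by case: b. Qed.
Lemma eval_pow x env e k : eval x env (EPow e k) = eval x env e ^ k.
Proof. by elim: k => [|k IH] //=; rewrite IH expnS. Qed.

Definition tvE := (tv_and, tv_or, tv_not, tv_eq, tv_lt, tv_inp, tv_bool).

Section Tableau.
Variable M : TM.
Notation tsy := (option (bool + tm_aux M))%type.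
Notation content := (tsy * option (tm_state M))%type.
Variables (pc pk tc tk : nat).

(* A content is a tape symbol, with the state of the machine if the head is on the cell. *)
Definition blank : content := (None, None).

Definition sym_at (c : config M) (H p : nat) : tsy :=
  let: (q, l, h, r) := c in
  if p < H then nth None l (H - p.+1) else nth None (h :: r) (p - H).

Definition state_of (c : config M) : tm_state M := c.1.1.1.

Definition cell_at (c : config M) (H p : nat) : content :=
  (sym_at c H p, if p == H then Some (state_of c) else None).

Definition move_head (c : config M) (H : nat) : nat :=
  let: (q, l, h, r) := c in
  if @tm_halt M q then H
  else let: (_, _, dir) := @tm_delta M q h in if dir then H.+1 else H.-1.

Definition next_content (a b c : content) : content :=
  match b.2 with
  | Some q => if @tm_halt M q then b else ((@tm_delta M q b.1).1.2, None)
  | None =>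
      (b.1,
       match a.2 with
       | Some q => if @tm_halt M q then None
                   else let: (q', _, dir) := @tm_delta M q a.1 in if dir then Some q' else None
       | None =>
           match c.2 with
           | Some q => if @tm_halt M q then None
                       else let: (q', _, dir) := @tm_delta M q c.1 in if dir then None else Some q'
           | None => None
           end
       end)
  end.

(** A left move from cell 0 would leave the head in place by truncated subtraction, hence
    [0 < H]. *)
Lemma cell_at_step (c : config M) H p : 0 < H ->
  cell_at (tm_step c) (move_head c H) p =
  next_content (if p == 0 then blank else cell_at c H p.-1) (cell_at c H p) (cell_at c H p.+1).
Proof.
case: c => [[[q l] h] r] HH.
have -> : (if p == 0 then blank else cell_at (q, l, h, r) H p.-1) =
   (if p == 0 then None else sym_at (q, l, h, r) H p.-1, if p == H.+1 then Some q else None).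
  by case: p => [|p].
rewrite /next_content /cell_at /state_of /=.
case Hq : (tm_halt q).
  rewrite -[if p < H then _ else _]/(sym_at (q, l, h, r) H p).
  by case: (p == H); case: (p == H.+1); case: (p.+1 == H); rewrite /= ?Hq.
case: (eqVneq p H) => [->|HpH] /=; rewrite ?Hq.
  rewrite ltnn subnn /=; case: (tm_delta q h) => [[q' w] []] /=.
    by rewrite ltnSn subnn (ltn_eqF (ltnSn H)).
  have -> : (H < H.-1) = false by lia.
  have -> : H - H.-1 = 1 by lia.
  by have -> : (H == H.-1) = false by lia.
case: (eqVneq p H.+1) => [->|HpH1] /=; rewrite ?Hq.
  rewrite ltnn subnn /=.
  case: (tm_delta q h) => [[q' w] []] /=.
    have -> : (H.+1 < H) = false by lia.
    by rewrite ltnn eqxx subnn subSnn /= nth0.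
  have -> : (H.+1 < H) = false by lia.
  have -> : (H.+1 < H.-1) = false by lia.
  have -> : (H.+1 == H.-1) = false by lia.
  have -> : H.+1 - H.-1 = 2 by lia.
  by rewrite subSnn.
case: (eqVneq p.+1 H) => [Hp|HpS]; rewrite /= ?Hq.
  rewrite Hp ltnn subnn /= -Hp.
  case: (tm_delta q h) => [[q' w] []] /=.
    have -> : (p < p.+2) = true by lia.
    have -> : (p == p.+2) = false by lia.
    by rewrite ltnSn subSS subSnn.
  by rewrite ltnn eqxx ltnSn !subnn /= nth0.
case: (tm_delta q h) => [[q' w] []] /=.
  have -> : (p == H.+1) = false by apply/negbTE.
  case: (ltngtP p H) HpH => // Hp _.
    have -> : (p < H.+1) = true by lia.
    by have -> : H.+1 - p.+1 = (H - p.+1).+1 by lia.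
  have -> : (p < H.+1) = false by lia.
  have -> : p - H = (p - H.+1).+1 by lia.
  by congr (_, _); rewrite /=; apply: nth_headbehead.
have -> : (p == H.-1) = false by lia.
case: (ltngtP p H) HpH => // Hp _.
  have -> : (p < H.-1) = true by lia.
  by rewrite nth_behead; congr (nth _ _ _, _); lia.
have -> : (p < H.-1) = false by lia.
have -> : p - H.-1 = (p - H.+1).+2 by lia.
by have -> : p - H = (p - H.+1).+1 by lia.
Qed.

Section Trace.
Variables (s : seq bool) (O : nat).

Definition cfg (t : nat) : config M := iter t (@tm_step M) (tm_init M s).
Fixpoint hpos (t : nat) : nat := if t is t'.+1 then move_head (cfg t') (hpos t') else O.

Lemma hpos_near t : t <= O -> O - t <= hpos t <= O + t.
Proof.
elim: t => [|t IH] Ht /=; first lia.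
have := IH (ltnW Ht); rewrite /move_head; case: (cfg t) => [[[q l] h] r].
by case: tm_halt; [lia | case: tm_delta => [[q' w] []]; lia].
Qed.

Lemma cfg_halted t0 t : @tm_halt M (state_of (cfg t0)) -> t0 <= t ->
  cfg t = cfg t0 /\ hpos t = hpos t0.
Proof.
move=> Hh /subnKC <-; elim: (t - t0) => [|k [IH1 IH2]]; first by rewrite addn0.
rewrite addnS /= -/(cfg (t0 + k)) IH1 IH2; move: Hh; rewrite /move_head.
by case: (cfg t0) => [[[q l] h] r] /=; rewrite /state_of /= => ->.
Qed.

(** After halting the head rests, so the bound for the running time holds at all later times. *)
Lemma hpos_bound t0 T t : @tm_halt M (state_of (cfg t0)) -> t0 <= T -> T <= O ->
  O - T <= hpos t <= O + T.
Proof.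
move=> Hh H0 HT; have [Hle|Hgt] := leqP t T; first by have := @hpos_near t; lia.
have [_ ->] := cfg_halted Hh (leq_trans H0 (ltnW Hgt)).
by have := @hpos_near t0; lia.
Qed.

Lemma cell_at_init p : cell_at (cfg 0) O p =
  (if p < O then None else nth None [seq Some (inl b) | b <- s] (p - O),
   if p == O then Some (@tm_start M) else None).
Proof.
rewrite /cell_at /=; congr (_, _); case: ltnP => Hp; first by rewrite nth_nil.
exact: nth_headbehead.
Qed.

End Trace.

Definition En : expr := EVar 0.
Definition Et : expr := EVar 1.
Definition Ep : expr := EVar 2.

(* The tableau has as many time steps as cells. The head starts at cell [origE], further right than the
   running time; [endE] is the end of the doubled input and [wstartE] the start of the witness. *)
Definition witE : expr := EAdd (EMul (ECst pc) (EPow En pk)) (ECst pc).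
Definition timeE : expr :=
  EAdd (EMul (ECst tc) (EPow (EAdd (EAdd (EMul (ECst 2) En) (ECst 2)) witE) tk)) (ECst tc).
Definition origE : expr := ESucc timeE.
Definition endE : expr := EAdd origE (EMul (ECst 2) En).
Definition wstartE : expr := EAdd endE (ECst 2).
Definition sizeE : expr := EAdd (EAdd (EAdd wstartE witE) timeE) (ECst 2).

Definition witF (n : nat) : nat := pc * n ^ pk + pc.
Definition timeF (n : nat) : nat := tc * (2 * n + 2 + witF n) ^ tk + tc.
Definition origF (n : nat) : nat := timeF n + 1.
Definition endF (n : nat) : nat := origF n + 2 * n.
Definition wstartF (n : nat) : nat := endF n + 2.
Definition sizeF (n : nat) : nat := wstartF n + witF n + timeF n + 2.

Lemma eval_wit x env : eval x env witE = witF (env 0).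
Proof. by rewrite /= eval_pow. Qed.
Lemma eval_time x env : eval x env timeE = timeF (env 0).
Proof. by rewrite /= !eval_pow /= eval_pow. Qed.
Lemma eval_orig x env : eval x env origE = origF (env 0).
Proof. by rewrite -[LHS]/(eval x env timeE + 1) eval_time. Qed.
Lemma eval_end x env : eval x env endE = endF (env 0).
Proof. by rewrite -[LHS]/(eval x env origE + _) eval_orig. Qed.
Lemma eval_wstart x env : eval x env wstartE = wstartF (env 0).
Proof. by rewrite -[LHS]/(eval x env endE + _) eval_end. Qed.
Lemma eval_size x env : eval x env sizeE = sizeF (env 0).
Proof.
by rewrite -[LHS]/(eval x env wstartE + eval x env witE + eval x env timeE + 2)
  eval_wstart eval_wit eval_time.
Qed.

(** Clause expressions use variables 0 to 2 only; they keep their values when variables 3 and 4 are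
    bound to the cell of a literal. *)
Fixpoint below (d : nat) (e : expr) : bool :=
  match e with
  | EVar i => i < d
  | ECst _ => true
  | EAdd a b | EMul a b | EEq a b | ELt a b => below d a && below d b
  | EPred a | EInp a => below d a
  end.

Lemma eval_below x d e env env' :
  below d e -> (forall i, i < d -> env i = env' i) -> eval x env e = eval x env' e.
Proof.
move=> + H; elim: e => //=.
all: try by move=> a IHa b IHb /andP [/IHa -> /IHb ->].
all: by move=> a IHa /IHa ->.
Qed.

Lemma below_pow d e k : below d e -> below d (EPow e k).
Proof. by move=> H; elim: k => //= k ->; rewrite H. Qed.

Lemma below_size : [/\ below 3 witE, below 3 timeE, below 3 origE, below 3 endE & below 3 wstartE].
Proof.
have H1 : below 3 witE by rewrite /= below_pow.
have H2 : below 3 timeE by rewrite /= below_pow //= below_pow.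
have H3 : below 3 origE by rewrite -[below _ _]/(below 3 timeE && true) H2.
have H4 : below 3 endE by rewrite -[below _ _]/(below 3 origE && true) H3.
by split=> //; rewrite -[below _ _]/(below 3 endE && true) H4.
Qed.

Lemma below_sizeE : below 3 sizeE.
Proof.
case: below_size => H1 H2 _ _ H5.
by rewrite -[below _ _]/([&& (below 3 wstartE && below 3 witE) && below 3 timeE & true]) H1 H2 H5.
Qed.

(** One record describes a family of literals indexed by [Et] and [Ep]; the guard tells for which
    indices the literal is present. *)
Record literal := Literal {
  lguard : expr; ltime : expr; lpos : expr; lcell : content; lsign : bool
}.

Record clause := Clause { capp : expr; clits : seq literal }.

(** The start state sits at [origE], which is the first input cell or, for the empty input, the
    first cell of the separator. *)
Definition symbol_lits (g pos : expr) (a : tsy) : seq literal :=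
  [:: Literal (EMul g (EEq pos origE)) (ECst 0) pos (a, Some (@tm_start M)) true;
      Literal (EMul g (ENot (EEq pos origE))) (ECst 0) pos (a, None) true].

Definition bitc (b : bool) : tsy := Some (inl b).
Definition in_witE : expr := EMul (ENot (ELt Ep wstartE)) (ELt Ep (EAdd wstartE witE)).

(** A single scheme for all initial cells outside the doubled input, the guards selecting the
    admissible contents. Only in the witness area is there a choice: a bit or a blank. *)
Definition cl_start : clause :=
  Clause (EMul (EEq Et (ECst 0)) (ENot (EMul (ENot (ELt Ep origE)) (ELt Ep endE))))
   ([:: Literal (EAdd (ELt Ep origE) (ENot (ELt Ep wstartE))) (ECst 0) Ep blank true;
        Literal in_witE (ECst 0) Ep (bitc true, None) true;
        Literal in_witE (ECst 0) Ep (bitc false, None) true;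
        Literal (EEq Ep (ESucc endE)) (ECst 0) Ep (bitc false, None) true]
    ++ symbol_lits (EEq Ep endE) Ep (bitc true)).

(* Here the row index [Et] ranges over the positions of the input string, not over time. *)
Definition cl_input (d : nat) : clause :=
  let pos := EAdd (EAdd origE (EMul (ECst 2) Et)) (ECst d) in
  Clause (EMul (ELt Et En) (EEq Ep (ECst 0)))
    (symbol_lits (EInp Et) pos (bitc true) ++ symbol_lits (ENot (EInp Et)) pos (bitc false)).

(** Blanks propagate to the right in the witness area, so the bits before them form one string. *)
Definition cl_pad : clause :=
  Clause (EMul (EEq Et (ECst 0)) in_witE)
    [:: Literal (ECst 1) (ECst 0) Ep blank false;
        Literal (ECst 1) (ECst 0) (ESucc Ep) blank true].

(** Beyond the border a neighbour counts as [blank]: other windows do not apply there, and the guard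
    drops the literal of the missing cell. *)
Definition cl_window (a b c : content) : clause :=
  Clause (EMul (ELt (ESucc Et) sizeE)
           (EMul (EAdd (ENot (EEq Ep (ECst 0))) (EBool (a == blank)))
                 (EAdd (ELt (ESucc Ep) sizeE) (EBool (c == blank)))))
    [:: Literal (ENot (EEq Ep (ECst 0))) Et (EPred Ep) a false;
        Literal (ECst 1) Et Ep b false;
        Literal (ELt (ESucc Ep) sizeE) Et (ESucc Ep) c false;
        Literal (ECst 1) (ESucc Et) Ep (next_content a b c) true].

Definition is_bit (a : tsy) : bool := if a is Some (inl _) then true else false.

(** The output is [[:: true]] exactly if the head reads a true bit and the next cell holds no
    bit. *)
Definition bad_final (a b : content) : bool :=
  if a.2 is Some q then ~~ [&& @tm_halt M q, a.1 == bitc true & ~~ is_bit b.1] else false.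

Definition cl_final (a b : content) : clause :=
  Clause (EMul (EEq (ESucc Et) sizeE) (EMul (ELt (ESucc Ep) sizeE) (EBool (bad_final a b))))
    [:: Literal (ECst 1) Et Ep a false; Literal (ECst 1) Et (ESucc Ep) b false].

(* Only implications: contents need not be unique in a cell, but every satisfying assignment contains
   the tableau of the run on some witness. *)
Definition clauses : seq clause :=
  [:: cl_start; cl_input 0; cl_input 1; cl_pad] ++
  [seq cl_window abc.1.1 abc.1.2 abc.2 | abc <- enum {: content * content * content}] ++
  [seq cl_final ab.1 ab.2 | ab <- enum {: content * content}].

Definition row_env (n t p : nat) : nat -> nat := upd (upd (env0 n) 1 t) 2 p.

(** A literal outside the tableau cannot count, since only cells inside have a column. *)
Definition lit_true (x : seq bool) (env : nat -> nat) (y : nat -> nat -> content -> bool)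
    (l : literal) : bool :=
  [&& tv x env (lguard l), eval x env (ltime l) < sizeF (env 0), eval x env (lpos l) < sizeF (env 0) &
   y (eval x env (ltime l)) (eval x env (lpos l)) (lcell l) == lsign l].

Definition clause_below (cl : clause) : bool :=
  below 3 (capp cl) &&
  all (fun l => [&& below 3 (lguard l), below 3 (ltime l) & below 3 (lpos l)]) (clits cl).

Definition clause_true (x : seq bool) (y : nat -> nat -> content -> bool) (t p : nat)
    (cl : clause) : bool :=
  let env := row_env (size x) t p in
  tv x env (capp cl) ==> has (lit_true x env y) (clits cl).

Opaque witE timeE origE endE wstartE sizeE.
Arguments witF : simpl never.
Arguments timeF : simpl never.
Arguments origF : simpl never.
Arguments endF : simpl never.
Arguments wstartF : simpl never.
Arguments sizeF : simpl never.

Definition evE := (eval_wit, eval_time, eval_orig, eval_end, eval_wstart, eval_size).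

Definition in_wit (n p : nat) : bool := wstartF n <= p < wstartF n + witF n.

Lemma tv_in_wit x n t p : tv x (row_env n t p) in_witE = in_wit n p.
Proof.
rewrite /in_witE !tvE.
by rewrite /= !evE /= -leqNgt. Qed.

Lemma below_in_wit : below 3 in_witE.
Proof.
have [H1 _ _ _ H5] := below_size.
by rewrite -[below _ _]/((below 3 wstartE && true) && (below 3 wstartE && below 3 witE)) H1 H5.
Qed.

Opaque in_witE.

Lemma clauses_below : all clause_below clauses.
Proof.
have [H1 H2 H3 H4 H5] := below_size; have H6 := below_sizeE; have H7 := below_in_wit.
rewrite /clauses !all_cat !all_map; apply/and3P; split.
- by rewrite /= /clause_below /= H3 H4 H5 H7.
- by apply/allP => u _; rewrite /= /clause_below /= H6.
- by apply/allP => u _; rewrite /= /clause_below /= H6.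
Qed.

(** These linear relations are what [lia] is given; the polynomials themselves stay folded. *)
Lemma allowed_sizes n : [/\ timeF n < origF n, endF n = origF n + 2 * n, wstartF n = endF n + 2 &
  sizeF n = wstartF n + witF n + timeF n + 2].
Proof. by split=> //; rewrite /origF; lia. Qed.

Variables (x : seq bool) (y : nat -> nat -> content -> bool).
Notation nx := (size x).
Notation N := (sizeF nx).

Lemma row_envE n t p : ((row_env n t p 0 = n) * (row_env n t p 1 = t) * (row_env n t p 2 = p))%type.
Proof. by []. Qed.

Ltac clause_simpl :=
  rewrite /clause_true /lit_true /= ?tv_in_wit ?tvE /= ?evE /= ?row_envE -?leqNgt ?eqb_id ?eqbF_neg.

Ltac clause_cases := do ! [case/orP => [/and4P [? ? ? ?]|]]; try done; try lia.

Definition start_state (p : nat) : option (tm_state M) :=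
  if p == origF nx then Some (@tm_start M) else None.

Lemma start_blank p : p < N -> clause_true x y 0 p (cl_start) ->
  p < origF nx \/ wstartF nx + witF nx <= p -> y 0 p blank.
Proof.
have [S1 S2 S3 S4] := allowed_sizes nx.
move=> Hp; clause_simpl; rewrite /in_wit => /implyP H Hr.
by have {H} := H (ltac:(lia)); clause_cases.
Qed.

Lemma start_wit p : clause_true x y 0 p cl_start -> in_wit nx p ->
  [|| y 0 p blank, y 0 p (bitc true, None) | y 0 p (bitc false, None)].
Proof.
have [S1 S2 S3 S4] := allowed_sizes nx.
clause_simpl; rewrite /in_wit => /implyP H Hr.
have {H} := H (ltac:(lia)); clause_cases; do ? (move=> ->); rewrite ?orbT //.
Qed.

Lemma start_mark p : clause_true x y 0 p cl_start -> p = endF nx ->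
  y 0 p (bitc true, start_state p).
Proof.
have [S1 S2 S3 S4] := allowed_sizes nx.
clause_simpl; rewrite /in_wit /start_state => /implyP H Hr.
by have {H} := H (ltac:(lia)); case: (p == origF nx); clause_cases.
Qed.

Lemma start_sep p : clause_true x y 0 p cl_start -> p = endF nx + 1 -> y 0 p (bitc false, None).
Proof.
have [S1 S2 S3 S4] := allowed_sizes nx.
clause_simpl; rewrite /in_wit => /implyP H Hr.
by have {H} := H (ltac:(lia)); clause_cases.
Qed.

Lemma input_bit i d : i < nx -> clause_true x y i 0 (cl_input d) ->
  let p := origF nx + 2 * i + d in y 0 p (bitc (nth false x i), start_state p).
Proof.
move=> Hi; clause_simpl; rewrite Hi /= /start_state.
by case: (nth false x i); case: (_ == origF nx); clause_cases.
Qed.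

Lemma pad_next p : clause_true x y 0 p cl_pad -> in_wit nx p -> y 0 p blank -> y 0 p.+1 blank.
Proof.
clause_simpl; move=> /implyP H /H {H}; rewrite addn1 orbF => /orP [] /and3P [_ _] //.
by move=> /negP.
Qed.

Lemma window_next t p a b c : t.+1 < N -> clause_true x y t p (cl_window a b c) ->
  (if p == 0 then a == blank else y t p.-1 a) -> y t p b ->
  (if p.+1 < N then y t p.+1 c else c == blank) -> y t.+1 p (next_content a b c).
Proof.
move=> Ht; clause_simpl; rewrite !addn1 Ht /= => /implyP H Ha Hb Hc.
have {H} := H _; case: eqP Ha => [_ ->|_ Ha]; case: ltnP Hc => [_ Hc|_ ->] /=.
all: by move=> /(_ isT); rewrite ?Ha ?Hb ?Hc ?andbF ?orbF /= => /andP [].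
Qed.

Lemma final_good t p a b : t.+1 = N -> p.+1 < N -> clause_true x y t p (cl_final a b) ->
  y t p a -> y t p.+1 b -> ~~ bad_final a b.
Proof.
move=> Ht Hp; clause_simpl; rewrite !addn1 Ht Hp eqxx /= => /implyP H Ha Hb.
by apply/negP => /H; rewrite Ha Hb !andbF.
Qed.

Definition all_true : Prop := forall t p, t < N -> p < N -> all (clause_true x y t p) clauses.

Lemma all_true_at t p : all_true -> t < N -> p < N ->
  [/\ clause_true x y t p cl_start, forall d, d < 2 -> clause_true x y t p (cl_input d),
      clause_true x y t p cl_pad, forall a b c, clause_true x y t p (cl_window a b c) &
      forall a b, clause_true x y t p (cl_final a b)].
Proof.
move=> H Ht Hp; have := H t p Ht Hp; rewrite /clauses !all_cat !all_map.
case/and3P => /and5P [H1 H2 H3 H4 _] /allP H5 /allP H6; split=> //.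
- by case=> [|[|]].
- by move=> a b c; apply: (H5 (a, b, c)); rewrite -enumT mem_enum.
- by move=> a b; apply: (H6 (a, b)); rewrite -enumT mem_enum.
Qed.

Lemma all_true_intro :
  (forall t p, t < N -> p < N ->
   [/\ clause_true x y t p cl_start, forall d, d < 2 -> clause_true x y t p (cl_input d),
      clause_true x y t p cl_pad, forall a b c, clause_true x y t p (cl_window a b c) &
      forall a b, clause_true x y t p (cl_final a b)]) -> all_true.
Proof.
move=> H t p Ht Hp; have [H1 H2 H3 H4 H5] := H t p Ht Hp.
rewrite /clauses !all_cat !all_map; apply/and3P; split; try by apply/allP => u _ /=.
by apply/and5P; split=> //; apply: H2.
Qed.

Lemma nth_pair_str (w : seq bool) k : nth None [seq bitc b | b <- pair_str x w] k =
  if k < 2 * nx then bitc (nth false x k./2)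
  else if k == 2 * nx then bitc true else if k == 2 * nx + 1 then bitc false
  else if k < 2 * nx + 2 + size w then bitc (nth false w (k - (2 * nx + 2))) else None.
Proof.
have Hs : size (flatten [seq [:: b; b] | b <- x]) = 2 * nx.
  by elim: (x) => //= b s ->; lia.
have Hd j : nth false (flatten [seq [:: b; b] | b <- x]) j = nth false x j./2.
  by elim: (x) j => [|b s IH] [|[|j]] //=; rewrite ?nth_nil //= IH.
have Hsz : size (pair_str x w) = 2 * nx + 2 + size w by rewrite !size_cat Hs /=; lia.
have [Hk|Hk] := ltnP k (2 * nx + 2 + size w); last first.
  by rewrite nth_default ?size_map ?Hsz //; do ! (case: ifP; try lia).
rewrite (nth_map false) ?Hsz // /pair_str nth_cat Hs Hd.
case: ltnP => H1 //; case E : (k - 2 * nx) => [|[|j]] /=.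
- by case: eqP => //; lia.
- by case: eqP => [|_]; [lia | case: eqP => //; lia].
- by case: eqP => [|_]; [lia | case: eqP => [|_]; [lia | congr (bitc (nth _ _ _)); lia]].
Qed.


Lemma read_bits_true (h : tsy) (r : seq tsy) :
  read_bits (h :: r) = [:: true] <-> (h == bitc true) && ~~ is_bit (nth None r 0).
Proof.
case: h => [[[]|g]|] //=; case: r => [|[[b|g]|] r] //=.
Qed.

(** * Accepting runs and satisfying assignments of the clauses *)

Variable V : seq bool -> seq bool.
Hypothesis V_computed : forall s, exists t, t <= tc * size s ^ tk + tc /\ tm_runs M s t (V s).

Section Run.
Variable s : seq bool.
Hypothesis size_s : size s <= 2 * nx + 2 + witF nx.
Notation O := (origF nx).
Notation Hd := (hpos s O).
Notation cell t p := (cell_at (cfg s t) (Hd t) p).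

Lemma run_halts : exists t0, [/\ t0 <= timeF nx, @tm_halt M (state_of (cfg s t0)) &
  tm_output (cfg s t0) = V s].
Proof.
have [t [Ht]] := V_computed s; rewrite /tm_runs -/(cfg s t).
case E : (cfg s t) => [[[q l] h] r] [Hq Ho]; exists t; rewrite E; split=> //.
apply: leq_trans Ht _; rewrite /timeF leq_add2r leq_mul2l.
by apply/orP; right; case: (tk) => // k; rewrite leq_exp2r.
Qed.

Lemma head_range t : 0 < Hd t /\ (Hd t).+1 < N.
Proof.
have [S1 S2 S3 S4] := allowed_sizes nx; have [t0 [Ht0 Hh _]] := run_halts.
by have := @hpos_bound s O t0 (timeF nx) t Hh Ht0 (ltnW S1); lia.
Qed.

(** The right neighbour matters only if the head is on it, and the head stays away from the border;
    so there it may be taken as blank. *)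
Lemma cell_next t p : cell t.+1 p =
  next_content (if p == 0 then blank else cell t p.-1) (cell t p)
    (if p.+1 < N then cell t p.+1 else blank).
Proof.
have [H0 HN] := head_range t.
rewrite -[LHS]/(cell_at (tm_step (cfg s t)) (move_head (cfg s t) (Hd t)) p) cell_at_step //.
case: ltnP => // Hp; rewrite /next_content.
have -> : (cell t p.+1).2 = None by rewrite /cell_at /=; case: eqP => //; lia.
by [].
Qed.

Lemma accept_final : V s = [:: true] <->
  ~~ bad_final (cell N.-1 (Hd N.-1)) (cell N.-1 (Hd N.-1).+1).
Proof.
have [S1 S2 S3 S4] := allowed_sizes nx; have [t0 [Ht0 Hh Ho]] := run_halts.
have Hle : t0 <= N.-1 by lia.
have [-> _] := cfg_halted O Hh Hle; rewrite -Ho.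
case: (cfg s t0) Hh => [[[q l] h] r]; rewrite /state_of /= => Hq.
rewrite /bad_final /cell_at /state_of /= eqxx negbK Hq ltnn subnn ltnNge leqnSn subSnn /=.
exact: read_bits_true.
Qed.

Lemma cell_start p : cell 0 p = 
  (if p < O then None else nth None [seq bitc b | b <- s] (p - O), start_state p).
Proof. exact: cell_at_init. Qed.

End Run.

Lemma size_pair_str (w : seq bool) : size (pair_str x w) = 2 * nx + 2 + size w.
Proof.
rewrite !size_cat /=; suff -> : size (flatten [seq [:: b; b] | b <- x]) = 2 * nx by lia.
by elim: (x) => //= b s ->; lia.
Qed.

Lemma tableau_true (w : seq bool) : size w <= witF nx ->
  V (pair_str x w) = [:: true] ->
  (forall t p c, y t p c = (cell_at (cfg (pair_str x w) t) (hpos (pair_str x w) (origF nx) t) p == c)) ->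
  all_true.
Proof.
set s := pair_str x w => Hw Hacc Hy.
have [S1 S2 S3 S4] := allowed_sizes nx.
have size_s : size s <= 2 * nx + 2 + witF nx by rewrite size_pair_str leq_add2l.
have y0 p c : y 0 p c = ((if p < origF nx then None else
   nth None [seq bitc b | b <- s] (p - origF nx), start_state p) == c) by rewrite Hy cell_start.
have HN : 0 < N by lia.
apply: all_true_intro => t p Ht Hp; split.
- clause_simpl; rewrite /in_wit; apply/implyP => /andP [_ Hr]; rewrite HN Hp !y0 nth_pair_str.
  rewrite /start_state /blank.
  have [HpO|HpO] := ltnP p (origF nx).
    by rewrite /= ifF ?eqxx //; lia.
  have -> : (p - origF nx < 2 * nx) = false by lia.
  have -> : (p - origF nx == 2 * nx) = (p == endF nx) by lia.
  have -> : (p - origF nx == 2 * nx + 1) = (p == endF nx + 1) by lia.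
  case: (eqVneq p (endF nx)) => [E|H1].
    by case: (p == origF nx); rewrite /= ?eqxx ?orbT ?andbF.
  have -> : (p == origF nx) = false by lia.
  case: (eqVneq p (endF nx + 1)) => [E|H2]; first by rewrite eqxx /= ?orbT.
  have -> : wstartF nx <= p by lia.
  case: ltnP => Hq; last by [].
  have -> : p < wstartF nx + witF nx by lia.
  by case: (nth false w _).
- move=> d Hd; clause_simpl; rewrite !y0 nth_pair_str; apply/implyP => /andP [Hi _].
  have -> : (origF nx + 2 * t + d < origF nx) = false by lia.
  have -> : (origF nx + 2 * t + d < N) = true by lia.
  have -> : (origF nx + 2 * t + d - origF nx < 2 * nx) = true by lia.
  have -> : (origF nx + 2 * t + d - origF nx)./2 = t by lia.
  rewrite HN /start_state; case: (nth false x t) => /=;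
    by case: (_ == origF nx); rewrite /= ?eqxx ?orbT.
- clause_simpl; rewrite /in_wit addn1 !y0; apply/implyP => /andP [_ Hr].
  have -> : (p < origF nx) = false by lia.
  have -> : (p.+1 < origF nx) = false by lia.
  have -> : (p.+1 < N) = true by lia.
  rewrite HN Hp /= /start_state !nth_pair_str.
  have -> : (p == origF nx) = false by lia.
  have -> : (p.+1 == origF nx) = false by lia.
  by do ! (case: ifP => ?; try by []; try lia).
- move=> a b c; clause_simpl; rewrite !addn1; apply/implyP => /and3P [HT Ha Hc].
  rewrite HT Ht Hp !Hy (cell_next size_s) /=.
  case: (eqVneq _ b) => [<-|] //=; rewrite ?orbT //.
  case: (eqVneq p 0) Ha => [Ep|Hp0] /= Ha.
    case: ltnP Hc => [HpN|HpN] /= Hc.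
      by case: (eqVneq _ c) => [<-|] //=; rewrite (eqP Ha) eqxx ?orbT.
    by rewrite (eqP Ha) (eqP Hc) eqxx.
  have -> : p.-1 < N by lia.
  case: (eqVneq _ a) => [<-|] //=.
  case: ltnP Hc => [HpN|HpN] /= Hc; last by rewrite (eqP Hc) eqxx.
  by case: (eqVneq _ c) => [<-|] //=; rewrite eqxx ?orbT.
- move=> a b; clause_simpl; rewrite !addn1; apply/implyP => /and3P [/eqP HT HpN Hbad].
  rewrite Ht Hp HpN !Hy /=; apply/orP; rewrite orbF.
  case: (eqVneq _ a) => [Ea|]; last by left.
  case: (eqVneq _ b) => [Eb|]; last by right.
  have Et' : t = N.-1 by rewrite -HT.
  have := proj1 (accept_final size_s) Hacc; rewrite -Et'.
  have EH : p = hpos s (origF nx) t.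
    move: Hbad; rewrite /bad_final -Ea /cell_at /=; case: eqP => // _.
  by rewrite EH in Ea Eb; rewrite Ea Eb Hbad.
Qed.

(** The witness ends before the first cell of its area that holds [blank], and a cell with both bits
    is read as true. Induction over time puts the run on this witness inside [y], and the final
    clauses exclude rejection. *)
Lemma witness_of_tableau : all_true ->
  exists2 w, size w <= witF nx & V (pair_str x w) = [:: true].
Proof.
have [S1 S2 S3 S4] := allowed_sizes nx; have HN : 0 < N by lia.
move=> Hall.
pose isb q := y 0 (wstartF nx + q) blank.
pose len := find isb (iota 0 (witF nx)).
have Hlen : len <= witF nx by rewrite -[X in _ <= X](size_iota 0) find_size.
pose w := [seq y 0 (wstartF nx + q) (bitc true, None) | q <- iota 0 len].
have Hw : size w = len by rewrite size_map size_iota.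
exists w; first by rewrite Hw.
set s := pair_str x w.
have size_s : size s <= 2 * nx + 2 + witF nx by rewrite size_pair_str Hw leq_add2l.
have nonblank q : q < len -> ~~ isb q.
  by move=> Hq; have := before_find 0 Hq; rewrite nth_iota ?add0n => [->|]; last lia.
have padded q : len <= q -> q < witF nx -> isb q.
  move=> /subnKC <-; elim: (q - len) => [|k IH] Hk.
    rewrite addn0 in Hk *.
    have Hh : has isb (iota 0 (witF nx)) by rewrite has_find size_iota.
    by have := nth_find 0 Hh; rewrite -/len nth_iota.
  have Hk' : len + k < witF nx by lia.
  have Hp : wstartF nx + (len + k) < N by lia.
  have [_ _ Hpad _ _] := all_true_at Hall HN Hp.
  rewrite /isb !addnS; apply: pad_next Hpad _ (IH Hk').
  by rewrite /in_wit; lia.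
have init p : p < N -> y 0 p (cell_at (cfg s 0) (hpos s (origF nx) 0) p).
  move=> Hp; rewrite cell_start nth_pair_str Hw.
  have [Hst _ _ _ _] := all_true_at Hall HN Hp.
  have [HpO|HpO] := ltnP p (origF nx).
    have -> : start_state p = None by rewrite /start_state; case: eqP => //; lia.
    by apply: start_blank => //; left.
  have [H1|H1] := ltnP (p - origF nx) (2 * nx).
    have Hi : (p - origF nx)./2 < nx by lia.
    have HiN : (p - origF nx)./2 < N by lia.
    have [_ Hin _ _ _] := all_true_at Hall HiN HN.
    have Hodd : odd (p - origF nx) < 2 by case: odd.
    have /= := input_bit Hi (Hin _ Hodd).
    by have -> : origF nx + 2 * (p - origF nx)./2 + odd (p - origF nx) = p by lia.
  case: eqP => H2; first by apply: start_mark => //; lia.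
  have -> : start_state p = None by rewrite /start_state; case: eqP => //; lia.
  case: eqP => H3; first by apply: start_sep => //; lia.
  have [H4|H4] := ltnP p (wstartF nx + witF nx); last first.
    by rewrite ifF; [apply: start_blank => //; right | lia].
  have Hq : p = wstartF nx + (p - wstartF nx) by lia.
  have -> : p - origF nx - (2 * nx + 2) = p - wstartF nx by lia.
  have -> : (p - origF nx < 2 * nx + 2 + len) = (p - wstartF nx < len) by lia.
  case: ltnP => Hl; last first.
    by have := padded _ Hl; rewrite /isb -Hq; apply; lia.
  rewrite (nth_map 0) ?size_iota // nth_iota // add0n -Hq.
  have := nonblank _ Hl; rewrite /isb -Hq => /negbTE Hnb.
  have := start_wit Hst; rewrite Hnb /in_wit => /(_ _).
  case E : (y 0 p (bitc true, None)) => //= ->//; lia.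
have run t p : t < N -> p < N -> y t p (cell_at (cfg s t) (hpos s (origF nx) t) p).
  elim: t p => [|t IH] p Ht Hp; first exact: init.
  have Ht' := ltnW Ht; have [_ _ _ Hwin _] := all_true_at Hall Ht' Hp.
  rewrite cell_next //; apply: (window_next Ht (Hwin _ _ _)).
  - by case: eqP => // Hp0; apply: IH => //; lia.
  - exact: IH.
  - by case: ltnP => // HpN; apply: IH.
apply/(accept_final size_s).
have HN1 : N.-1 < N by lia.
have [H0 HH] := head_range size_s N.-1.
have [_ _ _ _ Hfin] := all_true_at Hall HN1 (ltnW HH).
by apply: (final_good _ HH (Hfin _ _)); [lia | apply: run; lia | apply: run].
Qed.

End Tableau.

(** * The clause set as a tap matrix *)

Lemma nth_flatten_pairs (T S : Type) (d : S) (f g : T -> S) (s : seq T) (x0 : T) b (e : bool) :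
  b < size s ->
  nth d (flatten [seq [:: f v; g v] | v <- s]) (b.*2 + e) =
  if e then g (nth x0 s b) else f (nth x0 s b).
Proof.
by elim: s b => [|v s IH] [|b] //=; [case: (e) | rewrite ltnS => /IH <-].
Qed.

Section Rows.
Variables (M : TM) (pc pk tc tk : nat) (x : seq bool).
Notation content := (option (bool + tm_aux M) * option (tm_state M))%type.
Notation N := (sizeF pc pk tc tk (size x)).
Notation cls := (clauses M pc pk tc tk).

Definition cell_vars : seq (nat * nat * content) :=
  [seq (tp, c) | tp <- [seq (t, p) | t <- iota 0 N, p <- iota 0 N], c <- enum {: content}].

(* Whether the literal (c, pol) of cell (variable 3, variable 4) occurs in the clause; an inapplicable
   clause gets all literals, which makes it a tautology. *)
Definition tapE (cl : clause M) (c : content) (pol : bool) : expr :=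
  foldr (fun l e =>
    if (lcell l == c) && (lsign l == pol)
    then EAdd (EMul (lguard l) (EMul (EEq (ltime l) (EVar 3)) (EEq (lpos l) (EVar 4)))) e
    else e) (ENot (capp cl)) (clits cl).

Definition cell_env (n t p t' p' : nat) : nat -> nat := upd (upd (row_env n t p) 3 t') 4 p'.

Definition tap_bit (t p : nat) (cl : clause M) (v : nat * nat * content) (pol : bool) : bool :=
  tv x (cell_env (size x) t p v.1.1 v.1.2) (tapE cl v.2 pol).

Definition clause_row (t p : nat) (cl : clause M) : seq bool :=
  flatten [seq [:: tap_bit t p cl v true; tap_bit t p cl v false] | v <- cell_vars].

Definition clause_rows : seq (seq bool) :=
  flatten [seq flatten [seq [seq clause_row t p cl | cl <- cls] | p <- iota 0 N] | t <- iota 0 N].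

Definition num_cells : nat := size cell_vars.
Definition num_rows : nat := size clause_rows.
Definition row_tap (i j : nat) : bool := nth false (nth [::] clause_rows i) j.

Lemma size_clause_row t p cl : size (clause_row t p cl) = num_cells.*2.
Proof. by rewrite /clause_row /num_cells; elim: cell_vars => //= v s ->. Qed.

Lemma num_cellsE : num_cells = N * N * #|{: content}|.
Proof. by rewrite /num_cells !size_allpairs !size_iota -cardE. Qed.

Lemma num_rowsE : num_rows = N * N * size cls.
Proof.
rewrite /num_rows /clause_rows.
have H (f : nat -> seq (seq bool)) s k : (forall i, size (f i) = k) ->
    size (flatten [seq f i | i <- s]) = size s * k.
  by move=> Hf; elim: s => //= i s IH; rewrite size_cat Hf IH mulSn.
rewrite (H _ _ (N * size cls)) ?size_iota ?mulnA // => t.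
by rewrite (H _ _ (size cls)) ?size_iota // => p; rewrite size_map.
Qed.

(** The last conjunct stands for membership in [cls], without an equality test on clauses. *)
Lemma row_mem i : i < num_rows -> exists t p cl, [/\ t < N, p < N,
  nth [::] clause_rows i = clause_row t p cl & forall P, all P cls -> P cl].
Proof.
move=> Hi; have := mem_nth [::] Hi; case/flatten_mapP => t; rewrite mem_iota => Ht.
case/flatten_mapP => p; rewrite mem_iota => Hp.
elim: cls => //= cl s IH; rewrite inE => /orP [/eqP ->|/IH].
  by exists t, p, cl; split=> // P /andP [].
by case=> t' [p' [cl' [Ht' Hp' E H]]]; exists t', p', cl'; split=> // P /andP [_ /H].
Qed.

Lemma tap_bitE t p cl t' p' c pol : clause_below cl ->
  let env := row_env (size x) t p in
  tap_bit t p cl (t', p', c) pol = ~~ tv x env (capp cl) ||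
    has (fun l => [&& tv x env (lguard l), eval x env (ltime l) == t', eval x env (lpos l) == p',
      lcell l == c & lsign l == pol]) (clits cl).
Proof.
case/andP => Hc Hl env; rewrite /tap_bit /tapE /=; set env' := cell_env _ _ _ _ _.
have Eenv e : below 3 e -> eval x env' e = eval x env e.
  by move=> He; apply: (eval_below x He) => -[|[|[|]]].
have Etv e : below 3 e -> tv x env' e = tv x env e by move=> He; rewrite /tv Eenv.
elim: (clits cl) Hl => [|l s IH] /=; first by rewrite tv_not Etv // orbF.
case/andP => /and3P [H1 H2 H3] /IH {}IH.
case: (lcell l == c); case: (lsign l == pol); rewrite /= ?andbF //=.
by rewrite tv_or IH !tv_and !tv_eq Etv // (Eenv (ltime l)) // (Eenv (lpos l)) // andbT orbCA.
Qed.

Lemma uniq_cell_vars : uniq cell_vars.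
Proof.
apply: allpairs_uniq; rewrite ?enum_uniq //; last by move=> [a b] [c d] _ _ [-> ->].
by apply: allpairs_uniq; rewrite ?iota_uniq // => -[a b] [c d] _ _ [-> ->].
Qed.

Lemma mem_cell_vars t p c : ((t, p, c) \in cell_vars) = (t < N) && (p < N).
Proof.
apply/allpairsP/andP => [[[tp c'] /= [/allpairsP [[t' p'] /= [H1 H2 ->]] _ [-> -> _]]]|[Ht Hp]].
  by move: H1 H2; rewrite !mem_iota.
exists ((t, p), c); split=> //; last by rewrite mem_enum.
by apply/allpairsP; exists (t, p); rewrite !mem_iota.
Qed.

Notation sat := (cnf_sat num_cells num_rows row_tap).
Definition default_var : nat * nat * content := (0, 0, (None, None)).

Lemma cnf_sat_of_tableau (y : nat -> nat -> content -> bool) : all_true pc pk tc tk x y -> sat.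
Proof.
move=> Hall; pose v j := nth default_var cell_vars j./2.
exists (fun j => y (v j).1.1 (v j).1.2 (v j).2 (+) odd j); split.
  by move=> k Hk; rewrite /v /= uphalf_double doubleK odd_double addbF addbT.
move=> i /row_mem [t [p [cl [Ht Hp E Hcl]]]].
have Hb := Hcl _ (clauses_below M pc pk tc tk); have := Hcl _ (Hall t p Ht Hp).
have bit t' p' c pol : t' < N -> p' < N -> tap_bit t p cl (t', p', c) pol -> y t' p' c = pol ->
    exists j, [/\ j < num_cells.*2, row_tap i j & y (v j).1.1 (v j).1.2 (v j).2 (+) odd j].
  move=> Ht' Hp' Hbit Hy; have Hin : (t', p', c) \in cell_vars by rewrite mem_cell_vars Ht' Hp'.
  pose b := index (t', p', c) cell_vars.
  have Hb' : b < num_cells by rewrite index_mem.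
  exists (b.*2 + ~~ pol); rewrite /row_tap E /clause_row /v.
  have -> : (b.*2 + ~~ pol)./2 = b by case: pol {Hbit Hy}; lia.
  rewrite (nth_flatten_pairs _ _ _ default_var) // nth_index //= Hy oddD odd_double /=.
  by split; [case: pol {Hbit Hy}; lia | case: pol Hbit {Hy} | case: pol {Hbit Hy}].
have HN : 0 < N by apply: leq_ltn_trans Ht.
rewrite /clause_true; case Ha : (tv _ _ (capp cl)) => /=; last first.
  by move=> _; apply: (bit 0 0 (None, None) (y 0 0 (None, None))) => //; rewrite tap_bitE // Ha.
move=> Hh.
have [l [Hl H1 H2 H3 H4]] : exists l : literal M, let env := row_env (size x) t p in
   [/\ has (fun l' => [&& tv x env (lguard l'), eval x env (ltime l') == eval x env (ltime l),
     eval x env (lpos l') == eval x env (lpos l), lcell l' == lcell l & lsign l' == lsign l]) (clits cl),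
     tv x env (lguard l), eval x env (ltime l) < N, eval x env (lpos l) < N &
     y (eval x env (ltime l)) (eval x env (lpos l)) (lcell l) = lsign l].
  elim: (clits cl) Hh => //= l s IH /orP [|/IH [l' [Hl' *]]]; last first.
    by exists l'; split=> //; rewrite Hl' orbT.
  by rewrite /lit_true => /and4P [G1 G2 G3 /eqP G4]; exists l; split=> //; rewrite G1 !eqxx.
by apply: (bit _ _ _ _ H2 H3 _ H4); rewrite tap_bitE // Ha.
Qed.

Lemma tableau_of_cnf_sat : sat -> exists y : nat -> nat -> content -> bool, all_true pc pk tc tk x y.
Proof.
case=> z [Hz Hsat].
pose y t p (c : content) := z (index (t, p, c) cell_vars).*2.
exists y => t p Ht Hp; pose Q cl := clause_true pc pk tc tk x y t p cl.
have Hin cl : clause_below cl -> clause_row t p cl \in clause_rows -> Q cl.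
  move=> Hb Hrow; have Hi : index (clause_row t p cl) clause_rows < num_rows by rewrite index_mem.
  have [j [Hj Htap Hzj]] := Hsat _ Hi; move: Htap; rewrite /row_tap nth_index //.
  have Hh : j./2 < num_cells by lia.
  have Ej : j = (j./2).*2 + odd j by rewrite addnC odd_double_half.
  rewrite /clause_row {1}Ej (nth_flatten_pairs _ _ _ default_var) //.
  case Ev : (nth default_var cell_vars j./2) => [[t' p'] c'].
  have Hv : index (t', p', c') cell_vars = j./2 by rewrite -Ev index_uniq // uniq_cell_vars.
  have := mem_nth default_var Hh; rewrite Ev mem_cell_vars => /andP [Ht' Hp'].
  have Hy : y t' p' c' = ~~ odd j.
    rewrite /y Hv; move: Hzj; rewrite {1}Ej; case: (odd j); rewrite ?addn0 ?addn1 // => Hzj.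
    by move: Hzj; rewrite Hz // => /negbTE.
  have -> : (if odd j then tap_bit t p cl (t', p', c') false else tap_bit t p cl (t', p', c') true)
     = tap_bit t p cl (t', p', c') (~~ odd j) by case: (odd j).
  rewrite tap_bitE // /Q /clause_true; case: (tv _ _ (capp cl)) => //=.
  elim: (clits cl) => //= l s IH /orP [|/IH ->]; last by rewrite orbT.
  by case/and5P => G1 /eqP G2 /eqP G3 /eqP G4 /eqP G5; rewrite /lit_true G1 G2 G3 G4 G5 /= Ht' Hp' Hy eqxx.
have Hrows : all (fun cl => clause_row t p cl \in clause_rows) cls.
  have H : {subset [seq clause_row t p cl | cl <- cls] <= clause_rows}.
    move=> r Hr; apply/flatten_mapP; exists t; rewrite ?mem_iota //.
    by apply/flatten_mapP; exists p; rewrite ?mem_iota.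
  elim: (cls) H => //= cl s IH H; rewrite H ?inE ?eqxx //=.
  by apply: IH => r Hr; apply: H; rewrite inE Hr orbT.
elim: (cls) (clauses_below M pc pk tc tk) Hrows => //= cl s IH /andP [Hb Hs] /andP [Hr Hrs].
by rewrite IH // andbT; apply: Hin.
Qed.

Lemma sizeF_gt0 : 0 < N.
Proof. by rewrite /sizeF addn2. Qed.

Lemma num_cells_gt0 : 0 < num_cells.
Proof.
rewrite num_cellsE !muln_gt0 !sizeF_gt0; apply/card_gt0P.
by exists ((None, None) : content).
Qed.

Lemma num_rows_gt0 : 0 < num_rows.
Proof. by rewrite num_rowsE !muln_gt0 !sizeF_gt0. Qed.

(** Row 0 is [cl_start] at cell (0, 0). It applies there and has only positive literals, so the
    negated columns are untapped; the one of [blank] at (0, 0) is taken. *)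
Lemma first_row_passes : exists2 j, j < num_cells.*2 & ~~ row_tap 0 j.
Proof.
have E : nth [::] clause_rows 0 = clause_row 0 0 (cl_start M pc pk tc tk).
  rewrite /clause_rows; have: forall (r : nat -> nat -> clause M -> seq bool) k, 0 < k ->
     nth [::] (flatten [seq flatten [seq [seq r t p cl | cl <- cls] | p <- iota 0 k] | t <- iota 0 k]) 0
     = r 0 0 (cl_start M pc pk tc tk) by move=> r [].
  by apply; apply: sizeF_gt0.
pose b := index (0, 0, (None, None) : content) cell_vars.
have Hin : (0, 0, (None, None) : content) \in cell_vars by rewrite mem_cell_vars sizeF_gt0.
have Hb : b < num_cells by rewrite index_mem.
exists (b.*2 + true); first lia.
rewrite /row_tap E /clause_row (nth_flatten_pairs _ _ _ default_var) // nth_index // tap_bitE; last first.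
  by have /andP [] := clauses_below M pc pk tc tk.
rewrite /= !tvE !evE /= /origF addn1 /=.
by rewrite !andbF.
Qed.

End Rows.

(** * Printing the instance *)

Definition gcat (s : seq gen) : gen := foldr GSeq GNil s.
Definition gword (w : seq bool) : gen := gcat (map GBit w).
Definition gnat (e : expr) : gen := GSeq (GFor e (GBit true)) (GBit false).

Section Geval.
Variables (x : seq bool) (d : nat) (env : nat -> nat).

Lemma geval_seq g1 g2 : geval x d env (GSeq g1 g2) = geval x d env g1 ++ geval x d env g2.
Proof. by []. Qed.
Lemma geval_if e g1 g2 : geval x d env (GIf e g1 g2) =
  if tv x env e then geval x d env g1 else geval x d env g2.
Proof. by []. Qed.
Lemma geval_for e g : geval x d env (GFor e g) =
  flatten [seq geval x d.+1 (upd env d i) g | i <- iota 0 (eval x env e)].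
Proof. by []. Qed.
Lemma geval_gcat s : geval x d env (gcat s) = flatten [seq geval x d env g | g <- s].
Proof. by elim: s => //= g s ->. Qed.
Lemma geval_gword w : geval x d env (gword w) = w.
Proof. by elim: w => //= b w IH; rewrite -[in RHS]IH. Qed.
Lemma geval_gnat e : geval x d env (gnat e) = enc_nat (eval x env e).
Proof.
rewrite /gnat /enc_nat -cats1 /=; congr (_ ++ _).
by elim: (eval x env e) 0 => //= k IH i; rewrite IH.
Qed.
End Geval.

(** Columns are printed in pairs because the mate of a crossover in row 0 depends on the parity of
    its column, for which the expressions have no test. *)
Lemma flatten_iota_double (T : Type) (f : nat -> seq T) k :
  flatten [seq f j | j <- iota 0 k.*2] = flatten [seq f i.*2 ++ f i.*2.+1 | i <- iota 0 k].
Proof.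
elim: k => // k IH; rewrite doubleS !(flatten_iotaS f) IH.
by rewrite (flatten_iotaS (fun i => f i.*2 ++ f i.*2.+1)) catA.
Qed.

Lemma flatten_allpairs (A B C T : Type) (f : C -> seq T) (g : A -> B -> C) (s : seq A) (t : seq B) :
  flatten [seq f v | v <- [seq g a b | a <- s, b <- t]] =
  flatten [seq flatten [seq f (g a b) | b <- t] | a <- s].
Proof. by elim: s => //= a s IH; rewrite map_cat flatten_cat IH -map_comp. Qed.

Lemma flatten_vertices (T : Type) (F : vtx -> seq T) h m :
  flatten [seq F v | v <- cb_vertices h m] =
  flatten [seq F (VL i) ++ flatten [seq flatten [seq F v | v <- block i j] | j <- iota 0 h.*2]
             ++ F (VC i) | i <- iota 0 m]
  ++ F BZ ++ flatten [seq F (BX j) | j <- iota 0 h.*2] ++ F BC.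
Proof.
rewrite /cb_vertices map_cat flatten_cat map_flatten flatten_flatten -!map_comp; congr (_ ++ _).
  congr flatten; apply: eq_map => i; rewrite /= map_cat flatten_cat map_flatten flatten_flatten.
  by rewrite -!map_comp /= cats0.
by rewrite /= map_cat flatten_cat -map_comp /= cats0.
Qed.

Section Labels.
Variable (T : Type) (F : gadget -> seq T).

(** [F] will be the code of a label as well as the code of a semilocal constraint, which is also
    determined by the label. *)
Definition block_code (b : bool) : seq T :=
  F Crossover ++ F (Fanout 2) ++ F (if b then AndGate else OrGate) ++ F FreeTerminal ++
  F (if b then OrGate else AndGate).

Definition row_code (r : seq bool) : seq T :=
  F (Fanout 2) ++ flatten [seq block_code b | b <- r] ++ F AndGate.

Lemma flatten_labels h (rows : seq (seq bool)) :
  all (fun r => size r == h.*2) rows ->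
  let tap i j := nth false (nth [::] rows i) j in
  flatten [seq F (vlabel tap v) | v <- cb_vertices h (size rows)] =
  flatten [seq row_code r | r <- rows] ++
  F FreeTerminal ++ flatten [seq F FreeTerminal | j <- iota 0 h.*2] ++ F FreeTerminal.
Proof.
move=> Hsz tap; rewrite (flatten_vertices (fun v => F (vlabel tap v))); congr (_ ++ _).
rewrite -[in RHS](mkseq_nth [::] rows) /mkseq -map_comp; congr flatten.
apply/eq_in_map => i; rewrite mem_iota => Hi; rewrite /= /row_code; congr (_ ++ (_ ++ _)).
have Hr : size (nth [::] rows i) = h.*2 by apply/eqP; apply: (allP Hsz); apply: mem_nth.
rewrite -[in RHS](mkseq_nth false (nth [::] rows i)) Hr /mkseq -map_comp; congr flatten.
by apply: eq_map => j; rewrite /= cats0.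
Qed.

End Labels.

Section Mates.
Variables (hE mE : expr).

Definition nE : expr := EMul (ECst 2) hE.
Definition rsE : expr := EAdd (EMul (ECst 14) nE) (ECst 6).
Definition leftN (i : expr) (k : nat) : expr := EAdd (EMul i rsE) (ECst k).
Definition blockN (i j : expr) (k : nat) : expr :=
  EAdd (EAdd (EMul i rsE) (ECst 3)) (EAdd (EMul j (ECst 14)) (ECst k)).
Definition chainN (i : expr) (k : nat) : expr :=
  EAdd (EAdd (EMul i rsE) (ECst 3)) (EAdd (EMul nE (ECst 14)) (ECst k)).
Definition bottomN (k : expr) : expr := EAdd (EMul mE rsE) k.

Definition left_mates (i : expr) : gen :=
  gcat [:: GIf i (gnat (leftN (EPred i) 2)) (gnat (chainN (ECst 0) 1));
           gnat (blockN i (ECst 0) 3);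
           GIf (ELt (ESucc i) mE) (gnat (leftN (ESucc i) 0)) (gnat (bottomN (ECst 0)))].

Definition chain_mates (i : expr) : gen :=
  gcat [:: gnat (blockN i (EPred nE) 13);
           GIf i (gnat (chainN (EPred i) 2)) (gnat (leftN (ECst 0) 0));
           GIf (ELt (ESucc i) mE) (gnat (chainN (ESucc i) 1)) (gnat (bottomN (ESucc nE)))].

(** Offsets in a block: [VX] 0 to 3, [VF] 4 to 6, [VG] 7 to 9, [VT] 10, [VH] 11 to 13. *)
Definition block_mates (i j : expr) (odd_col : bool) : gen :=
  gcat [:: GIf i (gnat (blockN (EPred i) j 6))
             (gnat (blockN (ECst 0) (if odd_col then EPred j else ESucc j) 0));
           gnat (blockN i j 12);
           gnat (blockN i j 4);
           GIf j (gnat (blockN i (EPred j) 13)) (gnat (leftN i 1));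
           gnat (blockN i j 2);
           gnat (blockN i j 8);
           GIf (ELt (ESucc i) mE) (gnat (blockN (ESucc i) j 0)) (gnat (bottomN (ESucc j)));
           gnat (blockN i j 10);
           gnat (blockN i j 5);
           gnat (blockN i j 11);
           gnat (blockN i j 7);
           gnat (blockN i j 9);
           gnat (blockN i j 1);
           GIf (ELt (ESucc j) nE) (gnat (blockN i (ESucc j) 3)) (gnat (chainN i 0))].

Definition mates_gen : gen :=
  gcat [:: GFor mE (gcat [:: left_mates (EVar 1);
              GFor hE (gcat [:: block_mates (EVar 1) (EMul (ECst 2) (EVar 2)) false;
                                block_mates (EVar 1) (ESucc (EMul (ECst 2) (EVar 2))) true]);
              chain_mates (EVar 1)]);
           gnat (leftN (EPred mE) 2);
           GFor nE (gnat (blockN (EPred mE) (EVar 1) 6));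
           gnat (chainN (EPred mE) 2)].

Variables (x : seq bool) (h m : nat).
Hypothesis h_gt0 : 0 < h.
Hypothesis m_gt0 : 0 < m.

Definition mates_code (v : vtx) : seq bool :=
  flatten [seq enc_nat (dart_num h m (cb_mate h m d)) | d <- darts_of v].

Section Env.
Variables (d : nat) (env : nat -> nat).
Hypothesis eval_h : eval x env hE = h.
Hypothesis eval_m : eval x env mE = m.

Lemma eval_nE : eval x env nE = h.*2.
Proof. by rewrite /= eval_h mul2n. Qed.

Lemma eval_rsE : eval x env rsE = row_darts h.
Proof. by rewrite -[LHS]/(14 * eval x env nE + 6) eval_nE. Qed.

Lemma eval_leftN i k : eval x env (leftN i k) = dart_num h m (VL (eval x env i), k).
Proof. by rewrite -[LHS]/(eval x env i * eval x env rsE + k) eval_rsE. Qed.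

Lemma eval_blockN i j k : eval x env (blockN i j k) =
  eval x env i * row_darts h + 3 + (eval x env j * 14 + k).
Proof. by rewrite -[LHS]/(eval x env i * eval x env rsE + 3 + _) eval_rsE. Qed.

Lemma eval_chainN i k : eval x env (chainN i k) = dart_num h m (VC (eval x env i), k).
Proof.
rewrite -[LHS]/(eval x env i * eval x env rsE + 3 + (eval x env nE * 14 + k)) eval_rsE eval_nE.
by rewrite /= !addnA.
Qed.

Lemma eval_bottomN k : eval x env (bottomN k) = m * row_darts h + eval x env k.
Proof. by rewrite -[LHS]/(eval x env mE * eval x env rsE + _) eval_rsE eval_m. Qed.

Definition numE := (eval_leftN, eval_blockN, eval_chainN, eval_bottomN).

Lemma eval_succ e : eval x env (ESucc e) = (eval x env e).+1.
Proof. by rewrite -[LHS]/(eval x env e + 1) addn1. Qed.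
Lemma eval_pred e : eval x env (EPred e) = (eval x env e).-1.
Proof. by []. Qed.
Lemma eval_cst c : eval x env (ECst c) = c.
Proof. by []. Qed.

Ltac mates_simpl :=
  rewrite geval_gcat /mates_code /darts_of;
  cbn [map vdegree iota flatten foldr];
  rewrite ?geval_if ?geval_gnat ?numE ?tv_lt ?eval_succ ?eval_pred ?eval_cst ?eval_nE ?eval_m /tv.

Lemma geval_left_mates i : geval x d env (left_mates i) = mates_code (VL (eval x env i)).
Proof.
rewrite /left_mates; mates_simpl; move: (eval x env i) => i'.
congr (_ ++ (_ ++ (_ ++ _))); try by congr enc_nat; rewrite /=; lia.
  by case: i'.
by rewrite /=; case: ifP => _; congr enc_nat; rewrite /=; lia.
Qed.

Lemma geval_chain_mates i : geval x d env (chain_mates i) = mates_code (VC (eval x env i)).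
Proof.
rewrite /chain_mates; mates_simpl; move: (eval x env i) => i'.
congr (_ ++ (_ ++ (_ ++ _))); try by congr enc_nat; rewrite /=; lia.
  by case: i'.
by rewrite /=; case: ifP => _; congr enc_nat; rewrite /=; lia.
Qed.

Lemma geval_block_mates i j (b : bool) : odd (eval x env j) = b ->
  geval x d env (block_mates i j b) =
  flatten [seq mates_code v | v <- block (eval x env i) (eval x env j)].
Proof.
move=> Hodd; have Epart : eval x env (if b then EPred j else ESucc j) = partner (eval x env j).
  by rewrite /partner Hodd; case: b {Hodd}; rewrite ?eval_succ.
rewrite /block_mates /block; cbn [map flatten foldr]; mates_simpl; rewrite Epart.
move: (eval x env i) (eval x env j) {Hodd Epart} => i' j'.
rewrite -!catA !cat0s; do ! congr (_ ++ _); try by congr enc_nat; rewrite /=; lia.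
- by case: i' => [|i'] /=; congr enc_nat; lia.
- by case: j' => [|j'] /=; congr enc_nat; lia.
- by rewrite /=; case: ifP => _; congr enc_nat; rewrite /=; lia.
- by rewrite /=; case: ifP => _; congr enc_nat; rewrite /=; lia.
Qed.

End Env.
Lemma geval_mates_gen n0 :
  (forall env, env 0 = n0 -> eval x env hE = h /\ eval x env mE = m) ->
  geval x 1 (env0 n0) mates_gen = flatten [seq mates_code v | v <- cb_vertices h m].
Proof.
move=> H; have [Hh Hm] := H (env0 n0) erefl.
rewrite /mates_gen geval_gcat flatten_vertices; cbn [map flatten foldr].
rewrite !geval_for !geval_gnat !(numE Hh Hm) !eval_pred Hm (eval_nE Hh).
congr (_ ++ _); last first.
  rewrite -[mates_code BZ]/(_ ++ [::]) -[mates_code BC]/(_ ++ [::]) !cats0.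
  congr (_ ++ (_ ++ _)); congr flatten; apply: eq_map => j.
  have [Hh' Hm'] := H (upd (env0 n0) 1 j) erefl.
  rewrite geval_gnat !(numE Hh' Hm') eval_pred Hm' -[mates_code _]/(_ ++ [::]) cats0.
  by congr enc_nat; rewrite /= /upd /=; lia.
congr flatten; apply: eq_map => i.
have [Hh' Hm'] := H (upd (env0 n0) 1 i) erefl.
rewrite geval_gcat; cbn [map flatten foldr].
rewrite (geval_left_mates _ Hh' Hm') (geval_chain_mates _ Hh' Hm') cats0 geval_for Hh'.
congr (_ ++ (_ ++ _)).
rewrite (flatten_iota_double (fun j => flatten [seq mates_code v | v <- block i j])).
congr flatten; apply: eq_map => k.
have [Hh2 Hm2] := H (upd (upd (env0 n0) 1 i) 2 k) erefl.
rewrite geval_gcat; cbn [map flatten foldr].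
rewrite !(geval_block_mates _ Hh2 Hm2) ?cats0 ?eval_succ.
- by rewrite [eval x _ (EMul _ _)]/= [eval x _ (EVar 1)]/= -mul2n.
- by rewrite /= /upd /=; lia.
- by rewrite /= /upd /=; lia.
Qed.

End Mates.

Definition code_label (g : gadget) : seq bool := enc_nat (gadget_code g).
Definition code_semi (g : gadget) : seq bool := enc_list (enc_list enc_bool) (gconstraint g).

Lemma enc_net (vT : eqType) (vs : seq vT) (g : vT -> gadget) (sm : vT * nat -> vT * nat) :
  let ds := net_darts vs g in
  enc_instance (net vs g sm) =
  enc_nat (size vs) ++ flatten [seq code_label (g v) | v <- vs] ++
  enc_nat (size ds) ++ flatten [seq enc_nat (index (sm d) ds) | d <- ds] ++
  enc_nat (size vs) ++ flatten [seq code_semi (g v) | v <- vs].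
Proof. by rewrite /enc_instance /enc_list /= !size_map -!map_comp -!catA. Qed.

(** * The generator of the reduction and the hardness theorem *)

Section Reduction.
Variables (M : TM) (pc pk tc tk : nat).
Notation content := (option (bool + tm_aux M) * option (tm_state M))%type.
Notation cls := (clauses M pc pk tc tk).
Notation NE := (sizeE pc pk tc tk).

Definition cellsE : expr := EMul (EMul NE NE) (ECst #|{: content}|).
Definition rowsE : expr := EMul (EMul NE NE) (ECst (size cls)).

Section LabelGen.
Variable F : gadget -> seq bool.

Definition block_gen (e : expr) : gen :=
  GIf e (gword (block_code F true)) (gword (block_code F false)).

(** Contents and clause schemes are finitely many for a fixed machine and are unrolled in the
    program. The two loops bind variables 3 and 4, which [tapE] reads. *)
Definition row_gen (cl : clause M) : gen :=
  gcat [:: gword (F (Fanout 2));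
           GFor NE (GFor NE (gcat [seq GSeq (block_gen (tapE cl c true)) (block_gen (tapE cl c false))
                                  | c <- enum {: content}]));
           gword (F AndGate)].

Definition labels_gen : gen :=
  gcat [:: GFor NE (GFor NE (gcat [seq row_gen cl | cl <- cls]));
           gword (F FreeTerminal); GFor (nE cellsE) (gword (F FreeTerminal)); gword (F FreeTerminal)].
End LabelGen.

Definition verticesE : expr :=
  EAdd (EAdd (EMul rowsE (EAdd (EMul (ECst 5) (nE cellsE)) (ECst 2))) (nE cellsE)) (ECst 2).
Definition dartsE : expr := EAdd (EAdd (EMul rowsE (rsE cellsE)) (nE cellsE)) (ECst 2).

Definition instance_gen : gen :=
  gcat [:: gnat verticesE; labels_gen code_label; gnat dartsE; mates_gen cellsE rowsE;
           gnat verticesE; labels_gen code_semi].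

Variable x : seq bool.
Notation N := (sizeF pc pk tc tk (size x)).
Notation h := (num_cells M pc pk tc tk x).
Notation m := (num_rows M pc pk tc tk x).
Notation tap := (@row_tap M pc pk tc tk x).
Notation env1 := (env0 (size x)).

Lemma eval_cellsE env : env 0 = size x -> eval x env cellsE = h.
Proof.
move=> E; rewrite -[LHS]/(eval x env NE * eval x env NE * _) eval_size E num_cellsE.
by [].
Qed.

Lemma eval_rowsE env : env 0 = size x -> eval x env rowsE = m.
Proof.
by move=> E; rewrite -[LHS]/(eval x env NE * eval x env NE * _) eval_size E num_rowsE.
Qed.

Lemma geval_row_gen F t p cl :
  geval x 3 (row_env (size x) t p) (row_gen F cl) = row_code F (clause_row pc pk tc tk x t p cl).
Proof.
rewrite /row_gen geval_gcat /row_code; cbn [map flatten foldr].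
rewrite !geval_gword cats0; congr (_ ++ (_ ++ _)).
have -> : flatten [seq block_code F b | b <- clause_row pc pk tc tk x t p cl] =
  flatten [seq block_code F (tap_bit x t p cl v true) ++ block_code F (tap_bit x t p cl v false)
          | v <- cell_vars M pc pk tc tk x].
  rewrite /clause_row map_flatten flatten_flatten -!map_comp; congr flatten.
  by apply: eq_map => v; rewrite /= cats0.
pose B v := block_code F (tap_bit x t p cl v true) ++ block_code F (tap_bit x t p cl v false).
rewrite -[LHS]/(geval _ _ _ _) -[RHS]/(flatten [seq B v | v <- cell_vars M pc pk tc tk x]) /cell_vars.
rewrite (flatten_allpairs B (fun tp (c : content) => (tp, c))).
rewrite (flatten_allpairs (fun tp => flatten [seq B (tp, c) | c <- enum {: content}]) (fun t p => (t, p))).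
rewrite geval_for eval_size; congr flatten; apply: eq_map => t'.
rewrite geval_for eval_size; congr flatten; apply: eq_map => p'.
rewrite geval_gcat -map_comp; congr flatten; apply: eq_map => c.
rewrite [LHS]geval_seq !geval_if !geval_gword /B /tap_bit.
by congr (_ ++ _); [case: (tv _ _ (tapE _ _ true)) | case: (tv _ _ (tapE _ _ false))].
Qed.

Lemma clause_rows_size : all (fun r => size r == h.*2) (clause_rows M pc pk tc tk x).
Proof.
apply/allP => r /flatten_mapP [t _] /flatten_mapP [p _].
by elim: cls => //= cl s IH; rewrite inE => /orP [/eqP ->|//]; rewrite size_clause_row.
Qed.

Lemma geval_labels_gen F :
  geval x 1 env1 (labels_gen F) = flatten [seq F (vlabel tap v) | v <- cb_vertices h m].
Proof.
rewrite (flatten_labels F clause_rows_size) /labels_gen geval_gcat; cbn [map flatten foldr].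
rewrite !geval_gword cats0 [geval _ _ _ (GFor (nE _) _)]geval_for (eval_nE (eval_cellsE erefl)).
congr (_ ++ (_ ++ (_ ++ _))); last by congr flatten; apply: eq_map => j; rewrite geval_gword.
rewrite /clause_rows map_flatten flatten_flatten -!map_comp.
rewrite geval_for eval_size; congr flatten; apply: eq_map => t.
rewrite -[RHS]/(flatten [seq row_code F r | r <-
  flatten [seq [seq clause_row pc pk tc tk x t p cl | cl <- cls] | p <- iota 0 N]]).
rewrite map_flatten flatten_flatten -!map_comp geval_for eval_size.
congr flatten; apply: eq_map => p.
rewrite -[RHS]/(flatten [seq row_code F r | r <- [seq clause_row pc pk tc tk x t p cl | cl <- cls]]).
rewrite geval_gcat -!map_comp; congr flatten; apply: eq_map => cl.
exact: geval_row_gen.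
Qed.

Definition reduction_instance : instance :=
  net (cb_vertices h m) (vlabel tap) (cb_mate h m).

Lemma geval_instance_gen : geval x 1 env1 instance_gen = enc_instance reduction_instance.
Proof.
have Hh := num_cells_gt0 M pc pk tc tk x; have Hm := num_rows_gt0 M pc pk tc tk x.
have Eh : eval x env1 cellsE = h by apply: eval_cellsE.
have Em : eval x env1 rowsE = m by apply: eval_rowsE.
have EV : eval x env1 verticesE = size (cb_vertices h m).
  rewrite -[LHS]/(eval x env1 rowsE * (5 * eval x env1 (nE cellsE) + 2) + eval x env1 (nE cellsE) + 2).
  by rewrite Em (eval_nE Eh) size_vertices.
have ED : eval x env1 dartsE = size (net_darts (cb_vertices h m) (vlabel tap)).
  rewrite -[LHS]/(eval x env1 rowsE * eval x env1 (rsE cellsE) + eval x env1 (nE cellsE) + 2).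
  by rewrite Em (eval_nE Eh) (eval_rsE Eh) size_darts.
rewrite /instance_gen geval_gcat; cbn [map flatten foldr].
rewrite !geval_gnat !geval_labels_gen EV ED cats0.
rewrite (@geval_mates_gen _ _ x h m) //; last by move=> env E; rewrite eval_cellsE ?eval_rowsE.
rewrite enc_net; congr (_ ++ (_ ++ (_ ++ (_ ++ _)))).
have -> : [seq enc_nat (index (cb_mate h m d) (net_darts (cb_vertices h m) (vlabel tap)))
            | d <- net_darts (cb_vertices h m) (vlabel tap)] =
  [seq enc_nat (dart_num h m (cb_mate h m d)) | d <- net_darts (cb_vertices h m) (vlabel tap)].
  apply/eq_in_map => d Hd; congr enc_nat; apply: index_dart_num => //.
  exact: cb_mate_in.
by rewrite cb_dartsE map_flatten flatten_flatten -!map_comp.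
Qed.

End Reduction.

Theorem mainTheorem6 : coNP_hard_promise PGO_YES PGO_NO.
Proof.
move=> L [V [pc [pk [[M [tc [tk HV]]] HL]]]].
exists (fun x => geval x 1 (env0 (size x)) (instance_gen M pc pk tc tk)); split.
  exact: gen_poly.
move=> x; rewrite geval_instance_gen.
have Hh := num_cells_gt0 M pc pk tc tk x; have Hm := num_rows_gt0 M pc pk tc tk x.
pose sat := cnf_sat (num_cells M pc pk tc tk x) (num_rows M pc pk tc tk x) (@row_tap M pc pk tc tk x).
(* The verifier belongs to the complement of [L], so satisfiability marks the NO instances. *)
have Hsat : sat <-> ~ L x.
  split=> [/tableau_of_cnf_sat [y Hy]|/HL [w [Hw Hacc]]].
    by apply/HL; have [w Hw Hacc] := witness_of_tableau HV Hy; exists w.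
  pose s := pair_str x w.
  pose y t p c := cell_at (cfg M s t) (hpos M s (origF pc pk tc tk (size x)) t) p == c.
  by apply: (@cnf_sat_of_tableau _ _ _ _ _ _ y); apply: (tableau_true HV Hw Hacc).
split=> HLx.
  exists (reduction_instance M pc pk tc tk x); split=> //.
  - exact: cb_valid.
  - exact: (net_promise BZ).
  - by apply: cb_cond_a => // /Hsat.
have [j Hj Hp] := first_row_passes M pc pk tc tk x.
have [Hb Ha] := cb_cond_b Hm Hh Hj Hp (proj2 Hsat HLx).
exists (reduction_instance M pc pk tc tk x); split=> //.
- exact: cb_valid.
- exact: (net_promise BZ).
Qed.
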